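(* Let $K$ be a field and let $\theta$ be a unital action of an inverse monoid $S$ on a unital associative $K$-algebra $A$. Assume that $(A\rtimes_\theta S)^e$ is flat as a right $A^e$-module. Then for any $A\rtimes_\theta S$-bimodule $M$ there exists a third quadrant cohomology spectral sequence $$E^{p,q}_2=H^p(S,H^q(A,M))\Rightarrow H^{p+q}(A\rtimes_\theta S,M).$$
   Context: Inverse monoids and actions. For an inverse monoid $S$, $E(S)$ is its set of idempotents, $s\le t$ means $s=et$ for some $e\in E(S)$, and $KS$, $KE(S)$ are the semigroup algebras (free $K$-modules on $S$, $E(S)$ with the multiplication extended linearly). $\mathcal I(A)$ is the symmetric inverse monoid of all bijections between subsets of $A$. A unital action of $S$ on $A$ is a semigroup homomorphism $\theta:S\to\mathcal I(A)$, $s\mapsto\theta_s$, such that the domain and range of each $\theta_s$ are ideals of $A$, $\theta_s$ is an isomorphism of $K$-algebras from its domain onto its range, $\theta_{1_S}=\mathrm{id}_A$, and the range of $\theta_s$ is $1_sA$ for some central idempotent $1_s$ of $A$ (so $\theta_s:1_{s^{-1}}A\to 1_sA$). Crossed product. $L(A,\theta,S)=\bigoplus_{s\in S}1_sA\,\delta_s$ ($\delta_s$ are symbols) with product $a\delta_s\cdot b\delta_t=a\,\theta_s(1_{s^{-1}}b)\,\delta_{st}$ is an associative $K$-algebra; $\mathcal N$ is its ideal generated by all $a\delta_s-a\delta_t$ with $s\le t$ and $a\in 1_sA$. The crossed product is $A\rtimes_\theta S=L(A,\theta,S)/\mathcal N$; $\overline w$ denotes the class of $w$. The map $A\to A\rtimes_\theta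 S$, $a\mapsto\overline{a\delta_1}$, is an injective homomorphism of unital algebras; through it $A$ is regarded as a subalgebra of $A\rtimes_\theta S$ and any $A\rtimes_\theta S$-bimodule is an $A$-bimodule. Bimodules and Hochschild cohomology. For a unital $K$-algebra $R$, $R^e=R\otimes_K R^{\mathrm{op}}$; $R$-bimodules are identified with left $R^e$-modules by $(a\otimes b)\cdot x=axb$. For an $R$-bimodule $M$, $H^n(R,M)=\operatorname{Ext}^n_{R^e}(R,M)$. The right $A^e$-module structure on $(A\rtimes_\theta S)^e$ is $(x\otimes y)\cdot(a\otimes b)=xa\otimes by$ (products $xa$, $by$ taken in $A\rtimes_\theta S$). $KS$-module structures. $A$ is a left $KS$-module by $s\cdot a=\theta_s(1_{s^{-1}}a)$. An $A\rtimes_\theta S$-bimodule $M$ is a left $KS$-module by $s\cdot x=\overline{1_s\delta_s}\cdot x\cdot\overline{1_{s^{-1}}\delta_{s^{-1}}}$. Then $\operatorname{Hom}_{A^e}(A,M)$ is a left $KS$-module by $(s\cdot f)(a)=s\cdot f(s^{-1}\cdot a)$; this gives a left exact functor $T_1=\operatorname{Hom}_{A^e}(A,-)$ from left $(A\rtimes_\theta S)^e$-modules to left $KS$-modules. Under the flatness hypothesis, injective resolutions of $M$ over $(A\rtimes_\theta S)^e$ are injective resolutions over $A^e$, so the underlying $K$-module of the right derived functor $(R^qT_1)M$ is $\operatorname{Ext}^q_{A^e}(A,M)=H^q(A,M)$; $H^q(A,M)$ carries the left $KS$-module structure of $(R^qT_1)M$. Cohomology of $S$. $KE(S)$ is a left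 $KS$-module by $s\cdot e=ses^{-1}$ ($e\in E(S)$, $s\in S$). For a left $KS$-module $V$, $H^n(S,V)=\operatorname{Ext}^n_{KS}(KE(S),V)$. *)

(* Defs.v *)
From HB Require Import structures.
From mathcomp Require Import all_boot all_order all_algebra finmap.
From mathcomp Require Import monalg.
From mathcomp Require Import boolp classical_sets functions.

Set Implicit Arguments.
Unset Strict Implicit.
Unset Printing Implicit Defensive.

Import GRing.Theory.
Local Open Scope ring_scope.

(* An associative unital K-algebra, given as a ring A with its structure map
   K -> A, k |-> k 1, which lands in the centre; unlike algType, the zero ring
   is allowed. *)
HB.mixin Record PzRing_isUnitalAlgebra (K : pzRingType) A of GRing.PzRing A := {
  scal : K -> A;
  scal_additive : additive scal;
  scal_monoid_morphism : monoid_morphism scal;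
  scalC : forall k x, scal k * x = x * scal k
}.

#[short(type="ualgType")]
HB.structure Definition UnitalAlgebra (K : pzRingType) :=
  { A of PzRing_isUnitalAlgebra K A & GRing.PzRing A }.

Section ScalMorphism.
Variables (K : pzRingType) (A : ualgType K).
HB.instance Definition _ :=
  GRing.isAdditive.Build K A (@scal K A) (@scal_additive K A).
HB.instance Definition _ :=
  GRing.isMonoidMorphism.Build K A (@scal K A) (@scal_monoid_morphism K A).
End ScalMorphism.

Lemma morphD_additive (U V : zmodType) (f : U -> V) :
  {morph f : x y / x + y} -> additive f.
Proof. by move=> fD x y; apply: (addIr (f y)); rewrite -fD !subrK. Qed.

(* Submodules are Prop-valued; subm P is the submodule as a type, quo P the
   quotient by it. *)
Section Submodules.
Variables (R : pzRingType) (V : lmodType R).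

Record submod := Submod {
  smem :> V -> Prop;
  smem0 : smem 0;
  smemD : forall x y, smem x -> smem y -> smem (x + y);
  smemZ : forall (a : R) x, smem x -> smem (a *: x) }.

Lemma smemN (P : submod) x : P x -> P (- x).
Proof. by rewrite -scaleN1r; apply: smemZ. Qed.

Lemma smemB (P : submod) x y : P x -> P y -> P (x - y).
Proof. by move=> Px /smemN; apply: smemD. Qed.

Lemma smem_sum (P : submod) (I : Type) (r : seq I) (F : I -> V) :
  (forall i, P (F i)) -> P (\sum_(i <- r) F i).
Proof.
move=> PF; elim: r => [|i r IH]; first by rewrite big_nil; apply: smem0.
by rewrite big_cons; apply: smemD.
Qed.

Definition subm_pred (P : submod) : {pred V} := fun x => `[< P x >].
Definition subm (P : submod) := {x : V | x \in subm_pred P}.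

Lemma subm_closed (P : submod) : submod_closed (subm_pred P).
Proof.
split=> [|a x y]; first exact/asboolP/smem0.
by rewrite !unfold_in => /asboolP Px /asboolP Py; apply/asboolP/smemD => //; apply: smemZ.
Qed.

HB.instance Definition _ (P : submod) := GRing.isSubmodClosed.Build R V (subm_pred P) (subm_closed P).
HB.instance Definition _ (P : submod) := SubType.copy (subm P) {x : V | x \in subm_pred P}.
HB.instance Definition _ (P : submod) := [Choice of subm P by <:].
HB.instance Definition _ (P : submod) := [SubChoice_isSubLmodule of subm P by <:].

Definition incl (P : submod) : subm P -> V := val.

Lemma inclP (P : submod) (x : subm P) : P (incl x).
Proof. exact/asboolP/(valP x). Qed.

Definition mksub (P : submod) x (Px : P x) : subm P := Sub x (introT (asboolP (P x)) Px).

Lemma inclK (P : submod) x (Px : P x) : incl (mksub Px) = x.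
Proof. exact: SubK. Qed.

Lemma incl_inj (P : submod) : injective (@incl P).
Proof. exact: val_inj. Qed.

Lemma incl_is_linear (P : submod) : linear (@incl P).
Proof. exact: linearP. Qed.
HB.instance Definition _ (P : submod) :=
  GRing.isLinear.Build R (subm P) V _ (@incl P) (@incl_is_linear P).

(* the least submodule containing G *)
Definition spanP (G : V -> Prop) x := forall P : submod, (forall y, G y -> P y) -> P x.

Lemma span0 G : spanP G 0. Proof. by move=> P _; apply: smem0. Qed.
Lemma spanD G x y : spanP G x -> spanP G y -> spanP G (x + y).
Proof. by move=> Gx Gy P GP; apply: smemD; [apply: Gx | apply: Gy]. Qed.
Lemma spanZ G a x : spanP G x -> spanP G (a *: x).
Proof. by move=> Gx P GP; apply/smemZ/Gx. Qed.

Definition span (G : V -> Prop) := Submod (@span0 G) (@spanD G) (@spanZ G).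

Lemma span_gen (G : V -> Prop) x : G x -> span G x.
Proof. by move=> Gx P; apply. Qed.

End Submodules.

Section Quotients.
Variables (R : pzRingType) (V : lmodType R) (P : submod V).

Definition qrel : rel V := fun x y => `[< P (x - y) >].
Lemma qrel_refl : reflexive qrel.
Proof. by move=> x; apply/asboolP; rewrite subrr; apply: smem0. Qed.
Lemma qrel_sym : symmetric qrel.
Proof.
by move=> x y; apply/asboolP/asboolP => /smemN; rewrite opprB.
Qed.
Lemma qrel_trans : transitive qrel.
Proof.
move=> y x z /asboolP Pxy /asboolP Pyz; apply/asboolP.
by rewrite -[x](subrK y) -addrA; apply: smemD.
Qed.

Definition qequiv := EquivRel qrel qrel_refl qrel_sym qrel_trans.
Definition quo : Type := {eq_quot qequiv}%qT.
HB.instance Definition _ := Choice.copy quo {eq_quot qequiv}%qT.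

Definition proj : V -> quo := \pi_({eq_quot qequiv})%qT.
Definition lrep : quo -> V := @repr V {eq_quot qequiv}%qT.

Lemma lrepK : cancel lrep proj. Proof. exact: reprK. Qed.

Lemma projP x y : (proj x = proj y) <-> P (x - y).
Proof.
split; first by move=> /(@eqmodP _ qequiv) /asboolP.
by move=> Pxy; apply/(@eqmodP _ qequiv)/asboolP.
Qed.

Lemma lrep_proj x : P (lrep (proj x) - x).
Proof. by apply/projP; rewrite lrepK. Qed.

Lemma proj_surj q : exists x, q = proj x.
Proof. by exists (lrep q); rewrite lrepK. Qed.

Definition qadd q r := proj (lrep q + lrep r).
Definition qopp q := proj (- lrep q).
Definition qscale a q := proj (a *: lrep q).

Lemma qaddE x y : qadd (proj x) (proj y) = proj (x + y).
Proof. by apply/projP; rewrite opprD addrACA; apply: smemD; apply: lrep_proj. Qed.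
Lemma qoppE x : qopp (proj x) = proj (- x).
Proof. by apply/projP; rewrite -opprD; apply: smemN; apply: lrep_proj. Qed.
Lemma qscaleE a x : qscale a (proj x) = proj (a *: x).
Proof. by apply/projP; rewrite -scalerBr; apply: smemZ; apply: lrep_proj. Qed.

Lemma qaddA : associative qadd.
Proof.
move=> a b c; have [[[x ->] [y ->]] [z ->]] := (proj_surj a, proj_surj b, proj_surj c).
by rewrite !qaddE addrA.
Qed.
Lemma qaddC : commutative qadd.
Proof. by move=> a b; rewrite /qadd addrC. Qed.
Lemma qadd0 : left_id (proj 0) qadd.
Proof. by move=> a; have [x ->] := proj_surj a; rewrite qaddE add0r. Qed.
Lemma qaddN : left_inverse (proj 0) qopp qadd.
Proof. by move=> a; have [x ->] := proj_surj a; rewrite qoppE qaddE addNr. Qed.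

HB.instance Definition _ := GRing.isZmodule.Build quo qaddA qaddC qadd0 qaddN.

Lemma projD x y : proj (x + y) = proj x + proj y. Proof. by rewrite -qaddE. Qed.

Lemma qscaleA a b q : qscale a (qscale b q) = qscale (a * b) q.
Proof. by have [x ->] := proj_surj q; rewrite !qscaleE scalerA. Qed.
Lemma qscale1 : left_id 1 qscale.
Proof. by move=> q; have [x ->] := proj_surj q; rewrite !qscaleE scale1r. Qed.
Lemma qscaleDr : right_distributive qscale +%R.
Proof.
move=> a q r; have [[x ->] [y ->]] := (proj_surj q, proj_surj r).
by rewrite -projD !qscaleE -projD scalerDr.
Qed.
Lemma qscaleDl q : {morph qscale^~ q : a b / a + b}.
Proof. by move=> a b; have [x ->] := proj_surj q; rewrite !qscaleE -projD scalerDl. Qed.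

HB.instance Definition _ := GRing.Zmodule_isLmodule.Build R quo
  qscaleA qscale1 qscaleDr qscaleDl.

Lemma proj_is_linear : linear proj.
Proof. by move=> a x y; rewrite projD -qscaleE. Qed.
HB.instance Definition _ := GRing.isLinear.Build R V quo _ proj proj_is_linear.

Lemma proj_eq0 x : (proj x = 0) <-> P x.
Proof. by rewrite -[0](linear0 proj) projP subr0. Qed.

Section Lift.
Variables (W : lmodType R) (f : {linear V -> W}).
Definition qlift (q : quo) : W := f (lrep q).
Hypothesis fP : forall x, P x -> f x = 0.
Lemma qliftE x : qlift (proj x) = f x.
Proof. by apply/eqP; rewrite -subr_eq0 -linearB fP //; apply: lrep_proj. Qed.
Lemma qlift_is_linear : linear qlift.
Proof.
move=> a q r; have [[x ->] [y ->]] := (proj_surj q, proj_surj r).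
by rewrite -proj_is_linear !qliftE linearP.
Qed.
End Lift.
End Quotients.

(* restriction of scalars along phi *)
Definition res (R R' : pzRingType) (phi : {rmorphism R -> R'}) (M : lmodType R')
  : Type := M.

Section Restriction.
Variables (R R' : pzRingType) (phi : {rmorphism R -> R'}) (M : lmodType R').
Local Notation res := (res phi M).
HB.instance Definition _ := GRing.Zmodule.copy res M.
Definition rscale (a : R) (x : res) : res := phi a *: (x : M).
Lemma rscaleA a b x : rscale a (rscale b x) = rscale (a * b) x.
Proof. by rewrite /rscale scalerA rmorphM. Qed.
Lemma rscale1 : left_id 1 rscale.
Proof. by move=> x; rewrite /rscale rmorph1 scale1r. Qed.
Lemma rscaleDr : right_distributive rscale +%R.
Proof. by move=> a x y; rewrite /rscale scalerDr. Qed.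
Lemma rscaleDl x : {morph rscale^~ x : a b / a + b}.
Proof. by move=> a b; rewrite /rscale rmorphD scalerDl. Qed.
HB.instance Definition _ := GRing.Zmodule_isLmodule.Build R res
  rscaleA rscale1 rscaleDr rscaleDl.
Lemma resE a (x : res) : a *: x = (phi a *: (x : M)) :> M. Proof. by []. Qed.
End Restriction.

Definition mkLinear (R : pzRingType) (V W : lmodType R) (f : V -> W)
    (fL : linear f) : {linear V -> W} :=
  HB.pack f (GRing.isLinear.Build R V W _ f fL).

Lemma lin_eq (R : pzRingType) (V W : lmodType R) (f g : {linear V -> W}) :
  f =1 g -> f = g.
Proof.
move=> /funext; case: f g => [f [[fA] [fB]]] [g [[gA] [gB]]] /= fg.
by case: _ / fg in gA gB *; rewrite (Prop_irrelevance fA gA) (Prop_irrelevance fB gB).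
Qed.

Definition lmod_iso (R : pzRingType) (V W : lmodType R) : Prop :=
  exists f : {linear V -> W}, bijective f.

Section Subquotients.
Variables (R : pzRingType) (V : lmodType R) (Z B : submod V).

Definition subquo_rel (x : subm Z) : Prop := B (incl x).
Lemma subquo_rel0 : subquo_rel 0.
Proof. by rewrite /subquo_rel linear0; apply: smem0. Qed.
Lemma subquo_relD x y : subquo_rel x -> subquo_rel y -> subquo_rel (x + y).
Proof. by rewrite /subquo_rel linearD; apply: smemD. Qed.
Lemma subquo_relZ a x : subquo_rel x -> subquo_rel (a *: x).
Proof. by rewrite /subquo_rel linearZ; apply: smemZ. Qed.

(* the image of Z in V / B, i.e. Z / (Z \cap B) *)
Definition subquo : lmodType R := quo (Submod subquo_rel0 subquo_relD subquo_relZ).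
End Subquotients.

Section Kernels.
Variables (R : pzRingType) (V W : lmodType R) (f : {linear V -> W}).
Lemma ker0 : f 0 = 0. Proof. exact: linear0. Qed.
Lemma kerD x y : f x = 0 -> f y = 0 -> f (x + y) = 0.
Proof. by move=> fx fy; rewrite linearD fx fy addr0. Qed.
Lemma kerZ a x : f x = 0 -> f (a *: x) = 0.
Proof. by move=> fx; rewrite linearZ /= fx scaler0. Qed.
Definition kerm := @Submod R V (fun x => f x = 0) ker0 kerD kerZ.

Lemma im0 : exists x, 0 = f x. Proof. by exists 0; rewrite linear0. Qed.
Lemma imD u v : (exists x, u = f x) -> (exists x, v = f x) -> exists x, u + v = f x.
Proof. by case=> x -> [y ->]; exists (x + y); rewrite linearD. Qed.
Lemma imZ a u : (exists x, u = f x) -> exists x, a *: u = f x.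
Proof. by case=> x ->; exists (a *: x); rewrite linearZ. Qed.
Definition imm := @Submod R W (fun u => exists x, u = f x) im0 imD imZ.
End Kernels.

Definition zerosub (R : pzRingType) (V : lmodType R) : submod V :=
  kerm (idfun : {linear V -> V}).

Record cocomplex (R : pzRingType) := Cocomplex {
  ob :> nat -> lmodType R;
  dif : forall n, {linear ob n -> ob n.+1};
  dif_dif : forall n (x : ob n), dif n.+1 (dif n x) = 0 }.

Section Cohomology.
Variables (R : pzRingType) (C : cocomplex R).
Definition cocycles n : submod (C n) := kerm (dif C n).
Definition coboundaries n : submod (C n) :=
  match n with 0%N => zerosub (C 0%N) | m.+1 => imm (dif C m) end.
Definition cohomology n : lmodType R := subquo (cocycles n) (coboundaries n).
End Cohomology.

(* additive covariant functors from R-modules to R'-modules *)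
Record modfunctor (R R' : pzRingType) := ModFunctor {
  fob :> lmodType R -> lmodType R';
  fmap : forall M N : lmodType R, {linear M -> N} -> {linear fob M -> fob N};
  fmap_id : forall (M : lmodType R) x, fmap (idfun : {linear M -> M}) x = x;
  fmap_comp : forall (M N P : lmodType R) (g : {linear N -> P}) (f : {linear M -> N}) x,
    fmap (g \o f : {linear M -> P}) x = fmap g (fmap f x);
  fmap_add : forall (M N : lmodType R) (f g : {linear M -> N}) x,
    fmap (f \+ g : {linear M -> N}) x = fmap f x + fmap g x }.

Section MapComplex.
Variables (R R' : pzRingType) (T : modfunctor R R') (C : cocomplex R).

Lemma fmap0 (M N : lmodType R) x : fmap T (\0 : {linear M -> N}) x = 0.
Proof.
apply: (addrI (fmap T \0 x)); rewrite -fmap_add addr0; congr (fmap T _ x).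
by apply: lin_eq => y /=; rewrite addr0.
Qed.

Lemma fmap_dif_dif n (x : T (C n)) : fmap T (dif C n.+1) (fmap T (dif C n) x) = 0.
Proof.
rewrite -fmap_comp -(fmap0 _ x); congr (fmap T _ x).
by apply: lin_eq => y /=; rewrite dif_dif.
Qed.

Definition map_cocomplex : cocomplex R' :=
  Cocomplex fmap_dif_dif.
End MapComplex.

Definition injective_module (R : pzRingType) (I : lmodType R) : Prop :=
  forall (N N' : lmodType R) (i : {linear N -> N'}) (f : {linear N -> I}),
    injective i -> exists g : {linear N' -> I}, forall x, g (i x) = f x.

Record injective_resolution (R : pzRingType) (M : lmodType R) := InjectiveResolution {
  ires :> cocomplex R;
  iaug : {linear M -> ires 0%N};
  iaug_inj : injective iaug;
  ires_exact0 : forall x, dif ires 0 x = 0 <-> exists m, x = iaug m;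
  ires_exact : forall n x, dif ires n.+1 x = 0 <-> exists y, x = dif ires n y;
  ires_injective : forall n, injective_module (ires n) }.

Section ExtendLinear.
Local Open Scope classical_set_scope.
Variables (K : fieldType) (U W V : lmodType K) (i : {linear U -> W}) (f : {linear U -> V}).
Hypothesis iI : injective i.

Let base : set (W * V) := [set p | exists u, p = (i u, f u)].
Let good (G : set (W * V)) :=
  [/\ base `<=` G, forall v, G (0, v) -> v = 0 &
      forall a x y, G x -> G y -> G (a *: x.1 + y.1, a *: x.2 + y.2)].
Let P (G : set (W * V)) := G = set0 \/ good G.

Let base_good : good base.
Proof.
split=> //.
- by move=> v [u [/esym iu ->]]; rewrite (iI (etrans iu (esym (linear0 i)))) linear0.
- by move=> a _ _ [u ->] [u' ->]; exists (a *: u + u'); rewrite !linearP.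
Qed.

Let chain_P (F : set (set (W * V))) :
  F `<=` P -> total_on F subset -> P (\bigcup_(X in F) X).
Proof.
move=> FP Ftot; have [F0|] := pselect (exists X, F X /\ X !=set0); last first.
  move=> nF; left; rewrite -subset0 => x [X FX Xx].
  by apply: nF; exists X; split=> //; exists x.
have goodF X x : F X -> X x -> good X.
  by move=> FX Xx; case: (FP _ FX) => // X0; rewrite X0 in Xx.
right; case: F0 => X0 [FX0 [x0 Xx0]]; split.
- by case: (goodF _ _ FX0 Xx0) => bX _ _ p /bX Xp; exists X0.
- by move=> v [X FX Xv]; case: (goodF _ _ FX Xv) => _ /(_ _ Xv).
- move=> a x y [X FX Xx] [Y FY Yy].
  have [XY|YX] := Ftot _ _ FX FY.
    by exists Y => //; case: (goodF _ _ FY Yy) => _ _; apply=> //; apply: XY.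
  by exists X => //; case: (goodF _ _ FX Xx) => _ _; apply=> //; apply: YX.
Qed.

Lemma extend_linear : exists g : {linear W -> V}, forall u, g (i u) = f u.
Proof.
have [A [PA Amax]] := Zorn_bigcup chain_P.
have Ag : good A.
  case: PA => // A0; exfalso; apply: (Amax base); last by right; apply: base_good.
  by rewrite A0; split=> // b0; apply: (b0 (i 0, f 0)); exists 0.
case: (Ag) => bA fA lA.
have A0 : A (0, 0) by apply: bA; exists 0; rewrite !linear0.
have tot w : exists v, A (w, v).
  apply: contrapT => nw.
  pose B : set (W * V) := [set p | exists k, A (p.1 - k *: w, p.2)].
  have AB : A `<=` B by move=> [x v] Axv; exists 0; rewrite /= scale0r subr0.
  apply: (Amax B).
    split=> // BA; apply: nw; exists 0; apply: BA; exists 1.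
    by rewrite /= scale1r subrr.
  right; split; first exact: subset_trans AB.
  - move=> v [k]; rewrite /= sub0r; have [->|k0] := eqVneq k 0.
      by rewrite scale0r oppr0; apply: fA.
    move=> Akv; exfalso; apply: nw; exists (- k^-1 *: v + 0).
    have := lA (- k^-1) _ _ Akv A0.
    by rewrite /= addr0 scalerN scaleNr opprK scalerA mulVf // scale1r.
  - move=> a [x v] [y u] [k /= Ax] [l /= Ay]; exists (a * k + l).
    have := lA a _ _ Ax Ay; rewrite /=.
    by rewrite scalerBr addrACA -opprD scalerA -scalerDl.
pose g w := projT1 (cid (tot w)).
have gA w : A (w, g w) by rewrite /g; case: cid.
have gU w v : A (w, v) -> g w = v.
  move=> Awv; apply/eqP; rewrite -subr_eq0; apply/eqP/fA.
  have := lA (-1) _ _ Awv (gA w); rewrite /= !scaleN1r addNr.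
  by rewrite addrC.
have gL : linear g by move=> a x y; apply/gU/(lA a _ _ (gA x) (gA y)).
exists (mkLinear gL) => u; apply: gU.
by apply: bA; exists u.
Qed.
End ExtendLinear.

Section KModule.
Variables (K : pzRingType) (R : ualgType K).
(* the K-module underlying a module over the K-algebra R *)
Definition kmod (M : lmodType R) : lmodType K :=
  res (@scal K R : {rmorphism K -> R}) M.

Lemma kmodZ (M : lmodType R) k (x : kmod M) : k *: x = (scal k : R) *: (x : M).
Proof. by []. Qed.
End KModule.

Section Hom.
Variables (K : pzRingType) (R : ualgType K).

Section HomModule.
Variables (N M : lmodType R).
Definition linP (f : N -> kmod M) : Prop := linear (f : N -> M).
Lemma linP0 : linP 0.
Proof. by move=> a x y; rewrite /= scaler0 addr0. Qed.
Lemma linPD f g : linP f -> linP g -> linP (f + g).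
Proof.
move=> fL gL a x y; rewrite /= fctE.
by have := fL a x y; have := gL a x y => /= -> ->; rewrite scalerDr addrACA.
Qed.
Lemma linPZ k f : linP f -> linP (k *: f).
Proof.
move=> fL a x y; rewrite /= fctE [LHS]kmodZ.
have := fL a x y => /= ->.
by rewrite scalerDr !scalerA scalC.
Qed.
Definition lin_sub : submod (N -> kmod M) := Submod linP0 linPD linPZ.
Definition hom : lmodType K := subm lin_sub.

Definition homlin (h : hom) : {linear N -> M} := mkLinear (inclP h : linear (incl h : N -> M)).
Definition mkhom (f : {linear N -> M}) : hom := mksub (linearP f : lin_sub f).

Lemma mkhomK f x : homlin (mkhom f) x = f x. Proof. by []. Qed.
Lemma homP (g h : hom) : (forall x, homlin g x = homlin h x) -> g = h.
Proof. by move=> gh; apply/incl_inj/funext. Qed.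
Lemma homD (g h : hom) x : homlin (g + h) x = homlin g x + homlin h x. Proof. by []. Qed.
Lemma homZ k (h : hom) x : homlin (k *: h) x = (scal k : R) *: homlin h x. Proof. by []. Qed.
End HomModule.

Section HomFunctor.
Variable N : lmodType R.
Definition hom_map (M M' : lmodType R) (f : {linear M -> M'}) (h : hom N M) : hom N M' :=
  mkhom (f \o homlin h : {linear N -> M'}).
Lemma hom_map_linear (M M' : lmodType R) (f : {linear M -> M'}) : linear (hom_map f).
Proof.
by move=> k g h; apply: homP => x; rewrite homD homZ !mkhomK /= -linearZ -linearD.
Qed.
HB.instance Definition _ M M' f :=
  GRing.isLinear.Build K (hom N M) (hom N M') _ (hom_map f) (@hom_map_linear M M' f).

Definition hom_functor : modfunctor R K.
Proof.
refine (@ModFunctor R K (hom N) (fun M M' f => hom_map f : {linear _ -> _}) _ _ _).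
- by move=> M h; apply: homP.
- by move=> M M' M'' g f h; apply: homP.
- by move=> M M' f g h; apply: homP.
Defined.
End HomFunctor.
End Hom.

Section Coinduced.
Variables (K : fieldType) (R : ualgType K).

Section CoindModule.
Variable V : lmodType K.

Definition coindP (f : R -> V) : Prop :=
  (forall x y, f (x + y) = f x + f y) /\ (forall k x, f (scal k * x) = k *: f x).
Lemma coindP0 : coindP 0.
Proof. by split=> [x y|k x]; rewrite /= ?addr0 ?scaler0. Qed.
Lemma coindPD f g : coindP f -> coindP g -> coindP (f + g).
Proof.
case=> fD fZ [gD gZ]; split=> [x y|k x]; rewrite /= !fctE ?fD ?gD ?fZ ?gZ.
  by rewrite addrACA.
by rewrite scalerDr.
Qed.
Lemma coindPZ k f : coindP f -> coindP (k *: f).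
Proof.
case=> fD fZ; split=> [x y|l x]; rewrite /= !fctE ?fD ?fZ ?scalerDr //.
by rewrite !scalerA mulrC.
Qed.
(* Hom_K(R, V), with R acting by (a f)(x) = f (x a) *)
Definition coind : Type := subm (Submod coindP0 coindPD coindPZ).
HB.instance Definition _ := GRing.Zmodule.on coind.

Definition cfun (f : coind) : R -> V := incl f.
Lemma cfunD f x y : cfun f (x + y) = cfun f x + cfun f y.
Proof. by case: (inclP f). Qed.
Lemma cfunZ f k x : cfun f (scal k * x) = k *: cfun f x.
Proof. by case: (inclP f). Qed.
Lemma coind_eq (f g : coind) : (forall x, cfun f x = cfun g x) -> f = g.
Proof. by move=> fg; apply/incl_inj/funext. Qed.
Lemma cfun_add (f g : coind) x : cfun (f + g) x = cfun f x + cfun g x. Proof. by []. Qed.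

Lemma cscaleP a f : coindP (fun x => cfun f (x * a)).
Proof. by split=> [x y|k x]; rewrite ?mulrDl ?cfunD // -mulrA cfunZ. Qed.
Definition cscale a f : coind := mksub (cscaleP a f : Submod coindP0 coindPD coindPZ _).
Lemma cscaleE a f x : cfun (cscale a f) x = cfun f (x * a). Proof. by []. Qed.

Lemma cscaleA a b f : cscale a (cscale b f) = cscale (a * b) f.
Proof. by apply: coind_eq => x; rewrite !cscaleE mulrA. Qed.
Lemma cscale1 : left_id 1 cscale.
Proof. by move=> f; apply: coind_eq => x; rewrite cscaleE mulr1. Qed.
Lemma cscaleDr : right_distributive cscale +%R.
Proof. by move=> a f g; apply: coind_eq. Qed.
Lemma cscaleDl f : {morph cscale^~ f : a b / a + b}.
Proof. by move=> a b; apply: coind_eq => x; rewrite cfun_add !cscaleE mulrDr cfunD. Qed.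
HB.instance Definition _ := GRing.Zmodule_isLmodule.Build R coind
  cscaleA cscale1 cscaleDr cscaleDl.

Lemma cfun_scale a (f : coind) x : cfun (a *: f) x = cfun f (x * a). Proof. by []. Qed.

Lemma coind_injective : injective_module coind.
Proof.
move=> N N' i f iI.
have iL : linear (i : kmod N -> kmod N').
  by move=> k x y; rewrite !kmodZ; apply: linearP.
have fL : linear ((fun x => cfun (f x) 1) : kmod N -> V).
  move=> k x y; rewrite kmodZ linearD linearZ cfun_add cfun_scale.
  by rewrite mul1r -[scal k]mulr1 cfunZ.
have [g gP] := @extend_linear K _ _ _ (mkLinear iL) (mkLinear fL) iI.
pose G n : R -> V := fun x => g (x *: n : N').
have GP n : coindP (G n).
  split=> [x y|k x]; first by rewrite /G scalerDl linearD.
  by rewrite /G -scalerA -[_ *: (x *: n)]/(k *: (x *: n : kmod N')) linearZ.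
pose G' n : coind := mksub (GP n : Submod coindP0 coindPD coindPZ _).
have G'L : linear G'.
  move=> a x y; apply: coind_eq => z.
  rewrite cfun_add cfun_scale; rewrite /cfun !inclK /G.
  by rewrite scalerDr scalerA linearD.
exists (mkLinear G'L) => x; apply: coind_eq => z.
rewrite /= /cfun inclK /G -[LHS]/(g (z *: i x : N')) -linearZ.
by have /= -> := gP (z *: x); rewrite linearZ cfun_scale mul1r.
Qed.
End CoindModule.

Section Embedding.
Variable M : lmodType R.
Lemma embP (m : M) : @coindP (kmod M) (fun x => x *: m).
Proof. by split=> [x y|k x]; rewrite ?scalerDl // kmodZ scalerA. Qed.
Definition emb (m : M) : coind (kmod M) :=
  mksub (embP m : Submod (coindP0 _) (@coindPD _) (@coindPZ _) _).
Lemma emb_linear : linear emb.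
Proof.
move=> a x y; apply: coind_eq => z.
by rewrite cfun_add cfun_scale /cfun !inclK scalerDr scalerA.
Qed.
HB.instance Definition _ := GRing.isLinear.Build R M (coind (kmod M)) _ emb emb_linear.
Lemma emb_inj : injective emb.
Proof.
move=> x y /(congr1 (fun f => cfun f 1)).
by rewrite /cfun !inclK !scale1r.
Qed.
End Embedding.

(* M -> Hom_K(R, M) -> Hom_K(R, C1) -> Hom_K(R, C2) -> ..., where C1, C2, ...
   are the successive cokernels *)
Section StandardResolution.
Variable M : lmodType R.

Fixpoint cosyzygy n : lmodType R :=
  match n with
  | 0%N => M
  | m.+1 => quo (imm (@emb (cosyzygy m) : {linear _ -> _}))
  end.
Definition sob n : lmodType R := coind (kmod (cosyzygy n)).
Definition sdif n : {linear sob n -> sob n.+1} :=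
  @emb (cosyzygy n.+1) \o
  (@proj _ _ (imm (@emb (cosyzygy n) : {linear _ -> _})) : {linear sob n -> cosyzygy n.+1}).

Lemma sdif0 n x : sdif n x = 0 <-> exists m : cosyzygy n, x = emb m.
Proof.
split=> [|[m ->]] /=; last first.
  suff -> : proj (imm (@emb (cosyzygy n) : {linear _ -> _})) (emb m) = 0 by apply: linear0.
  by apply/proj_eq0; exists m.
rewrite -[X in _ = X](linear0 (@emb _)) => /emb_inj.
by move/proj_eq0.
Qed.

Lemma sdif_exact n x : sdif n.+1 x = 0 <-> exists y, x = sdif n y.
Proof.
rewrite sdif0; split=> [[m ->]|[y ->]]; last by eexists.
by have [y ->] := proj_surj m; exists y.
Qed.

Lemma sdif_dif n x : sdif n.+1 (sdif n x) = 0.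
Proof. by apply/sdif_exact; exists x. Qed.

Definition standard_resolution : injective_resolution M :=
  @InjectiveResolution R M (Cocomplex sdif_dif) (@emb M : {linear _ -> _}) (@emb_inj M)
    (sdif0 (n := 0)) sdif_exact (fun n => @coind_injective _).
End StandardResolution.

(* R^n T, and Ext^n_R(N, M) as the n-th right derived functor of Hom_R(N, -).
   All injective resolutions give isomorphic modules; this one has injective
   terms Hom_K(R, V). *)
Definition rderived (R' : pzRingType) (T : modfunctor R R') (n : nat) (M : lmodType R) :
    lmodType R' :=
  cohomology (map_cocomplex T (standard_resolution M)) n.

Definition Ext (n : nat) (N M : lmodType R) : lmodType K := rderived (hom_functor N) n M.
End Coinduced.

Local Open Scope fset.
Local Open Scope ring_scope.

(* linear extension of a function on a basis *)
Section Extension.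
Variables (T : choiceType) (R : nzRingType) (V : lmodType R) (f : T -> V).
Definition mext (w : {malg R[T]}) : V := \sum_(t <- msupp w) w@_t *: f t.

Lemma mextw (d : {fset T}) w : msupp w `<=` d -> mext w = \sum_(t <- d) w@_t *: f t.
Proof.
move=> wd; rewrite /mext (big_fset_incl _ wd) //= => t _ /mcoeff_outdom ->.
by rewrite scale0r.
Qed.

Lemma mext_linear : linear mext.
Proof.
move=> a x y; pose d := msupp x `|` msupp y `|` msupp (a *: x + y).
rewrite !(@mextw d) ?fsubsetUr //.
- rewrite scaler_sumr -big_split; apply: eq_bigr => t _ /=.
  by rewrite mcoeffD mcoeffZ scalerDl scalerA.
- by rewrite /d (fsubset_trans _ (fsubsetUl _ _)) // fsubsetUr.
- by rewrite /d (fsubset_trans _ (fsubsetUl _ _)) // fsubsetUl.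
Qed.
HB.instance Definition _ := GRing.isLinear.Build R {malg R[T]} V _ mext mext_linear.

Lemma mextU c t : mext << c *g t >> = c *: f t.
Proof. by rewrite (mextw msuppU_le) big_seq_fset1 mcoeffUU. Qed.
End Extension.

Lemma malg_eq (R : nzRingType) (T : choiceType) (V : lmodType R)
    (f g : {linear {malg R[T]} -> V}) :
  (forall t, f << 1 *g t >> = g << 1 *g t >>) -> f =1 g.
Proof.
move=> fg w; rewrite [w]monalgE !linear_sum; apply: eq_bigr => t _.
have -> : << w@_t *g t >> = w@_t *: << 1 *g t >> :> {malg R[T]}.
  by apply/malgP=> k; rewrite mcoeffZ !mcoeffU mulrnAr mulr1.
by rewrite !linearZ fg.
Qed.

(* the product (a t)(b u) = m t a b (t u) on finitely supported families *)
Section GradedProduct.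
Variables (T : monoidType) (G : zmodType) (m : T -> G -> G -> G).
Hypothesis mDl : forall t b, {morph m t ^~ b : x y / x + y}.
Hypothesis mDr : forall t a, {morph m t a : x y / x + y}.

Lemma gm0l t b : m t 0 b = 0.
Proof. by apply: (addrI (m t 0 b)); rewrite -mDl !addr0. Qed.
Lemma gm0r t a : m t a 0 = 0.
Proof. by apply: (addrI (m t a 0)); rewrite -mDr !addr0. Qed.

Definition gmul (x y : {malg G[T]}) : {malg G[T]} :=
  \sum_(t <- msupp x) \sum_(u <- msupp y) << m t (x@_t) (y@_u) *g (t * u)%g >>.

Lemma gmulw (d1 d2 : {fset T}) x y : msupp x `<=` d1 -> msupp y `<=` d2 ->
  gmul x y = \sum_(t <- d1) \sum_(u <- d2) << m t (x@_t) (y@_u) *g (t * u)%g >>.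
Proof.
move=> le_d1 le_d2; rewrite /gmul (big_fset_incl _ le_d1) /=.
  apply/eq_bigr=> k1 _; apply/big_fset_incl => // k _ /mcoeff_outdom ->.
  by rewrite gm0r monalgU0.
move=> k _ /mcoeff_outdom xk; rewrite big1 // => k' _.
by rewrite xk gm0l monalgU0.
Qed.

Lemma gmulDl x y z : gmul (x + y) z = gmul x z + gmul y z.
Proof.
pose d := msupp x `|` msupp y `|` msupp (x + y).
rewrite !(@gmulw d (msupp z)) ?fsubsetUr //.
- rewrite -big_split; apply: eq_bigr => t _ /=.
  rewrite -big_split; apply: eq_bigr => u _ /=.
  by rewrite mcoeffD mDl monalgUD.
- by rewrite /d (fsubset_trans _ (fsubsetUl _ _)) // fsubsetUr.
- by rewrite /d (fsubset_trans _ (fsubsetUl _ _)) // fsubsetUl.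
Qed.

Lemma gmulDr x y z : gmul z (x + y) = gmul z x + gmul z y.
Proof.
pose d := msupp x `|` msupp y `|` msupp (x + y).
rewrite !(@gmulw (msupp z) d) ?fsubsetUr //.
- rewrite -big_split; apply: eq_bigr => t _ /=.
  rewrite -big_split; apply: eq_bigr => u _ /=.
  by rewrite mcoeffD mDr monalgUD.
- by rewrite /d (fsubset_trans _ (fsubsetUl _ _)) // fsubsetUr.
- by rewrite /d (fsubset_trans _ (fsubsetUl _ _)) // fsubsetUl.
Qed.

Lemma gmul0 x : gmul x 0 = 0.
Proof. by apply: (addrI (gmul x 0)); rewrite -gmulDr !addr0. Qed.
Lemma g0mul x : gmul 0 x = 0.
Proof. by apply: (addrI (gmul 0 x)); rewrite -gmulDl !addr0. Qed.

Lemma gmulUU a b t u : gmul << a *g t >> << b *g u >> = << m t a b *g (t * u)%g >>.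
Proof. by rewrite (gmulw msuppU_le msuppU_le) !big_seq_fset1 !mcoeffUU. Qed.

Lemma gmul_suml (I : Type) (r : seq I) F y :
  gmul (\sum_(i <- r) F i) y = \sum_(i <- r) gmul (F i) y.
Proof. exact: (big_morph (gmul^~ y) (fun _ _ => gmulDl _ _ _) (g0mul y)). Qed.
Lemma gmul_sumr (I : Type) (r : seq I) F y :
  gmul y (\sum_(i <- r) F i) = \sum_(i <- r) gmul y (F i).
Proof. exact: (big_morph (gmul y) (fun _ _ => gmulDr _ _ _) (gmul0 y)). Qed.

Lemma malg_ind (P : {malg G[T]} -> Prop) :
  P 0 -> (forall x y, P x -> P y -> P (x + y)) -> (forall a t, P << a *g t >>) ->
  forall x, P x.
Proof. by move=> P0 PD PU x; rewrite [x]monalgE; elim/big_ind: _. Qed.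

Hypothesis mA : forall t u a b c, m t a (m u b c) = m (t * u)%g (m t a b) c.

Lemma gmulA : associative gmul.
Proof.
move=> x y z.
elim/malg_ind: x => [|x x' IHx IHx'|a t]; first by rewrite !g0mul.
  by rewrite !gmulDl IHx IHx'.
elim/malg_ind: y => [|y y' IHy IHy'|b u]; first by rewrite !(g0mul, gmul0).
  by rewrite !(gmulDl, gmulDr) IHy IHy'.
elim/malg_ind: z => [|z z' IHz IHz'|c v]; first by rewrite !gmul0.
  by rewrite !gmulDr IHz IHz'.
by rewrite !gmulUU mA mulgA.
Qed.
End GradedProduct.

(* the monoid algebra *)
Definition monalg (K : fieldType) (S : monoidType) : Type := {malg K[S]}.

Section MonoidAlgebra.
Variables (K : fieldType) (S : monoidType).
Local Notation KS := (monalg K S).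
HB.instance Definition _ := GRing.Lmodule.copy KS {malg K[S]}.

Let m (t : S) (a b : K) := a * b.
Let mDl t b : {morph m t ^~ b : x y / x + y}.
Proof. by move=> x y; rewrite /m mulrDl. Qed.
Let mDr t a : {morph m t a : x y / x + y}.
Proof. by move=> x y; rewrite /m mulrDr. Qed.

Definition mmul : KS -> KS -> KS := gmul (fun _ a b => a * b).
Definition mone : KS := << 1 *g 1%g >>.

Lemma mmulA : associative mmul.
Proof. by apply: (gmulA mDl mDr) => *; rewrite /m mulrA. Qed.
Lemma mmulDl : left_distributive mmul +%R.
Proof. by move=> x y z; apply: (gmulDl mDl mDr). Qed.
Lemma mmulDr : right_distributive mmul +%R.
Proof. by move=> x y z; apply: (gmulDr mDl mDr). Qed.
Lemma mmul1 : left_id mone mmul.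
Proof.
elim/malg_ind=> [|x y IHx IHy|a t]; first exact: (gmul0 mDl mDr).
  by rewrite mmulDr IHx IHy.
by rewrite /mmul (gmulUU mDl mDr) /m mul1r mul1g.
Qed.
Lemma m1mul : right_id mone mmul.
Proof.
elim/malg_ind=> [|x y IHx IHy|a t]; first exact: (g0mul mDl mDr).
  by rewrite mmulDl IHx IHy.
by rewrite /mmul (gmulUU mDl mDr) /m mulr1 mulg1.
Qed.
HB.instance Definition _ := GRing.Zmodule_isPzRing.Build KS mmulA mmul1 m1mul mmulDl mmulDr.

Definition ms (s : S) : KS := << 1 *g s >>.
Lemma msM s t : ms (s * t)%g = ms s * ms t.
Proof. by rewrite [RHS](gmulUU mDl mDr) /m mulr1. Qed.

Lemma mUU (a b : K) s t : (<< a *g s >> : KS) * << b *g t >> = << a * b *g (s * t)%g >>.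
Proof. exact: (gmulUU mDl mDr). Qed.

Definition mscal (k : K) : KS := << k *g 1%g >>.
Lemma mscal_additive : additive mscal.
Proof. by move=> a b; apply: monalgUB. Qed.
Lemma mscal_monoid_morphism : monoid_morphism mscal.
Proof. by split=> // a b; rewrite /mscal mUU mul1g. Qed.
Lemma mscalE k (x : KS) : mscal k * x = k *: x.
Proof.
elim/malg_ind: x => [|x y IHx IHy|a t]; first by rewrite mulr0 scaler0.
  by rewrite mulrDr IHx IHy scalerDr.
rewrite mUU mul1g; apply/malgP=> u.
by rewrite mcoeffZ !mcoeffU mulrnAr.
Qed.
Lemma mscalEr k (x : KS) : x * mscal k = k *: x.
Proof.
elim/malg_ind: x => [|x y IHx IHy|a t]; first by rewrite mul0r scaler0.
  by rewrite mulrDl IHx IHy scalerDr.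
rewrite mUU mulg1; apply/malgP=> u.
by rewrite mcoeffZ !mcoeffU mulrnAr mulrC.
Qed.
Lemma mscalC k (x : KS) : mscal k * x = x * mscal k.
Proof. by rewrite mscalE mscalEr. Qed.
Lemma mscalM k (x y : KS) : x * (k *: y) = k *: (x * y).
Proof. by rewrite -!mscalE mulrA -mscalC -mulrA. Qed.
Lemma mMscal k (x y : KS) : (k *: x) * y = k *: (x * y).
Proof. by rewrite -!mscalE mulrA. Qed.
HB.instance Definition _ := PzRing_isUnitalAlgebra.Build K KS
  mscal_additive mscal_monoid_morphism mscalC.
Lemma ms1 : ms 1%g = 1. Proof. by []. Qed.
Lemma scal_monalg k (x : KS) : scal k * x = k *: x. Proof. exact: mscalE. Qed.
End MonoidAlgebra.
(* Opaque for the sake of fast unification failure. *)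
#[global] Opaque mmul mone mscal ms.

(* modules over K[S] from linear actions of S on K-modules *)
Record monoid_rep (K : fieldType) (S : monoidType) := MonoidRep {
  rcarrier :> lmodType K;
  ract : S -> rcarrier -> rcarrier;
  ract_linear : forall s, linear (ract s);
  ract1 : forall x, ract 1%g x = x;
  ractM : forall s t x, ract (s * t)%g x = ract s (ract t x) }.

Definition repmod (K : fieldType) (S : monoidType) (V : monoid_rep K S) : Type := V.

Section RepModule.
Variables (K : fieldType) (S : monoidType) (V : monoid_rep K S).
HB.instance Definition _ := GRing.Zmodule.copy (repmod V) V.

(* (\sum_s a_s s) x = \sum_s a_s (s x) *)
Definition rmscale (w : monalg K S) (x : repmod V) : repmod V :=
  mext (fun s => ract s (x : V)) w.

Let actL s := mkLinear (@ract_linear _ _ V s).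

Lemma rmscaleU (c : K) s x : rmscale << c *g s >> x = c *: ract s (x : V).
Proof. exact: mextU. Qed.
Lemma rmscaleDl x : {morph rmscale^~ x : a b / a + b}.
Proof. by move=> a b; apply: linearD. Qed.
Lemma rmscale0 x : rmscale 0 x = 0.
Proof. exact: linear0. Qed.
Lemma rmscaleDr : right_distributive rmscale +%R.
Proof.
move=> w x y; rewrite /rmscale /mext -big_split; apply: eq_bigr => s _ /=.
by rewrite -scalerDr; have /= -> := linearD (actL s) x y.
Qed.
Lemma rmscaler0 w : rmscale w 0 = 0.
Proof. by apply: (addrI (rmscale w 0)); rewrite -rmscaleDr !addr0. Qed.
Lemma rmscale1 : left_id 1 rmscale.
Proof. by move=> x; rewrite rmscaleU scale1r ract1. Qed.
Lemma rmscaleA a b x : rmscale a (rmscale b x) = rmscale (a * b) x.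
Proof.
elim/malg_ind: a => [|a a' IH IH'|k s]; first by rewrite mul0r !rmscale0.
  by rewrite mulrDl !rmscaleDl IH IH'.
elim/malg_ind: b => [|b b' IH IH'|l t]; first by rewrite mulr0 !rmscale0 rmscaler0.
  by rewrite mulrDr !rmscaleDl rmscaleDr IH IH'.
rewrite mUU !rmscaleU; have /= -> := linearZ_LR (actL s) l (ract t (x : V)).
by rewrite scalerA ractM.
Qed.
HB.instance Definition _ := GRing.Zmodule_isLmodule.Build (monalg K S) (repmod V)
  rmscaleA rmscale1 rmscaleDr rmscaleDl.

Lemma repmodE s (x : repmod V) : ms K s *: x = ract s (x : V).
Proof. by rewrite [LHS]rmscaleU scale1r. Qed.
End RepModule.

(* quotients of K-algebras by two-sided ideals *)
Record ideal (A : pzRingType) := Ideal {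
  imem :> A -> Prop;
  imem0 : imem 0;
  imemD : forall x y, imem x -> imem y -> imem (x + y);
  imemMl : forall a x, imem x -> imem (a * x);
  imemMr : forall a x, imem x -> imem (x * a) }.

Section Ideals.
Variable A : pzRingType.
(* the least two-sided ideal containing G *)
Definition gidealP (G : A -> Prop) x := forall I : ideal A, (forall y, G y -> I y) -> I x.
Lemma gideal0 G : gidealP G 0. Proof. by move=> I _; apply: imem0. Qed.
Lemma gidealD G x y : gidealP G x -> gidealP G y -> gidealP G (x + y).
Proof. by move=> Gx Gy I GI; apply: imemD; [apply: Gx|apply: Gy]. Qed.
Lemma gidealMl G a x : gidealP G x -> gidealP G (a * x).
Proof. by move=> Gx I GI; apply/imemMl/Gx. Qed.
Lemma gidealMr G a x : gidealP G x -> gidealP G (x * a).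
Proof. by move=> Gx I GI; apply/imemMr/Gx. Qed.
Definition gideal (G : A -> Prop) : ideal A :=
  Ideal (@gideal0 G) (@gidealD G) (@gidealMl G) (@gidealMr G).
Definition ideal_sub (I : ideal A) : submod A^o :=
  @Submod A A^o I (imem0 I) (@imemD A I) (@imemMl A I).
End Ideals.

Definition qalg (A : pzRingType) (I : ideal A) : Type := quo (ideal_sub I).

Section QuotientAlgebra.
Variables (A : pzRingType) (I : ideal A).
Local Notation Q := (qalg I).
HB.instance Definition _ := GRing.Zmodule.copy Q (quo (ideal_sub I)).
Definition qpi (x : A) : Q := proj (ideal_sub I) x.
Definition qrep (q : Q) : A := lrep q.

Lemma qrepK : cancel qrep qpi. Proof. exact: lrepK. Qed.
Lemma qpiP x y : (qpi x = qpi y) <-> I (x - y). Proof. exact: projP. Qed.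
Lemma qpi_surj q : exists x, q = qpi x.
Proof. by have [x ->] := @proj_surj _ _ (ideal_sub I) q; exists x. Qed.
Lemma qpiB : additive qpi.
Proof. by move=> x y; apply: (raddfB (proj (ideal_sub I))). Qed.
HB.instance Definition _ := GRing.isAdditive.Build A Q qpi qpiB.

Definition qmul (q r : Q) : Q := qpi (qrep q * qrep r).
Lemma qmulE x y : qmul (qpi x) (qpi y) = qpi (x * y).
Proof.
apply/qpiP; set x' := qrep _; set y' := qrep _.
have Ix : I (x' - x) by apply/qpiP; rewrite qrepK.
have Iy : I (y' - y) by apply/qpiP; rewrite qrepK.
have -> : x' * y' - x * y = (x' - x) * y' + x * (y' - y).
  by rewrite mulrBl mulrBr addrA subrK.
by apply: imemD; [apply: imemMr | apply: imemMl].
Qed.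
Lemma qmulA : associative qmul.
Proof.
move=> a b c; have [[[x ->] [y ->]] [z ->]] := (qpi_surj a, qpi_surj b, qpi_surj c).
by rewrite !qmulE mulrA.
Qed.
Lemma qmul1 : left_id (qpi 1) qmul.
Proof. by move=> a; have [x ->] := qpi_surj a; rewrite qmulE mul1r. Qed.
Lemma q1mul : right_id (qpi 1) qmul.
Proof. by move=> a; have [x ->] := qpi_surj a; rewrite qmulE mulr1. Qed.
Lemma qmulDl : left_distributive qmul +%R.
Proof.
move=> a b c; have [[[x ->] [y ->]] [z ->]] := (qpi_surj a, qpi_surj b, qpi_surj c).
by rewrite -raddfD !qmulE mulrDl raddfD.
Qed.
Lemma qmulDr : right_distributive qmul +%R.
Proof.
move=> a b c; have [[[x ->] [y ->]] [z ->]] := (qpi_surj a, qpi_surj b, qpi_surj c).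
by rewrite -raddfD !qmulE mulrDr raddfD.
Qed.
HB.instance Definition _ := GRing.Zmodule_isPzRing.Build Q qmulA qmul1 q1mul qmulDl qmulDr.
Lemma qpi_monoid_morphism : monoid_morphism qpi.
Proof. by split=> // x y; rewrite -qmulE. Qed.
HB.instance Definition _ := GRing.isMonoidMorphism.Build A Q qpi qpi_monoid_morphism.
End QuotientAlgebra.

Section QuotientScal.
Variables (K : pzRingType) (A : ualgType K) (I : ideal A).
Definition qscal (k : K) : qalg I := qpi I (scal k).
Lemma qscal_additive : additive qscal.
Proof. by move=> a b; rewrite /qscal !raddfB. Qed.
Lemma qscal_monoid_morphism : monoid_morphism qscal.
Proof. by split=> [|a b]; rewrite /qscal ?rmorph1 // !rmorphM. Qed.
Lemma qscalC k (x : qalg I) : qscal k * x = x * qscal k.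
Proof. by have [y ->] := qpi_surj x; rewrite /qscal -!rmorphM scalC. Qed.
Lemma qscalE k : qscal k = qpi I (scal k). Proof. by []. Qed.
HB.instance Definition _ := PzRing_isUnitalAlgebra.Build K (qalg I)
  qscal_additive qscal_monoid_morphism qscalC.
Lemma qpi_scal k : qpi I (scal k) = scal k. Proof. by []. Qed.
End QuotientScal.
#[global] Opaque qmul qpi qscal.

Definition kalg (K : fieldType) (A : ualgType K) : lmodType K := kmod (A^o : lmodType A).

(* the multiplicative monoid R x R^op; a fresh type keeps conversion cheap *)
Record envmon (R : Type) := EnvPair { efst : R; esnd : R }.

Section EnvMonoid.
Variable R : pzRingType.
HB.instance Definition _ := gen_eqMixin (envmon R).
HB.instance Definition _ := gen_choiceMixin (envmon R).
Definition envmon_mul (p q : envmon R) : envmon R :=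
  EnvPair (efst p * efst q) (esnd q * esnd p).
Definition envmon_one : envmon R := EnvPair 1 1.
Lemma envmon_mulA : associative envmon_mul.
Proof. by move=> [a b] [c d] [e f]; rewrite /envmon_mul /= !mulrA. Qed.
Lemma envmon_mul1 : left_id envmon_one envmon_mul.
Proof. by move=> [a b]; rewrite /envmon_mul /= mul1r mulr1. Qed.
Lemma envmon_1mul : right_id envmon_one envmon_mul.
Proof. by move=> [a b]; rewrite /envmon_mul /= mul1r mulr1. Qed.
HB.instance Definition _ :=
  isMonoid.Build (envmon R) envmon_mulA envmon_mul1 envmon_1mul.
End EnvMonoid.

Section Enveloping.
Variables (K : fieldType) (R : ualgType K).
Local Notation F := (monalg K (envmon R)).
Definition pt (a b : R) : F := ms K (EnvPair a b).

Lemma ptM a b c d : pt a b * pt c d = pt (a * c) (d * b).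
Proof. by rewrite -msM. Qed.
Lemma ptE a b : pt a b = << 1 *g (EnvPair a b) >>.
Proof. by []. Qed.
Opaque pt.

Variant tensor_rel : F -> Prop :=
| TensorDl a a' b : tensor_rel (pt (a + a') b - pt a b - pt a' b)
| TensorDr a b b' : tensor_rel (pt a (b + b') - pt a b - pt a b')
| TensorZl k a b : tensor_rel (pt (scal k * a) b - k *: pt a b)
| TensorZr k a b : tensor_rel (pt a (scal k * b) - k *: pt a b).

Definition tensor_sub : submod F := span tensor_rel.

Lemma tensor_sub_ind (P : submod F) x : (forall y, tensor_rel y -> P y) -> tensor_sub x -> P x.
Proof. by move=> relP; apply. Qed.

Lemma ptMl_rel c d x : tensor_rel x -> tensor_rel (pt c d * x).
Proof.
case=> [a a' b|a b b'|k a b|k a b];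
  rewrite !mulrBr ?mscalM !ptM.
- by rewrite mulrDr; apply: TensorDl.
- by rewrite mulrDl; apply: TensorDr.
- by rewrite (mulrA c) -(scalC k c) -(mulrA (scal k)); apply: TensorZl.
- by rewrite -(mulrA (scal k)); apply: TensorZr.
Qed.
Lemma ptMr_rel c d x : tensor_rel x -> tensor_rel (x * pt c d).
Proof.
case=> [a a' b|a b b'|k a b|k a b];
  rewrite !mulrBl ?mMscal !ptM.
- by rewrite mulrDl; apply: TensorDl.
- by rewrite mulrDr; apply: TensorDr.
- by rewrite -(mulrA (scal k)); apply: TensorZl.
- by rewrite (mulrA d) -(scalC k d) -(mulrA (scal k)); apply: TensorZr.
Qed.

Lemma monalg_pt_ind (P : F -> Prop) :
  P 0 -> (forall x y, P x -> P y -> P (x + y)) -> (forall k a b, P (k *: pt a b)) ->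
  forall x, P x.
Proof.
move=> P0 PD PU; apply: malg_ind => // k [a b].
suff -> : << k *g (EnvPair a b) >> = k *: pt a b by apply: PU.
by rewrite ptE; apply/malgP=> t; rewrite mcoeffZ !mcoeffU mulrnAr mulr1.
Qed.

Lemma tensor_subMl a x : tensor_sub x -> tensor_sub (a * x).
Proof.
elim/monalg_pt_ind: a x => [|a b IHa IHb|k c d] x tx.
- by rewrite mul0r; apply: smem0.
- by rewrite mulrDl; apply: smemD; [apply: IHa|apply: IHb].
- rewrite mMscal; apply: smemZ => P relP.
  have Q0 : P (pt c d * 0) by rewrite mulr0; apply: smem0.
  have QD y z : P (pt c d * y) -> P (pt c d * z) -> P (pt c d * (y + z)).
    by rewrite mulrDr; apply: smemD.
  have QZ l y : P (pt c d * y) -> P (pt c d * (l *: y)).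
    by rewrite mscalM; apply: smemZ.
  apply: (tx (@Submod K F (fun y => P (pt c d * y)) Q0 QD QZ)) => y ry.
  exact/relP/ptMl_rel.
Qed.

Lemma tensor_subMr a x : tensor_sub x -> tensor_sub (x * a).
Proof.
elim/monalg_pt_ind: a x => [|a b IHa IHb|k c d] x tx.
- by rewrite mulr0; apply: smem0.
- by rewrite mulrDr; apply: smemD; [apply: IHa|apply: IHb].
- rewrite mscalM; apply: smemZ => P relP.
  have Q0 : P (0 * pt c d) by rewrite mul0r; apply: smem0.
  have QD y z : P (y * pt c d) -> P (z * pt c d) -> P ((y + z) * pt c d).
    by rewrite mulrDl; apply: smemD.
  have QZ l y : P (y * pt c d) -> P ((l *: y) * pt c d).
    by rewrite mMscal; apply: smemZ.
  apply: (tx (@Submod K F (fun y => P (y * pt c d)) Q0 QD QZ)) => y ry.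
  exact/relP/ptMr_rel.
Qed.

Definition tensor_ideal : ideal F :=
  @Ideal F tensor_sub (smem0 _) (@smemD _ _ _) tensor_subMl tensor_subMr.

(* R (x)_K R^op : the free K-module on R x R^op modulo the bilinearity relations *)
Definition env : ualgType K := qalg tensor_ideal.

Definition tens (a b : R) : env := qpi tensor_ideal (pt a b).

Lemma tens_qpi a b : qpi tensor_ideal (pt a b) = tens a b.
Proof. by []. Qed.
Lemma tensM a b c d : tens a b * tens c d = tens (a * c) (d * b).
Proof. by rewrite /tens -ptM [RHS]rmorphM. Qed.
Lemma tens1 : tens 1 1 = 1. Proof. exact: (rmorph1 (qpi tensor_ideal)). Qed.
Lemma tensDl a a' b : tens (a + a') b = tens a b + tens a' b.
Proof.
rewrite /tens -[RHS]raddfD; apply/qpiP; rewrite opprD addrA.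
by apply/span_gen/TensorDl.
Qed.
Lemma tensDr a b b' : tens a (b + b') = tens a b + tens a b'.
Proof.
rewrite /tens -[RHS]raddfD; apply/qpiP; rewrite opprD addrA.
by apply/span_gen/TensorDr.
Qed.
Lemma tensZl k a b : tens (scal k * a) b = scal k * tens a b.
Proof.
rewrite /tens -qpi_scal -[RHS]rmorphM; apply/qpiP; rewrite scal_monalg.
by apply/span_gen/TensorZl.
Qed.
Lemma tensZr k a b : tens a (scal k * b) = scal k * tens a b.
Proof.
rewrite /tens -qpi_scal -[RHS]rmorphM; apply/qpiP; rewrite scal_monalg.
by apply/span_gen/TensorZr.
Qed.

Opaque tens.

Lemma env_ind (P : env -> Prop) :
  P 0 -> (forall x y, P x -> P y -> P (x + y)) -> (forall a b, P (tens a b)) ->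
  forall x, P x.
Proof.
move=> P0 PD Pt x; have [y ->] := qpi_surj x.
elim/monalg_pt_ind: y => [|y z IHy IHz|k a b]; first by rewrite raddf0.
  by rewrite raddfD; apply: PD.
by rewrite -scal_monalg rmorphM /= qpi_scal tens_qpi -[_ * _]tensZl; apply: Pt.
Qed.

Section TensorLift.
Variables (W : lmodType K) (g : R -> R -> W).
Hypotheses (gDl : forall b, {morph g^~ b : x y / x + y})
           (gDr : forall a, {morph g a : x y / x + y}).
Hypotheses (gZl : forall k a b, g (scal k * a) b = k *: g a b)
           (gZr : forall k a b, g a (scal k * b) = k *: g a b).

Definition tlift (u : env) : W := mext (fun p : envmon R => g (efst p) (esnd p)) (qrep u).

Let h : {linear F -> W} := (mext (fun p : envmon R => g (efst p) (esnd p)) : {linear {malg K[envmon R]} -> W}).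
Let hpt a b : h (pt a b) = g a b.
Proof. by rewrite ptE [LHS]mextU scale1r. Qed.

Lemma tlift_rel x : tensor_sub x -> h x = 0.
Proof.
apply: (@tensor_sub_ind (kerm h)) => _ [a a' b|a b b'|k a b|k a b] /=.
- by rewrite !linearB /= !hpt gDl addrAC addrK subrr.
- by rewrite !linearB /= !hpt gDr addrAC addrK subrr.
- by rewrite linearB linearZ /= !hpt gZl subrr.
- by rewrite linearB linearZ /= !hpt gZr subrr.
Qed.

Lemma tlift_qpi x : tlift (qpi tensor_ideal x) = h x.
Proof.
apply/eqP; rewrite -subr_eq0 -[tlift _]/(h _) -linearB; apply/eqP/tlift_rel.
by apply/(qpiP tensor_ideal); rewrite qrepK.
Qed.
Lemma tliftE a b : tlift (tens a b) = g a b.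
Proof. by rewrite -tens_qpi tlift_qpi hpt. Qed.
Lemma tliftD : {morph tlift : x y / x + y}.
Proof.
move=> x y; have [[x' ->] [y' ->]] := (qpi_surj x, qpi_surj y).
by rewrite -raddfD !tlift_qpi linearD.
Qed.
Lemma tlift0 : tlift 0 = 0.
Proof. by apply: (addrI (tlift 0)); rewrite -tliftD !addr0. Qed.
Lemma tliftZ k x : tlift (scal k * x) = k *: tlift x.
Proof.
have [x' ->] := qpi_surj x.
by rewrite -qpi_scal -rmorphM !tlift_qpi scal_monalg linearZ.
Qed.
End TensorLift.
End Enveloping.

(* R as an R-bimodule *)
Definition regbimod (K : fieldType) (R : ualgType K) : Type := R.

Section RegularBimodule.
Variables (K : fieldType) (R : ualgType K).
HB.instance Definition _ := GRing.Zmodule.copy (regbimod R) R.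

Let g (x : R) (a b : R) : kalg R := a * x * b.
Let gDl x b : {morph (g x)^~ b : a a' / a + a'}.
Proof. by move=> a a'; rewrite /g !mulrDl. Qed.
Let gDr x a : {morph g x a : b b' / b + b'}.
Proof. by move=> b b'; rewrite /g !mulrDr. Qed.
Let gZl x k a b : g x (scal k * a) b = k *: g x a b.
Proof. by rewrite /g -!mulrA. Qed.
Let gZr x k a b : g x a (scal k * b) = k *: g x a b.
Proof.
by rewrite /g mulrA -(scalC k (a * x)) -(mulrA (scal k) (a * x)).
Qed.

Definition regscale (u : env R) (x : regbimod R) : regbimod R :=
  tlift (fun a b => a * (x : R) * b : kalg R) u.

Lemma regscaleE a b x : regscale (tens a b) x = a * (x : R) * b.
Proof. exact: (tliftE (gDl x) (gDr x) (gZl x) (gZr x)). Qed.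
Lemma regscaleDl x : {morph regscale^~ x : u v / u + v}.
Proof. exact: (tliftD (gDl x) (gDr x) (gZl x) (gZr x)). Qed.
Lemma regscale0 x : regscale 0 x = 0.
Proof. exact: (tlift0 (gDl x) (gDr x) (gZl x) (gZr x)). Qed.
Lemma regscale1 : left_id 1 regscale.
Proof. by move=> x; rewrite -tens1 regscaleE mul1r mulr1. Qed.
Lemma regscaleDr : right_distributive regscale +%R.
Proof.
move=> u x y; elim/env_ind: u => [|u v IHu IHv|a b].
- by rewrite !regscale0 addr0.
- by rewrite !regscaleDl IHu IHv addrACA.
- by rewrite !regscaleE mulrDr mulrDl.
Qed.
Lemma regscaler0 u : regscale u 0 = 0.
Proof. by apply: (addrI (regscale u 0)); rewrite -regscaleDr !addr0. Qed.
Lemma regscaleA u v x : regscale u (regscale v x) = regscale (u * v) x.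
Proof.
elim/env_ind: u => [|u u' IHu IHu'|a b].
- by rewrite mul0r !regscale0.
- by rewrite mulrDl !regscaleDl IHu IHu'.
elim/env_ind: v => [|v v' IHv IHv'|c d].
- by rewrite mulr0 !regscale0 regscaler0.
- by rewrite mulrDr !regscaleDl regscaleDr IHv IHv'.
- by rewrite tensM !regscaleE !mulrA.
Qed.
HB.instance Definition _ := GRing.Zmodule_isLmodule.Build (env R) (regbimod R)
  regscaleA regscale1 regscaleDr regscaleDl.

Lemma regbimodE a b (x : regbimod R) : tens a b *: x = a * (x : R) * b.
Proof. exact: regscaleE. Qed.
End RegularBimodule.

(* H^n(R, M), an R-bimodule being a left R^e-module *)
Definition Hochschild (K : fieldType) (R : ualgType K) (n : nat) (M : lmodType (env R)) :
    lmodType K :=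
  Ext n (regbimod R) M.

Section EnvMap.
Variables (K : fieldType) (R R' : ualgType K) (f : {rmorphism R -> R'}).
Hypothesis fK : forall k, f (scal k) = scal k.

Let g (a b : R) : kalg (env R') := tens (f a) (f b).
Let gDl b : {morph g^~ b : a a' / a + a'}.
Proof. by move=> a a'; rewrite /g rmorphD tensDl. Qed.
Let gDr a : {morph g a : b b' / b + b'}.
Proof. by move=> b b'; rewrite /g rmorphD tensDr. Qed.
Let gZl k a b : g (scal k * a) b = k *: g a b.
Proof. by rewrite /g rmorphM fK tensZl. Qed.
Let gZr k a b : g a (scal k * b) = k *: g a b.
Proof. by rewrite /g rmorphM fK tensZr. Qed.

(* f (x) f^op *)
Definition env_fun (u : env R) : env R' := tlift (fun a b => tens (f a) (f b) : kalg (env R')) u.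
Lemma env_funE a b : env_fun (tens a b) = tens (f a) (f b).
Proof. exact: (tliftE gDl gDr gZl gZr). Qed.
Lemma env_funD : {morph env_fun : u v / u + v}.
Proof. exact: (tliftD gDl gDr gZl gZr). Qed.
Lemma env_fun0 : env_fun 0 = 0.
Proof. exact: (tlift0 gDl gDr gZl gZr). Qed.
Lemma env_fun_additive : additive env_fun.
Proof. exact: (morphD_additive env_funD). Qed.
Lemma env_fun_monoid_morphism : monoid_morphism env_fun.
Proof.
split; first by rewrite -tens1 env_funE !rmorph1.
move=> u v; elim/env_ind: u => [|u u' IHu IHu'|a b].
- by rewrite mul0r env_fun0 mul0r.
- by rewrite mulrDl !env_funD IHu IHu' mulrDl.
elim/env_ind: v => [|v v' IHv IHv'|c d].
- by rewrite mulr0 env_fun0 mulr0.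
- by rewrite mulrDr !env_funD IHv IHv' mulrDr.
- by rewrite tensM !env_funE tensM !rmorphM.
Qed.
Definition env_map : {rmorphism env R -> env R'} :=
  HB.pack env_fun (GRing.isAdditive.Build _ _ env_fun env_fun_additive)
    (GRing.isMonoidMorphism.Build _ _ env_fun env_fun_monoid_morphism).
Lemma env_mapE a b : env_map (tens a b) = tens (f a) (f b).
Proof. exact: env_funE. Qed.
End EnvMap.

(* right R-modules are left modules over the converse ring R^c *)
Section TensorProduct.
Variables (R : pzRingType) (M : lmodType R^c).

Section Balanced.
Variable N : lmodType R.
Local Notation FZ := {malg int[(M * N)%type]}.
Definition bpt (x : M) (y : N) : FZ := << 1 *g (x, y) >>.
Variant balanced_rel : FZ -> Prop :=
| BalancedDl x x' y : balanced_rel (bpt (x + x') y - bpt x y - bpt x' y)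
| BalancedDr x y y' : balanced_rel (bpt x (y + y') - bpt x y - bpt x y')
| BalancedM x (r : R) y : balanced_rel (bpt ((r : R^c) *: x) y - bpt x (r *: y)).
Definition tensor : lmodType int := quo (span balanced_rel).
Definition tensor_pt x y : tensor := proj (span balanced_rel) (bpt x y).
End Balanced.

Section TensorMap.
Variables (N N' : lmodType R) (f : {linear N -> N'}).
(* M (x) f *)
Definition tensor_map : tensor N -> tensor N' :=
  @qlift _ _ (span (@balanced_rel N)) (tensor N')
    (mext (fun p : M * N => tensor_pt p.1 (f p.2)) : {linear {malg int[(M * N)%type]} -> _}).
Lemma tensor_mapE x y : tensor_map (tensor_pt x y) = tensor_pt x (f y).
Proof.
pose h : {linear {malg int[(M * N)%type]} -> tensor N'} :=
  mext (fun p : M * N => tensor_pt p.1 (f p.2)).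
have E u v : h (bpt u v) = tensor_pt u (f v) by rewrite [LHS]mextU scale1r.
rewrite [LHS](@qliftE _ _ _ _ h) // => w.
suff: span (@balanced_rel N) w -> kerm h w by [].
apply; move=> _ [u u' v|u v v'|u r v] /=.
- rewrite !linearB /= !E; apply/eqP; rewrite -addrA -opprD subr_eq0; apply/eqP.
  rewrite -linearD; apply/projP; rewrite opprD addrA; apply/span_gen/BalancedDl.
- rewrite !linearB /= !E; apply/eqP; rewrite -addrA -opprD subr_eq0; apply/eqP.
  rewrite -linearD; apply/projP; rewrite linearD opprD addrA; apply/span_gen/BalancedDr.
- rewrite !linearB /= !E; apply/eqP; rewrite subr_eq0; apply/eqP.
  by apply/projP; rewrite linearZ; apply/span_gen/BalancedM.
Qed.
End TensorMap.

Definition flat : Prop :=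
  forall (N N' : lmodType R) (f : {linear N -> N'}),
    injective f -> injective (tensor_map f).
End TensorProduct.

Definition rres (R R' : pzRingType) (phi : {rmorphism R -> R'}) : Type := R'.

Section RightRestriction.
Variables (R R' : pzRingType) (phi : {rmorphism R -> R'}).
HB.instance Definition _ := GRing.Zmodule.copy (rres phi) R'.
(* R' as a right R-module : x r = x (phi r) *)
Definition rrscale (r : R^c) (x : rres phi) : rres phi := (x : R') * phi r.
Lemma rrscaleA a b x : rrscale a (rrscale b x) = rrscale (a * b) x.
Proof. by rewrite /rrscale -mulrA -rmorphM. Qed.
Lemma rrscale1 : left_id 1 rrscale.
Proof. by move=> x; rewrite /rrscale rmorph1 mulr1. Qed.
Lemma rrscaleDr : right_distributive rrscale +%R.
Proof. by move=> a x y; rewrite /rrscale mulrDl. Qed.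
Lemma rrscaleDl x : {morph rrscale^~ x : a b / a + b}.
Proof. by move=> a b; rewrite /rrscale rmorphD mulrDr. Qed.
HB.instance Definition _ := GRing.Zmodule_isLmodule.Build R^c (rres phi)
  rrscaleA rrscale1 rrscaleDr rrscaleDl.
End RightRestriction.

HB.mixin Record Monoid_isInverse S of Monoid S := {
  ginv : S -> S;
  mulgVK : forall s, (s * ginv s * s = s)%g;
  mulVgK : forall s, (ginv s * s * ginv s = ginv s)%g;
  ginv_uniq : forall s t, (s * t * s = s)%g -> (t * s * t = t)%g -> t = ginv s
}.

#[short(type="invMonoidType")]
HB.structure Definition InverseMonoid := { S of Monoid_isInverse S & Monoid S }.

Notation "s ^v" := (ginv s) (at level 2, left associativity, format "s ^v") : group_scope.

Section InverseMonoids.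
Variable S : invMonoidType.
Implicit Types s t e f : S.
Local Open Scope group_scope.

Definition idempotent e := e * e = e.
Definition natural_le s t := exists2 e, idempotent e & s = e * t.

Lemma ginvK : involutive (@ginv S).
Proof. by move=> s; apply/esym/ginv_uniq; [apply: mulVgK | apply: mulgVK]. Qed.

Lemma idem_ginv e : idempotent e -> e^v = e.
Proof. by move=> ee; apply/esym/ginv_uniq; rewrite !ee. Qed.

Lemma ginv1 : 1^v = 1 :> S.
Proof. by apply: idem_ginv; rewrite /idempotent mulg1. Qed.

Lemma idemM e f : idempotent e -> idempotent f -> idempotent (e * f).
Proof.
move=> ee ff; set x := (e * f)^v.
have K1 : e * (f * (x * (e * f))) = e * f by rewrite -[RHS]mulgVK !mulgA.
have K2 : x * (e * (f * x)) = x by rewrite -[RHS]mulVgK !mulgA.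
have K3 z : x * (e * (f * (x * z))) = x * z by rewrite -[in RHS]K2 -!mulgA.
have fe z : f * (f * z) = f * z by rewrite mulgA ff.
have ez z : e * (e * z) = e * z by rewrite mulgA ee.
have yx : f * (x * e) = x.
  by apply: ginv_uniq; rewrite -!mulgA ?ez ?fe ?ez ?fe ?K1 ?K3.
have xx : x * x = x.
  have -> : x * x = f * (x * e) * (f * (x * e)) by rewrite yx.
  by rewrite -!mulgA K3 yx.
have -> : e * f = x.
  rewrite -(idem_ginv xx); apply: ginv_uniq; rewrite -!mulgA; first exact: K2.
  exact: K1.
exact: xx.
Qed.

Lemma idemC e f : idempotent e -> idempotent f -> e * f = f * e.
Proof.
move=> ee ff; have ef := idemM ee ff; have fe := idemM ff ee.
rewrite -[LHS](idem_ginv ef); apply/esym/ginv_uniq; rewrite -!mulgA.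
  by rewrite (mulgA f f) ff (mulgA e e) ee mulgA.
by rewrite (mulgA e e) ee (mulgA f f) ff mulgA.
Qed.

Lemma idem_gV s : idempotent (s * s^v).
Proof. by rewrite /idempotent mulgA mulgVK. Qed.
Lemma idem_Vg s : idempotent (s^v * s).
Proof. by rewrite /idempotent mulgA mulVgK. Qed.

Lemma ginvM s t : (s * t)^v = t^v * s^v.
Proof.
have C := idemC (idem_Vg s) (idem_gV t).
apply/esym/ginv_uniq.
  rewrite -!mulgA (mulgA t) (mulgA s^v s) (mulgA (t * t^v)) -C.
  by rewrite -(mulgA (s^v * s)) !mulgA mulgVK -!mulgA (mulgA t) mulgVK.
rewrite -!mulgA (mulgA s^v) (mulgA t t^v) (mulgA (s^v * s)) C.
by rewrite -(mulgA (t * t^v)) !mulgA mulVgK -!mulgA (mulgA s^v) mulVgK.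
Qed.

Lemma idem_conj s e : idempotent e -> idempotent (s * e * s^v).
Proof.
move=> ee; rewrite /idempotent -!mulgA (mulgA s^v s) (mulgA e (s^v * s)).
by rewrite (idemC ee (idem_Vg s)) !mulgA mulgVK -(mulgA s e e) ee.
Qed.
End InverseMonoids.

Definition is_ideal (A : pzRingType) (P : A -> Prop) : Prop :=
  exists I : ideal A, forall x, P x <-> I x.

(* Partial maps of A are encoded as functions A -> option A. *)
Record unital_action (K : fieldType) (S : invMonoidType) (A : ualgType K) := UnitalAction {
  act : S -> A -> option A;
  act_dom s x := exists y, act s x = Some y;
  act_ran s y := exists x, act s x = Some y;
  (* act is a homomorphism into the symmetric inverse monoid of A *)
  act_inj : forall s x y z, act s x = Some z -> act s y = Some z -> x = y;
  actM : forall s t x, act (s * t)%g x = obind (act s) (act t x);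
  act1 : forall x, act 1%g x = Some x;
  (* by isomorphisms of K-algebras between ideals *)
  act_dom_ideal : forall s, is_ideal (act_dom s);
  act_ran_ideal : forall s, is_ideal (act_ran s);
  actD : forall s x y x' y', act s x = Some x' -> act s y = Some y' ->
    act s (x + y) = Some (x' + y');
  act_mul : forall s x y x' y', act s x = Some x' -> act s y = Some y' ->
    act s (x * y) = Some (x' * y');
  act_scal : forall s k x x', act s x = Some x' -> act s (scal k * x) = Some (scal k * x');
  (* the central idempotent 1_s *)
  aunit : S -> A;
  aunitC : forall s a, aunit s * a = a * aunit s;
  aunit_idem : forall s, aunit s * aunit s = aunit s;
  act_ranE : forall s y, act_ran s y <-> exists a, y = aunit s * a }.

Section UnitalActions.
Variables (K : fieldType) (S : invMonoidType) (A : ualgType K) (th : unital_action S A).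
Local Notation u := (aunit th).

(* s a = theta_s (1_{s^-1} a) *)
Definition sact (s : S) (a : A) : A := odflt 0 (act th s (u (ginv s) * a)).

Lemma act_ranP s y : act_ran th s y <-> u s * y = y.
Proof.
split=> [/act_ranE [a ->]|<-]; first by rewrite mulrA aunit_idem.
by apply/act_ranE; exists y.
Qed.

Lemma act_ginv s x y : act th s x = Some y -> act th (ginv s) y = Some x.
Proof.
move=> sx.
have : act th (s * ginv s * s)%g x = Some y by rewrite mulgVK.
rewrite -mulgA !actM sx /=; case E: (act th (ginv s) y) => [z|] //= sz.
by rewrite (act_inj sz sx).
Qed.

Lemma act_domP s x : act_dom th s x <-> u (ginv s) * x = x.
Proof.
rewrite -act_ranP; split=> [[y sx]|[y vy]]; first by exists y; apply: act_ginv.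
by exists y; rewrite -[s]ginvK; apply: act_ginv.
Qed.

Lemma sactE s a : act th s (u (ginv s) * a) = Some (sact s a).
Proof.
have [y E] : act_dom th s (u (ginv s) * a) by apply/act_domP; rewrite mulrA aunit_idem.
by rewrite /sact E.
Qed.

Lemma sactP s a b : act th s (u (ginv s) * a) = Some b -> sact s a = b.
Proof. by rewrite sactE => -[]. Qed.

Lemma act_sact s x y : act th s x = Some y -> sact s x = y.
Proof.
move=> sx; have /act_domP ux : act_dom th s x by exists y.
by apply: sactP; rewrite ux.
Qed.

Lemma sactD s : {morph sact s : a b / a + b}.
Proof. by move=> a b; apply: sactP; rewrite mulrDr; apply: actD; apply: sactE. Qed.

Lemma sact_mul s : {morph sact s : a b / a * b}.
Proof.
move=> a b; apply: sactP.
have -> : u (ginv s) * (a * b) = (u (ginv s) * a) * (u (ginv s) * b).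
  by rewrite mulrA -{1}(aunit_idem th (ginv s)) -!mulrA (mulrA _ a) (aunitC th _ a) !mulrA.
by apply: act_mul; apply: sactE.
Qed.

Lemma sactZ s k a : sact s (scal k * a) = scal k * sact s a.
Proof.
by apply: sactP; rewrite mulrA -scalC -mulrA; apply: act_scal; apply: sactE.
Qed.

Lemma sact_ran s a : u s * sact s a = sact s a.
Proof. by apply/act_ranP; exists (u (ginv s) * a); apply: sactE. Qed.

Lemma sact_unit s : sact s 1 = u s.
Proof.
have [x sx] : act_ran th s (u s) by apply/act_ranP; rewrite aunit_idem.
have := sact_mul s 1 x; rewrite mul1r (act_sact sx) -aunitC sact_ran => ->.
by [].
Qed.

Lemma aunit1 : u 1%g = 1.
Proof. by have /act_ranP : act_ran th 1%g 1; [exists 1; rewrite act1 | rewrite mulr1]. Qed.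

Lemma sact1 a : sact 1%g a = a.
Proof. by apply: act_sact; rewrite act1. Qed.

Lemma sactV s a : sact s (sact (ginv s) a) = u s * a.
Proof.
by have := sactE (ginv s) a; rewrite ginvK => /act_ginv; rewrite ginvK => /act_sact.
Qed.

Lemma sactM s t a : sact (s * t)%g a = sact s (sact t a).
Proof.
set f := sact (ginv t) (u (ginv s)).
have ft : sact t f = u t * u (ginv s) by rewrite sactV.
have fdom x : act_dom th (s * t)%g x -> f * x = x.
  case=> z; rewrite actM; case E: (act th t x) => [y|] //= sy.
  have yd : u (ginv s) * y = y by apply/act_domP; exists z.
  have yr : u t * y = y by apply/act_ranP; exists x.
  have := sact_mul t f x; rewrite ft (act_sact E) -mulrA yd yr => fx.
  apply: (@act_inj _ _ _ th t _ _ y) => //.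
  have [w2 w2E] : act_dom th t (f * x) by apply/act_domP; rewrite mulrA /f sact_ran.
  by rewrite w2E -(act_sact w2E) fx.
have ffix b : act_dom th (s * t)%g (f * b).
  have E : act th t (f * b) = Some (sact t (f * b)).
    have [w2 w2E] : act_dom th t (f * b) by apply/act_domP; rewrite mulrA /f sact_ran.
    by rewrite w2E (act_sact w2E).
  have [z zE] : act_dom th s (sact t (f * b)).
    by apply/act_domP; rewrite sact_mul ft (aunitC th t) !mulrA aunit_idem.
  by exists z; rewrite actM E /= zE.
have fu : f = u (ginv (s * t)%g).
  have uu : act_dom th (s * t)%g (u (ginv (s * t)%g)).
    by apply/act_domP; rewrite aunit_idem.
  have /act_domP := ffix 1; rewrite mulr1 => <-.
  by rewrite aunitC; apply: fdom.
have [z zE] := ffix a.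
have -> : sact (s * t)%g a = z by apply: sactP; rewrite -fu.
rewrite actM in zE; case E: (act th t (f * a)) zE => [y|] //= sy.
have fa : y = u (ginv s) * sact t a.
  by rewrite -(act_sact E) sact_mul ft -aunitC -mulrA sact_ran.
by apply/esym/sactP; rewrite -fa.
Qed.

Lemma aunit_le s t a : natural_le s t -> u s * a = a -> u t * a = a.
Proof.
case=> e ee -> ua.
have C : (e * t = t * (ginv t * e * t))%g.
  rewrite !mulgA (idemC (idem_gV t) ee) -!mulgA (mulgA t) mulgVK //.
have {ua} /act_ranP [x] := ua.
rewrite {1}C actM; case: (act _ _ x) => //= z tz.
by apply/act_ranP; exists z.
Qed.

Lemma sact0 s : sact s 0 = 0.
Proof. by apply: (addrI (sact s 0)); rewrite -sactD !addr0. Qed.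

(* L(A, theta, S) : the finitely supported w : S -> A with w s in 1_s A *)
Definition skew_pred : {pred {malg A[S]}} := fun w => `[< forall s, u s * w@_s = w@_s >].
Lemma skew_pred_closed : zmod_closed skew_pred.
Proof.
split; first by apply/asboolP => s; rewrite mcoeff0 mulr0.
move=> x y /asboolP xP /asboolP yP; apply/asboolP => s.
by rewrite mcoeffB mulrBr xP yP.
Qed.
HB.instance Definition _ := GRing.isZmodClosed.Build {malg A[S]} skew_pred skew_pred_closed.
Lemma skew_predD (v w : {malg A[S]}) :
  v \in skew_pred -> w \in skew_pred -> v + w \in skew_pred.
Proof. exact: rpredD. Qed.
Lemma skew_pred0 : 0 \in skew_pred. Proof. exact: rpred0. Qed.
End UnitalActions.

Definition skew (K : fieldType) (S : invMonoidType) (A : ualgType K) (th : unital_action S A) : Type :=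
  {w : {malg A[S]} | w \in skew_pred th}.

Section SkewRing.
Variables (K : fieldType) (S : invMonoidType) (A : ualgType K) (th : unital_action S A).
Local Notation u := (aunit th).
Local Notation L := (skew th).
Local Notation sact := (sact th).
HB.instance Definition _ := SubType.copy L {w : {malg A[S]} | w \in skew_pred th}.
HB.instance Definition _ := [Choice of L by <:].
HB.instance Definition _ := [SubChoice_isSubZmodule of L by <:].

Definition skv (w : L) : {malg A[S]} := val w.
Lemma skv_additive : additive skv. Proof. exact: raddfB. Qed.
HB.instance Definition _ := GRing.isAdditive.Build L {malg A[S]} skv skv_additive.
Lemma skv_inj : injective skv. Proof. exact: val_inj. Qed.

Let m (s : S) (a b : A) := a * sact s b.
Let mDl t b : {morph m t ^~ b : x y / x + y}.
Proof. by move=> x y; rewrite /m mulrDl. Qed.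
Let mDr t a : {morph m t a : x y / x + y}.
Proof. by move=> x y; rewrite /m sactD mulrDr. Qed.
Let mA t v a b c : m t a (m v b c) = m (t * v)%g (m t a b) c.
Proof. by rewrite /m sact_mul sactM mulrA. Qed.

Lemma skew_coef (w : L) s : u s * (skv w)@_s = (skv w)@_s.
Proof. by move: s; apply/(@asboolP (forall s, u s * (skv w)@_s = (skv w)@_s))/(valP w). Qed.

Lemma deltaP s a : << u s * a *g s >> \in skew_pred th.
Proof.
apply/asboolP => t; rewrite mcoeffU; case: eqP => [<-|_]; last by rewrite mulr0n mulr0.
by rewrite mulr1n mulrA aunit_idem.
Qed.
(* a delta_s when a lies in 1_s A, and (1_s a) delta_s in general *)
Definition delta (s : S) (a : A) : L := Sub << u s * a *g s >> (deltaP s a).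

Lemma deltaE s a : skv (delta s a) = << u s * a *g s >>.
Proof. exact: SubK. Qed.

Lemma delta_eq s a b : u s * a = u s * b -> delta s a = delta s b.
Proof. by move=> ab; apply: skv_inj; rewrite !deltaE ab. Qed.

Lemma deltaD s a b : delta s (a + b) = delta s a + delta s b.
Proof. by apply: skv_inj; rewrite raddfD !deltaE mulrDr monalgUD. Qed.

Lemma skew_ind (P : L -> Prop) :
  P 0 -> (forall x y, P x -> P y -> P (x + y)) -> (forall s a, P (delta s a)) ->
  forall x, P x.
Proof.
move=> P0 PD Pd x.
have -> : x = \sum_(s <- msupp (skv x)) delta s ((skv x)@_s).
  apply: skv_inj; rewrite raddf_sum [LHS]monalgE; apply: eq_bigr => s _.
  by rewrite [RHS]deltaE skew_coef.
by elim/big_ind: _.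
Qed.

Lemma delta_mul_subproof s t a b :
  gmul m << u s * a *g s >> << u t * b *g t >> =
  << u (s * t)%g * (a * sact s b) *g (s * t)%g >>.
Proof.
rewrite (gmulUU mDl mDr) /m; congr << _ *g _ >>.
rewrite -[in LHS](sact_unit th t) sact_mul -sactM sact_unit.
rewrite (aunitC th s a) -(mulrA a (u s)) (mulrA (u s)) (aunitC th s (u (s * t)%g)).
rewrite -(mulrA (u (s * t)%g)) sact_ran (mulrA a) -(aunitC th (s * t)%g a).
by rewrite mulrA.
Qed.

Lemma smulP (x y : L) : gmul m (skv x) (skv y) \in skew_pred th.
Proof.
elim/skew_ind: x => [|x x' IHx IHx'|s a].
- by rewrite raddf0 (g0mul mDl mDr); apply: skew_pred0.
- by rewrite (raddfD skv x x') (gmulDl mDl mDr); exact: (skew_predD IHx IHx').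
elim/skew_ind: y => [|y y' IHy IHy'|t b].
- by rewrite raddf0 (gmul0 mDl mDr); apply: skew_pred0.
- by rewrite (raddfD skv y y') (gmulDr mDl mDr); exact: (skew_predD IHy IHy').
- by rewrite !deltaE delta_mul_subproof; apply: deltaP.
Qed.

(* (a delta_s)(b delta_t) = a theta_s(1_{s^-1} b) delta_{s t} *)
Definition smul (x y : L) : L :=
  Sub (gmul (fun s a b => a * sact s b) (skv x) (skv y)) (smulP x y).

Lemma smulE x y : skv (smul x y) = gmul m (skv x) (skv y).
Proof. exact: SubK. Qed.

Lemma delta_smul s t a b : smul (delta s a) (delta t b) = delta (s * t)%g (a * sact s b).
Proof. by apply: skv_inj; rewrite smulE !deltaE delta_mul_subproof. Qed.

Lemma smulA : associative smul.
Proof. by move=> x y z; apply: skv_inj; rewrite !smulE (gmulA mDl mDr mA). Qed.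
Lemma smulDl : left_distributive smul +%R.
Proof. by move=> x y z; apply: skv_inj; rewrite raddfD !smulE raddfD (gmulDl mDl mDr). Qed.
Lemma smulDr : right_distributive smul +%R.
Proof. by move=> x y z; apply: skv_inj; rewrite raddfD !smulE raddfD (gmulDr mDl mDr). Qed.
Lemma s0mul x : smul 0 x = 0.
Proof. by apply: (addrI (smul 0 x)); rewrite -smulDl !addr0. Qed.
Lemma smul0 x : smul x 0 = 0.
Proof. by apply: (addrI (smul x 0)); rewrite -smulDr !addr0. Qed.

Lemma smul1 : left_id (delta 1%g 1) smul.
Proof.
elim/skew_ind=> [|x y IHx IHy|s a]; first by rewrite smul0.
  by rewrite smulDr IHx IHy.
by rewrite delta_smul mul1g mul1r sact1.
Qed.
Lemma s1mul : right_id (delta 1%g 1) smul.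
Proof.
elim/skew_ind=> [|x y IHx IHy|s a]; first by rewrite s0mul.
  by rewrite smulDl IHx IHy.
rewrite delta_smul mulg1 sact_unit; apply: delta_eq.
by rewrite -aunitC mulrA aunit_idem.
Qed.
HB.instance Definition _ := GRing.Zmodule_isPzRing.Build L smulA smul1 s1mul smulDl smulDr.

Lemma deltaM s t a b : delta s a * delta t b = delta (s * t)%g (a * sact s b).
Proof. exact: delta_smul. Qed.

Definition emb1 (a : A) : L := delta 1%g a.
Lemma emb1D : additive emb1.
Proof. by apply: morphD_additive => a b; apply: deltaD. Qed.
Lemma emb1M : monoid_morphism emb1.
Proof. by split=> // a b; rewrite /emb1 deltaM mulg1 sact1. Qed.
HB.instance Definition _ := GRing.isAdditive.Build A L emb1 emb1D.
HB.instance Definition _ := GRing.isMonoidMorphism.Build A L emb1 emb1M.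

Definition sscal (k : K) : L := emb1 (scal k).
Lemma sscal_additive : additive sscal.
Proof. by move=> a b; rewrite /sscal !raddfB. Qed.
Lemma sscal_monoid_morphism : monoid_morphism sscal.
Proof. by split=> [|a b]; rewrite /sscal ?rmorph1 // !rmorphM. Qed.
Lemma sscalC k (x : L) : sscal k * x = x * sscal k.
Proof.
elim/skew_ind: x => [|x y IHx IHy|s a]; first by rewrite mulr0 mul0r.
  by rewrite mulrDr mulrDl IHx IHy.
rewrite /sscal /emb1 !deltaM mul1g mulg1 sact1; apply: delta_eq.
have -> : a * sact s (scal k) = u s * (scal k * a).
  by rewrite -[scal k in LHS]mulr1 sactZ sact_unit mulrA -(scalC k a) -aunitC.
by rewrite (mulrA (u s) (u s)) aunit_idem.
Qed.
HB.instance Definition _ := PzRing_isUnitalAlgebra.Build K L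
  sscal_additive sscal_monoid_morphism sscalC.

(* For s <= t and a in 1_s A one also has a in 1_t A (aunit_le), so that
   delta t a is a delta_t. *)
Definition crossed_rel (w : L) : Prop :=
  exists s t a, [/\ natural_le s t, u s * a = a & w = delta s a - delta t a].

Definition crossed : ualgType K := qalg (gideal crossed_rel).

Definition cls (w : L) : crossed := qpi (gideal crossed_rel) w.
(* A -> A x S, a |-> class of a delta_1 *)
Definition eta (a : A) : crossed := cls (emb1 a).
Lemma eta_additive : additive eta.
Proof. by move=> a b; rewrite /eta /cls !raddfB. Qed.
Lemma eta_monoid_morphism : monoid_morphism eta.
Proof.
split=> [|a b]; first by rewrite /eta /cls !rmorph1.
by rewrite /eta /cls !rmorphM.
Qed.
HB.instance Definition _ := GRing.isAdditive.Build A crossed eta eta_additive.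
HB.instance Definition _ := GRing.isMonoidMorphism.Build A crossed eta eta_monoid_morphism.
Lemma etaM a b : eta (a * b) = eta a * eta b.
Proof. exact: rmorphM. Qed.
Lemma eta_scal k : eta (scal k) = scal k.
Proof. by []. Qed.

(* the class of 1_s delta_s *)
Definition gen (s : S) : crossed := cls (delta s (u s)).

Lemma gen1 : gen 1%g = 1.
Proof. by rewrite /gen aunit1 -[LHS]/(eta 1) rmorph1. Qed.
Lemma clsM x y : cls (x * y) = cls x * cls y.
Proof. exact: (rmorphM (qpi (gideal crossed_rel))). Qed.
Lemma genM s t : gen (s * t)%g = gen s * gen t.
Proof.
rewrite /gen -clsM deltaM; congr cls; apply: delta_eq.
rewrite aunit_idem -[u t](sact_unit th) -sactM sact_unit.
by rewrite (aunitC th s) mulrA aunit_idem -{2}(sact_unit th (s * t)%g) sactM -(aunitC th s) sact_ran -sactM sact_unit.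
Qed.
Lemma gen_eta s a : gen s * eta a = eta (sact s a) * gen s.
Proof.
rewrite /gen /eta -!clsM !deltaM mulg1 mul1g; congr cls; apply: delta_eq.
by rewrite sact1 -aunitC !sact_ran.
Qed.
Lemma eta_gen s : eta (u s) * gen s = gen s.
Proof.
by rewrite /gen /eta -clsM deltaM mul1g sact1 aunit_idem.
Qed.
End SkewRing.

Section RepMap.
Variables (K : fieldType) (S : monoidType) (V W : monoid_rep K S) (f : {linear V -> W}).
Hypothesis fS : forall s x, f (ract s x) = ract s (f x).
Lemma repmap_linear : linear (f : repmod V -> repmod W).
Proof.
move=> w x y; rewrite linearD; congr (_ + _).
by rewrite [LHS]linear_sum; apply: eq_bigr => s _; rewrite linearZ /= fS.
Qed.
Definition repmap : {linear repmod V -> repmod W} := mkLinear repmap_linear.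
End RepMap.

(* K E(S), with s e = s e s^-1 *)
Definition idems (S : invMonoidType) : Type := {e : S | (e * e)%g == e}.

Section IdempotentModule.
Variables (K : fieldType) (S : invMonoidType).
HB.instance Definition _ := SubType.copy (idems S) {e : S | (e * e)%g == e}.
HB.instance Definition _ := [Choice of idems S by <:].

Lemma idemsP (e : idems S) : idempotent (val e).
Proof. exact/eqP/(valP e). Qed.
Definition idems_conj (s : S) (e : idems S) : idems S :=
  exist _ (s * val e * ginv s)%g (introT eqP (idem_conj s (idemsP e))).
Definition KE_act (s : S) (x : {malg K[idems S]}) : {malg K[idems S]} :=
  mext (fun e => << 1 *g idems_conj s e >>) x.
Lemma KE_actL s : linear (KE_act s). Proof. exact: mext_linear. Qed.
Lemma KE_actU s e : KE_act s << 1 *g e >> = << 1 *g idems_conj s e >>.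
Proof. by rewrite [LHS]mextU scale1r. Qed.
Lemma KE_act1 x : KE_act 1%g x = x.
Proof.
apply: (@malg_eq _ _ _ (mkLinear (KE_actL 1%g)) idfun) => e /=.
rewrite KE_actU; congr << _ *g _ >>; apply: val_inj.
by rewrite /= ginv1 mulg1 mul1g.
Qed.
Lemma KE_actM s t x : KE_act (s * t)%g x = KE_act s (KE_act t x).
Proof.
apply: (@malg_eq _ _ _ (mkLinear (KE_actL (s * t)%g))
  (mkLinear (KE_actL s) \o mkLinear (KE_actL t))) => e /=.
rewrite !KE_actU; congr << _ *g _ >>; apply: val_inj.
by rewrite /= ginvM !mulgA.
Qed.
Definition KE : lmodType (monalg K S) := repmod (MonoidRep KE_actL KE_act1 KE_actM).
End IdempotentModule.

(* H^n(S, V) *)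
Definition Hmon (K : fieldType) (S : invMonoidType) (n : nat) (V : lmodType (monalg K S)) :
    lmodType K :=
  Ext n (KE K S) V.

Section T1.
Variables (K : fieldType) (S : invMonoidType) (A : ualgType K) (th : unital_action S A).
Local Notation Lam := (crossed th).
Local Notation etaA := (eta th : {rmorphism A -> Lam}).
Local Notation sact := (sact th).

(* A^e -> (A x S)^e, a (x) b |-> eta a (x) eta b *)
Definition eta_env : {rmorphism env A -> env Lam} := env_map (f := etaA) (eta_scal th).

Definition cross_gen (s : S) : env Lam := tens (gen th s) (gen th (ginv s)).

Lemma eta_env_scal k : eta_env (scal k) = scal k.
Proof.
rewrite -[scal k in LHS]mulr1 -tens1 -tensZl mulr1 /eta_env env_mapE rmorph1.
by rewrite -[etaA (scal k)]/(eta th (scal k)) eta_scal -[scal k in LHS]mulr1 tensZl tens1 mulr1.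
Qed.

Lemma cross_gen1 : cross_gen 1%g = 1.
Proof. by rewrite /cross_gen ginv1 !gen1 tens1. Qed.
Lemma cross_genM s t : cross_gen (s * t)%g = cross_gen s * cross_gen t.
Proof. by rewrite /cross_gen ginvM !genM tensM. Qed.
Lemma cross_gen_eta s b c :
  cross_gen s * eta_env (tens (sact (ginv s) b) (sact (ginv s) c)) =
  eta_env (tens b c) * cross_gen s.
Proof.
rewrite /eta_env !env_mapE /cross_gen !tensM; congr tens; last by rewrite gen_eta.
by rewrite [LHS]gen_eta sactV aunitC etaM -mulrA eta_gen.
Qed.

Variable M : lmodType (env Lam).
Local Notation resM := (res eta_env M : lmodType (env A)).
Local Notation H := (hom (regbimod A) resM).

(* (s f)(a) = s f(s^-1 a), where s x = 1_s delta_s x 1_{s^-1} delta_{s^-1} *)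
Definition T1_fun (s : S) (f : H) (a : regbimod A) : resM :=
  cross_gen s *: (homlin f (sact (ginv s) a) : M).

Lemma T1_fun_linear s f : linear (T1_fun s f).
Proof.
have D : {morph T1_fun s f : x y / x + y}.
  by move=> x y; rewrite /T1_fun (sactD th) linearD scalerDr.
move=> w x y; rewrite D; congr (_ + _).
have Z0 : T1_fun s f 0 = 0 by apply: (addrI (T1_fun s f 0)); rewrite -D !addr0.
elim/env_ind: w => [|v w IHv IHw|b c]; first by rewrite !scale0r.
  by rewrite !scalerDl D IHv IHw.
rewrite regbimodE /T1_fun !(sact_mul th) -regbimodE linearZ.
rewrite [LHS](scalerA (cross_gen s) (eta_env _)) cross_gen_eta.
by rewrite -scalerA.
Qed.

Definition T1_act (s : S) (f : H) : H := mkhom (mkLinear (@T1_fun_linear s f)).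

Lemma T1_actE s f a : homlin (T1_act s f) a = T1_fun s f a. Proof. by []. Qed.

Lemma T1_act_linear s : linear (T1_act s).
Proof.
move=> k f g; apply: homP => a.
rewrite homD homZ !T1_actE /T1_fun homD homZ.
rewrite [LHS](scalerDr (cross_gen s)); congr (_ + _).
have E (m : M) : cross_gen s *: (eta_env (scal k) *: m) = eta_env (scal k) *: (cross_gen s *: m).
  rewrite eta_env_scal.
  rewrite [LHS]scalerA [RHS]scalerA.
  exact: (congr1 (fun z => z *: m) (esym (scalC k (cross_gen s)))).
exact: E.
Qed.

Lemma T1_act1 f : T1_act 1%g f = f.
Proof.
apply: homP => a; rewrite T1_actE /T1_fun cross_gen1 scale1r.
by rewrite ginv1 (sact1 th).
Qed.
Lemma T1_actM s t f : T1_act (s * t)%g f = T1_act s (T1_act t f).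
Proof.
apply: homP => a; rewrite !T1_actE /T1_fun T1_actE /T1_fun ginvM (sactM th).
by rewrite scalerA cross_genM.
Qed.
Definition T1_rep : monoid_rep K S := MonoidRep T1_act_linear T1_act1 T1_actM.
Definition T1_ob : lmodType (monalg K S) := repmod T1_rep.
End T1.

Section T1Functor.
Variables (K : fieldType) (S : invMonoidType) (A : ualgType K) (th : unital_action S A).
Local Notation Lam := (crossed th).
Section Map.
Variables (M N : lmodType (env Lam)) (f : {linear M -> N}).
Local Notation res := (res (eta_env th)).
Lemma res_linear : linear (f : res M -> res N).
Proof. by move=> a x y; apply: linearP. Qed.
Definition T1_lin : {linear T1_rep M -> T1_rep N} :=
  hom_map (mkLinear res_linear).
Lemma T1_linS s x : T1_lin (ract s x) = ract s (T1_lin x).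
Proof. by apply: homP => a; apply: linearZ_LR. Qed.
Definition T1_map : {linear T1_ob M -> T1_ob N} := repmap T1_linS.
End Map.

(* Hom_(A^e)(A, -) from (A x S)^e-modules to KS-modules *)
Definition T1 : modfunctor (env Lam) (monalg K S).
Proof.
refine (@ModFunctor _ _ (@T1_ob K S A th) (@T1_map) _ _ _).
- by move=> M h; apply: homP.
- by move=> M N P g f h; apply: homP.
- by move=> M N f g h; apply: homP.
Defined.
End T1Functor.

(* H^q(A, M) as a KS-module, namely (R^q T1) M. Its underlying K-module is the
   cohomology of Hom_(A^e)(A, I), for I an injective resolution of M over
   (A x S)^e; when I is injective over A^e as well, this is Ext^q_(A^e)(A, M). *)
Definition HochschildS (K : fieldType) (S : invMonoidType) (A : ualgType K)
    (th : unital_action S A) (q : nat) (M : lmodType (env (crossed th))) :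
    lmodType (monalg K S) :=
  rderived (T1 th) q M.

Section SpectralSequences.
Variable K : pzRingType.

Definition bidegree (r p q p' q' : nat) : Prop := p' = (p + r)%N /\ (q' + r)%N = q.+1.

Section Pages.
Variables (E : nat -> nat -> lmodType K) (r : nat)
  (d : forall p q p' q', {linear E p q -> E p' q'}).

Definition pcyc p q (x : E p q) : Prop :=
  forall p' q', bidegree r p q p' q' -> d p q p' q' x = 0.
Lemma pcyc0 p q : @pcyc p q 0. Proof. by move=> p' q' _; rewrite linear0. Qed.
Lemma pcycD p q (x y : E p q) : pcyc x -> pcyc y -> pcyc (x + y).
Proof. by move=> xc yc p' q' b; rewrite linearD xc // yc // addr0. Qed.
Lemma pcycZ p q a (x : E p q) : pcyc x -> pcyc (a *: x).
Proof. by move=> xc p' q' b; rewrite linearZ /= xc // scaler0. Qed.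
Definition page_cycles p q : submod (E p q) := Submod (@pcyc0 p q) (@pcycD p q) (@pcycZ p q).

Definition pbnd p q (x : E p q) : Prop :=
  x = 0 \/ exists p0 q0 (y : E p0 q0), bidegree r p0 q0 p q /\ x = d p0 q0 p q y.
Lemma pbnd0 p q : @pbnd p q 0. Proof. by left. Qed.
Lemma pbndD p q (x y : E p q) : pbnd x -> pbnd y -> pbnd (x + y).
Proof.
case=> [->|[p0 [q0 [x' [[b1 b2] ->]]]]]; first by rewrite add0r.
case=> [->|[p1 [q1 [y' [[b1' b2'] ->]]]]].
  by rewrite addr0; right; exists p0, q0, x'.
have pp : p1 = p0 by apply: (@addIn r); rewrite -b1 b1'.
have qq : q1 = q0 by apply: succn_inj; rewrite -b2 b2'.
subst p1 q1; right; exists p0, q0, (x' + y').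
by rewrite linearD.
Qed.
Lemma pbndZ p q a (x : E p q) : pbnd x -> pbnd (a *: x).
Proof.
case=> [->|[p0 [q0 [y [b ->]]]]]; first by rewrite scaler0; left.
by right; exists p0, q0, (a *: y); rewrite linearZ.
Qed.
Definition page_boundaries p q : submod (E p q) :=
  Submod (@pbnd0 p q) (@pbndD p q) (@pbndZ p q).

Definition page_homology p q : lmodType K := subquo (page_cycles p q) (page_boundaries p q).
End Pages.

(* E_r^{p,q} for r >= 2 and p, q >= 0, and zero outside this quadrant;
   page_dif r p q p' q' is the differential d_r when bidegree r p q p' q',
   that is (p', q') = (p + r, q - r + 1), and is irrelevant otherwise. *)
Record spectral_sequence := SpectralSequence {
  page : nat -> nat -> nat -> lmodType K;
  page_dif : forall r p q p' q', {linear page r p q -> page r p' q'};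
  page_dif_dif : forall r p q p' q' p'' q'' (x : page r p q), (2 <= r)%N ->
    bidegree r p q p' q' -> bidegree r p' q' p'' q'' ->
    page_dif r p' q' p'' q'' (page_dif r p q p' q' x) = 0;
  page_next : forall r p q, (2 <= r)%N ->
    lmod_iso (page r.+1 p q) (page_homology r (page_dif r) p q) }.

(* No differential enters or leaves position (p, q) from page max(p, q + 1) + 1 on. *)
Definition page_infty (E : spectral_sequence) (p q : nat) : lmodType K :=
  page E (maxn p q.+1).+1 p q.

(* E_2^{p,q} => H^{p+q} *)
Definition converges_to (E : spectral_sequence) (H : nat -> lmodType K) : Prop :=
  forall n, exists F : nat -> submod (H n),
    [/\ forall x, F 0%N x,
        forall p x, F p.+1 x -> F p x,
        forall x, F n.+1 x -> x = 0 &
        forall p q, (p + q)%N = n ->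
          lmod_iso (page_infty E p q) (subquo (F p) (F p.+1))].
End SpectralSequences.

(* Main.v *)
From HB Require Import structures.
From mathcomp Require Import all_boot all_algebra finmap monalg.
From mathcomp Require Import boolp functions.
Require Import Defs.

(* Let L be the crossed product, I an injective resolution of M over L^e and
   T1 = Hom_(A^e)(A, -). Since K E(S) is generated by 1 as a K S-module,
   Hom_(KS)(K E(S), T1 I^q) is the set of x in I^q that commute with A and satisfy
   s x = s s^-1 x for all s in S, which means that x commutes with L: this is
   Hom_(L^e)(L, I^q). Moreover T1 sends the injective modules Hom_K(L^e, W) to injective
   K S-modules: L^e (x)_(A^e) A is isomorphic to L (x)_(K E(S)) K S as a right K S-module,
   and modules over K E(S) are flat because this algebra is spanned by commuting
   idempotents.
   The spectral sequence is that of the double complex Hom_(KS)(K E(S), J^p(T1 I^q)), where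
   J is the standard injective resolution. As J is functorial and exact, taking the
   cohomology in the direction of q first gives E_2 = H^p(S, H^q(A, M)); as T1 I^q is
   injective, taking it in the direction of p first leaves Hom_(L^e)(L, I^q) in the column
   p = 0.
   Flatness is what makes I an injective resolution over A^e; it identifies the K-module
   underlying (R^q T1) M with H^q(A, M). *)

Set Implicit Arguments.
Unset Strict Implicit.
Unset Printing Implicit Defensive.
Import GRing.Theory.
Local Open Scope ring_scope.

(** * Subquotients and linear relations *)

(** The functor J plays the part of a Cartan-Eilenberg resolution: it is functorial on the nose, so
    applying it termwise to T1 I gives a double complex, and its exactness makes it commute with
    cocycles and cohomology in the direction of q. The isomorphism behind the injectivity of T1 I^q
    comes from L^e (x)_(A^e) A = L (x)_A L. Write s for the class of 1_s delta_s. As s s^-1 lies in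
    A, the element x (x) a s equals x a s s^-1 (x) s, which is (x a s (x) 1) s^-1 for the right
    action of S. A K S-linear map into T1 of Hom_K(L^e, W) is therefore determined by values on the
    elements x (x) 1, and besides bilinearity these values only have to let idempotents of S cross
    from x to the argument. The obstacle is the converse: L is a quotient by an ideal known through
    generators only, so a map rebuilt from such values must be shown to respect that ideal. For
    this, L(A, theta, S) is first made to act on all balanced maps at once. Isomorphisms of
    subquotients are given throughout as linear relations between representatives. *)

Section LinearRelations.
Variable R : pzRingType.

Definition linear_relation (V W : lmodType R) (r : V -> W -> Prop) : Prop :=
  forall (a : R) x y u v, r x u -> r y v -> r (a *: x + y) (a *: u + v).

(** By linearity the last hypothesis makes the relation both single-valued and injective, so it is
    the graph of an isomorphism. *)
Lemma linear_relation_iso (V W : lmodType R) (r : V -> W -> Prop) :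
  linear_relation r ->
  (forall x, exists u, r x u) -> (forall u, exists x, r x u) ->
  (forall x u, r x u -> (x = 0 <-> u = 0)) -> lmod_iso V W.
Proof.
move=> rL rV rW r0.
have rB x y u v : r x u -> r y v -> (x = y <-> u = v).
  move=> xu yv; have := r0 _ _ (rL (-1) _ _ _ _ yv xu).
  rewrite !scaleN1r ![- _ + _]addrC => E.
  by split=> /eqP; rewrite -subr_eq0 => /eqP/E/eqP; rewrite subr_eq0 => /eqP.
pose f x := projT1 (cid (rV x)); pose g u := projT1 (cid (rW u)).
have fP x : r x (f x) by rewrite /f; case: cid.
have gP u : r (g u) u by rewrite /g; case: cid.
have fL : linear f by move=> a x y; apply/(rB _ _ _ _ (fP _) (rL _ _ _ _ _ (fP x) (fP y))).
exists (mkLinear fL), g => [x|u] /=.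
  by apply/(rB _ _ _ _ (gP _) (fP _)).
exact/(rB _ _ _ _ (fP _) (gP _)).
Qed.

Lemma lmod_iso_sym (V W : lmodType R) : lmod_iso V W -> lmod_iso W V.
Proof.
case=> f [g fK gK]; have gL : linear g.
  by move=> a x y; apply: (can_inj fK); rewrite linearP !gK.
by exists (mkLinear gL), f.
Qed.

Lemma lmod_iso_trans (U V W : lmodType R) : lmod_iso U V -> lmod_iso V W -> lmod_iso U W.
Proof. by case=> f fb [g gb]; exists (g \o f); apply: bij_comp. Qed.

Section Subquo.
Variables (V : lmodType R) (Z B : submod V).

Definition represents (x : V) (u : subquo Z B) : Prop :=
  exists z : subm Z, incl z = x /\ u = proj _ z.

Lemma represents_linear : linear_relation represents.
Proof.
move=> a x y _ _ [z [<- ->]] [w [<- ->]]; exists (a *: z + w).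
by rewrite !linearP.
Qed.

Lemma represents_ex u : exists2 x, Z x & represents x u.
Proof.
have [z ->] := proj_surj u; exists (incl z); first exact: inclP.
by exists z.
Qed.

Lemma represents_class x : Z x -> exists u, represents x u.
Proof. by move=> Zx; exists (proj _ (mksub Zx)), (mksub Zx); rewrite inclK. Qed.

Lemma represents0 x u : represents x u -> (B x <-> u = 0).
Proof. by case=> z [<- ->]; rewrite proj_eq0. Qed.

Lemma representsZ x u : represents x u -> Z x.
Proof. by case=> z [<- _]; apply: inclP. Qed.

Lemma represents_unique x y u v : represents x u -> represents y v -> (B (x - y) <-> u = v).
Proof.
move=> xu yv; have := represents_linear (-1) yv xu.
rewrite !scaleN1r ![- _ + _]addrC => /represents0 ->.
by split=> [/eqP|->]; rewrite ?subrr // subr_eq0 => /eqP.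
Qed.

Section SubquoRelation.
Variables (W : lmodType R) (r : V -> W -> Prop).
Hypothesis rL : linear_relation r.

Lemma subquo_iso :
  (forall x, Z x -> exists u, r x u) -> (forall u, exists2 x, Z x & r x u) ->
  (forall x u, Z x -> r x u -> (B x <-> u = 0)) -> lmod_iso (subquo Z B) W.
Proof.
move=> rZ rW r0; apply: (@linear_relation_iso _ _ (fun q u => exists2 x, represents x q & r x u)).
- move=> a q q' u u' [x xq xu] [x' xq' xu'].
  by exists (a *: x + x'); [apply: represents_linear | apply: rL].
- move=> q; have [x Zx xq] := represents_ex q; have [u xu] := rZ _ Zx.
  by exists u, x.
- move=> u; have [x Zx xu] := rW u; have [q xq] := represents_class Zx.
  by exists q, x.
- move=> q u [x xq xu]; rewrite -(represents0 xq); apply: r0 => //.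
  exact: representsZ xq.
Qed.
End SubquoRelation.
End Subquo.

Lemma subquo_subquo_iso (V W : lmodType R) (Z B : submod V) (Z' B' : submod W)
    (r : V -> W -> Prop) :
  linear_relation r ->
  (forall x, Z x -> exists2 u, Z' u & r x u) -> (forall u, Z' u -> exists2 x, Z x & r x u) ->
  (forall x u, Z x -> Z' u -> r x u -> (B x <-> B' u)) -> lmod_iso (subquo Z B) (subquo Z' B').
Proof.
move=> rL rZ rZ' rB; apply: (@subquo_iso _ _ _ _ (fun x q => exists2 u, represents u q & r x u)).
- move=> a x x' q q' [u uq xu] [u' uq' xu'].
  by exists (a *: u + u'); [apply: represents_linear | apply: rL].
- by move=> x /rZ [u /(represents_class B') [q uq] xu]; exists q, u.
- move=> q; have [u Zu uq] := represents_ex q; have [x Zx xu] := rZ' _ Zu.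
  by exists x => //; exists u.
- move=> x q Zx [u uq xu]; rewrite -(represents0 uq); apply: rB => //.
  exact: representsZ uq.
Qed.

End LinearRelations.

(** * The spectral sequence of a filtered complex *)

Section FilteredComplex.
Variables (K : pzRingType) (C : lmodType K) (d : {linear C -> C}).
(* deg is shifted: deg n.+1 consists of the elements of degree n. *)
Variables (deg Fil : nat -> submod C).
Hypothesis d_d : forall x, d (d x) = 0.
Hypothesis degd : forall n x, deg n x -> deg n.+1 (d x).
Hypothesis Fil0 : forall x, Fil 0 x.
Hypothesis FilS : forall p x, Fil p.+1 x -> Fil p x.
Hypothesis Fil_deg : forall n x, deg n x -> Fil n x -> x = 0.

Lemma Fil_le p p' x : (p <= p')%N -> Fil p' x -> Fil p x.
Proof.
move=> /subnK <-; elim: (p' - p)%N => [//|n IH]; rewrite addSn => /FilS; exact: IH.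
Qed.

Lemma subd0 x : x - d 0 = x. Proof. by rewrite linear0 subr0. Qed.

Definition Zfil r p q (x : C) : Prop := [/\ deg (p + q).+1 x, Fil p x & Fil (p + r) (d x)].
Lemma Zfil0 r p q : Zfil r p q 0.
Proof. by split; rewrite ?linear0; apply: smem0. Qed.
Lemma ZfilD r p q x y : Zfil r p q x -> Zfil r p q y -> Zfil r p q (x + y).
Proof. by case=> ? ? ? [? ? ?]; split; rewrite ?linearD; apply: smemD. Qed.
Lemma ZfilZ r p q a x : Zfil r p q x -> Zfil r p q (a *: x).
Proof. by case=> ? ? ?; split; rewrite ?linearZ; apply: smemZ. Qed.
Definition Zsub r p q := Submod (@Zfil0 r p q) (@ZfilD r p q) (@ZfilZ r p q).

(* The truncated subtraction is harmless since Fil p is everything for p <= 0. *)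
Definition Bfil r p q (x : C) : Prop :=
  exists z, [/\ deg (p + q) z, Fil (p.+1 - r) z & Fil p.+1 (x - d z)].
Lemma Bfil0 r p q : Bfil r p q 0.
Proof. by exists 0; split; [apply: smem0 | apply: smem0 | rewrite subd0; apply: smem0]. Qed.
Lemma BfilD r p q x y : Bfil r p q x -> Bfil r p q y -> Bfil r p q (x + y).
Proof.
case=> z [? ? ?] [w [? ? ?]]; exists (z + w).
by split; rewrite ?linearD ?opprD ?[_ + _ + (- _ - _)]addrACA; apply: smemD.
Qed.
Lemma BfilZ r p q a x : Bfil r p q x -> Bfil r p q (a *: x).
Proof.
case=> z [? ? ?]; exists (a *: z); split; [exact: smemZ|exact: smemZ|].
by rewrite linearZ_LR -scalerBr; apply: smemZ.
Qed.
Definition Bsub r p q := Submod (@Bfil0 r p q) (@BfilD r p q) (@BfilZ r p q).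

(** The usual denominator is Z_(r-1)^(p+1) + d Z_(r-1)^(p+1-r) rather than F^(p+1) + d F^(p+1-r).
    Both meet Z_r^p in the same submodule, and [subquo] depends on that intersection only. *)
Definition fpage r p q : lmodType K := subquo (Zsub r p q) (Bsub r p q).

Lemma Zfil_d r p q p' q' x : bidegree r p q p' q' -> Zfil r p q x -> Zfil r p' q' (d x).
Proof.
case=> -> e [xd xp xr]; split=> //; last by rewrite d_d; apply: smem0.
have -> : ((p + r + q').+1 = (p + q).+2)%N by rewrite -addnA [(r + _)%N]addnC e addnS.
exact: degd.
Qed.

Lemma Bfil_d r p q p' q' x : bidegree r p q p' q' -> Zfil r p q x -> Bfil r p q x ->
  Bfil r p' q' (d x).
Proof.
case=> -> e [xd xp xr] [z [zd zp xz]]; exists (x - d z); split.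
- have -> : (p + r + q' = (p + q).+1)%N by rewrite -addnA [(r + _)%N]addnC e addnS.
  by apply: smemB => //; apply: degd.
- by rewrite -addSn addnK.
- by rewrite linearB d_d subr0 subrr; apply: smem0.
Qed.

Section PageDif.
Variables (r p q p' q' : nat).

(** The second clause is a default value: [spectral_sequence] asks for a map between any two
    positions. *)
Definition fpage_graph (u : fpage r p q) (v : fpage r p' q') : Prop :=
  bidegree r p q p' q' /\ (exists2 x, represents x u & represents (d x) v) \/
  ~ bidegree r p q p' q' /\ v = 0.

Lemma fpage_graph_ex u : exists v, fpage_graph u v.
Proof.
have [b|nb] := pselect (bidegree r p q p' q'); last by exists 0; right.
have [x Zx xu] := represents_ex u.
have [v xv] := represents_class (Bsub r p' q') (Zfil_d b Zx : Zsub r p' q' _).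
by exists v; left; split=> //; exists x.
Qed.

Lemma fpage_graph_unique u v w : fpage_graph u v -> fpage_graph u w -> v = w.
Proof.
case=> [[b [x xu xv]]|[nb ->]] [[b' [y yu yw]]|[nb' ->]] //.
apply/(represents_unique xv yw); rewrite -linearB; apply: (Bfil_d b).
  by have := represents_linear (-1) yu xu => /representsZ; rewrite scaleN1r addrC.
by apply/(represents_unique xu yu).
Qed.

Lemma fpage_graph_linear : linear_relation fpage_graph.
Proof.
move=> a u u' v v' [[b [x xu xv]]|[nb ->]] [[b' [y yu yw]]|[nb' ->]] //; last first.
  by right; rewrite scaler0 addr0.
left; split=> //; exists (a *: x + y); first exact: represents_linear.
by rewrite linearP; apply: represents_linear.
Qed.

Definition fpage_fun u := projT1 (cid (fpage_graph_ex u)).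
Lemma fpage_funP u : fpage_graph u (fpage_fun u).
Proof. by rewrite /fpage_fun; case: cid. Qed.
Lemma fpage_fun_linear : linear fpage_fun.
Proof.
move=> a u v; apply: fpage_graph_unique (fpage_funP _) _.
by apply: fpage_graph_linear; apply: fpage_funP.
Qed.
Definition fpage_dif : {linear fpage r p q -> fpage r p' q'} := mkLinear fpage_fun_linear.

Lemma fpage_difE x u : bidegree r p q p' q' -> represents x u -> represents (d x) (fpage_dif u).
Proof.
move=> b xu.
have [v xv] := represents_class (Bsub r p' q') (Zfil_d b (representsZ xu) : Zsub r p' q' _).
have uv : fpage_graph u v by left; split=> //; exists x.
by have /= <- := fpage_graph_unique uv (fpage_funP u).
Qed.
End PageDif.

Lemma fpage_dif_dif r p q p' q' p'' q'' (u : fpage r p q) :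
  bidegree r p q p' q' -> bidegree r p' q' p'' q'' ->
  fpage_dif r p' q' p'' q'' (fpage_dif r p q p' q' u) = 0.
Proof.
move=> b b'; have [x _ xu] := represents_ex u.
have := fpage_difE b' (fpage_difE b xu); rewrite d_d => /represents0 <-.
exact: smem0.
Qed.

(** If d_r kills the class of x, then d x is congruent to some d z modulo F^(p+r+1), with z in
    F^(p+1). Then x - z represents the same class and lies in Z_(r+1). *)
Lemma fpage_next r p q : (2 <= r)%N ->
  lmod_iso (fpage r.+1 p q) (page_homology r (fpage_dif r) p q).
Proof.
move=> r2; have Zs x : Zfil r.+1 p q x -> Zfil r p q x.
  by case=> ? ? xr; split=> //; apply: Fil_le xr; rewrite addnS.
apply: (@subquo_subquo_iso _ _ _ _ _ _ _ (fun (x : C) (u : fpage r p q) => represents x u)).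
- exact: represents_linear.
- move=> x Zx; have [u xu] := represents_class (Bsub r p q) (Zs _ Zx : Zsub r p q x).
  exists u => // p' q' b; have /represents0 <- := fpage_difE b xu.
  case: Zx => xd xp xr; case: b => -> e; exists 0.
  rewrite addnS in xr; split; rewrite ?subd0 //; exact: smem0.
- move=> u uZ; have [x [xd xp xr] xu] := represents_ex u.
  (* For r > q + 1 the differential would leave the quadrant. There d x vanishes already, its
     filtration exceeding its degree. *)
  have [rq|rq] := leqP r q.+1; last first.
    exists x => //; split=> //.
    have -> : d x = 0; last exact: smem0.
    apply: (Fil_deg (degd xd)); apply: Fil_le xr.
    by rewrite -!addnS leq_add2l.
  have b : bidegree r p q (p + r) (q.+1 - r) by split; rewrite ?subnK.
  have /represents0 := fpage_difE b xu; rewrite uZ // => [[_ /(_ erefl)]].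
  case=> z; have -> : (p + r + (q.+1 - r) = (p + q).+1)%N by rewrite -addnA subnKC // addnS.
  have -> : ((p + r).+1 - r = p.+1)%N by rewrite -addSn addnK.
  move=> [zd zp xz].
  have zr : Fil (p + r) (d z).
    rewrite -[d z](subKr (d x)); apply: smemB => //.
    exact: FilS.
  have xzr : represents (x - z) u; last first.
    exists (x - z) => //; split; first exact: smemB.
      by apply: smemB => //; apply: FilS.
    by rewrite linearB addnS.
  have Zxz : Zsub r p q (x - z).
    by split; rewrite ?linearB; apply: smemB => //; apply: FilS.
  have [v xzv] := represents_class (Bsub r p q) Zxz.
  have <- // : v = u; apply/(represents_unique xzv xu).
  rewrite addrAC subrr add0r; exists 0.
  by split; rewrite ?subd0; [exact: smem0 | exact: smem0 | apply: smemN].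
- move=> x u [xd xp xr] _ xu; split=> [[z [zd zp xz]]|].
    (* For r > p no differential arrives at (p, q): the truncated [p.+1 - r] is 0, so z is
       unrestricted on both pages. *)
    have [rp|rp] := leqP r p; last first.
      left; apply/(represents0 xu); exists z; split=> //.
      by have -> : (p.+1 - r = 0)%N by apply/eqP; rewrite subn_eq0.
    have b : bidegree r (p - r) (q + r).-1 p q.
      by split; rewrite ?subnK // prednK // addn_gt0 (leq_trans _ r2) ?orbT.
    have Zz : Zsub r (p - r) (q + r).-1 z.
      split.
      - rewrite -addnS prednK ?addn_gt0 ?(leq_trans _ r2) ?orbT //.
        by rewrite [(q + r)%N]addnC addnA subnK.
      - by rewrite subSS in zp.
      - rewrite subnK // -[d z](subKr x); apply: smemB => //.
        exact: FilS.
    have [v zv] := represents_class (Bsub r (p - r) (q + r).-1) Zz.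
    right; exists (p - r)%N, (q + r).-1, v; split=> //.
    apply/(represents_unique xu (fpage_difE b zv)).
    by exists 0; split; rewrite ?subd0 //; exact: smem0.
  case=> [/(represents0 xu) [z [zd zp xz]]|[p0 [q0 [v [b uv]]]]].
    by exists z; split=> //; apply: Fil_le zp; rewrite subSS leq_sub2r.
  have [y [yd yp yr] yv] := represents_ex v.
  rewrite uv in xu; have [_ /(_ erefl)] := represents_unique xu (fpage_difE b yv).
  case=> z [zd zp xz]; case: b => ep eq_; exists (y + z); split.
  - apply: smemD => //; have -> // : (p + q = (p0 + q0).+1)%N.
    by rewrite ep -addnA [(r + q)%N]addnC eq_ addnS.
  - rewrite subSS ep addnK; apply: smemD => //.
    by apply: Fil_le zp; rewrite ep -addSn addnK.
  - by rewrite linearD opprD addrA.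
Qed.

Definition filtered_spectral_sequence : spectral_sequence K :=
  @SpectralSequence K fpage fpage_dif
    (fun r p q p' q' p'' q'' u _ => @fpage_dif_dif r p q p' q' p'' q'' u) fpage_next.

Definition Zdeg n (x : C) : Prop := deg n.+1 x /\ d x = 0.
Lemma Zdeg0 n : Zdeg n 0.
Proof. by split; rewrite ?linear0 //; apply: smem0. Qed.
Lemma ZdegD n x y : Zdeg n x -> Zdeg n y -> Zdeg n (x + y).
Proof. by case=> ? dx [? dy]; split; rewrite ?linearD ?dx ?dy ?addr0 //; apply: smemD. Qed.
Lemma ZdegZ n a x : Zdeg n x -> Zdeg n (a *: x).
Proof. by case=> ? dx; split; rewrite ?linearZ /= ?dx ?scaler0 //; apply: smemZ. Qed.
Definition Zdsub n := Submod (@Zdeg0 n) (@ZdegD n) (@ZdegZ n).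

Definition Bdeg n (x : C) : Prop := exists2 z, deg n z & x = d z.
Lemma Bdeg0 n : Bdeg n 0.
Proof. by exists 0; rewrite ?linear0 //; apply: smem0. Qed.
Lemma BdegD n x y : Bdeg n x -> Bdeg n y -> Bdeg n (x + y).
Proof. by case=> z zd -> [w wd ->]; exists (z + w); rewrite ?linearD //; apply: smemD. Qed.
Lemma BdegZ n a x : Bdeg n x -> Bdeg n (a *: x).
Proof. by case=> z zd ->; exists (a *: z); rewrite ?linearZ //; apply: smemZ. Qed.
Definition Bdsub n := Submod (@Bdeg0 n) (@BdegD n) (@BdegZ n).

Definition fcohomology n : lmodType K := subquo (Zdsub n) (Bdsub n).

(** The filtration of H^n at p consists of the classes that contain a cocycle of F^p. *)
Lemma filtered_convergence (H : nat -> lmodType K) :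
  (forall n, lmod_iso (fcohomology n) (H n)) -> converges_to filtered_spectral_sequence H.
Proof.
move=> isoH n; have [g [f gK fK]] := lmod_iso_sym (isoH n).
pose G p h := exists2 x, Fil p x & represents x (g h).
have G0 p : G p 0.
  exists 0; first exact: smem0.
  by rewrite linear0; exists 0; rewrite !linear0.
have GD p h k : G p h -> G p k -> G p (h + k).
  case=> x xp xh [y yp yk]; exists (x + y); first exact: smemD.
  by rewrite linearD -[x]scale1r -[g h]scale1r; apply: represents_linear.
have GZ p a h : G p h -> G p (a *: h).
  case=> x xp xh; exists (a *: x); first exact: smemZ.
  rewrite linearZ_LR -[a *: x]addr0 -[a *: g h]addr0.
  by apply: represents_linear => //; exists 0; rewrite !linear0.
exists (fun p => Submod (@G0 p) (@GD p) (@GZ p)); split.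
- by move=> h; have [x _ xh] := represents_ex (g h); exists x.
- by move=> p h [x xp xh]; exists x => //; apply: FilS.
- move=> h [x xp xh]; have [xd _] := representsZ xh.
  apply: (can_inj gK); rewrite linear0; apply/(represents0 xh).
  by rewrite (Fil_deg xd xp); apply: smem0.
(* On this page r >= q + 2 turns the elements of Z_r into cocycles, and r >= p + 1 lifts the bound
   on z in B_r. *)
move=> p q pq; set r := (maxn p q.+1).+1.
have pr : (p.+1 - r = 0)%N by apply/eqP; rewrite subn_eq0 /r ltnS leq_maxl.
apply: (@subquo_subquo_iso _ _ _ _ _ _ _ (fun x h => represents x (g h))).
- by move=> a x y h k xh yk; rewrite linearP; apply: represents_linear.
- move=> x [xd xp xr]; have Zx : Zdsub n x.
    split; first by rewrite -pq.
    apply: (Fil_deg (degd xd)); apply: Fil_le xr.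
    by rewrite /r -!addnS leq_add2l ltnS leq_maxr.
  have [u xu] := represents_class (Bdsub n) Zx.
  by exists (f u); [exists x; rewrite ?fK | rewrite fK].
- move=> h [x xp xh]; exists x => //; have [xd dx] := representsZ xh.
  by split=> //; [rewrite pq | rewrite dx; apply: smem0].
- move=> x h [xd xp xr] _ xh; split=> [[z [zd zp xz]]|[y yp yh]].
    exists (x - d z) => //; rewrite pq in zd.
    have [_ dx] := representsZ xh.
    have Zxz : Zdsub n (x - d z).
      by split; [rewrite -pq; apply: smemB => //; rewrite pq; apply: degd
               | rewrite linearB dx d_d subrr].
    have [v xv] := represents_class (Bdsub n) Zxz.
    have <- // : v = g h; apply/(represents_unique xv xh).
    by exists (- z); rewrite ?linearN; [apply: smemN | rewrite addrAC subrr add0r].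
  have [_ /(_ erefl) [z zd xy]] := represents_unique xh yh.
  exists z; split; first by rewrite pq.
    by rewrite pr; apply: Fil0.
  by rewrite -xy subKr.
Qed.
End FilteredComplex.

(** * Double complexes *)

(* First quadrant double complexes with anticommuting differentials. *)
Record double_complex (K : pzRingType) := DoubleComplex {
  dob :> nat -> nat -> lmodType K;
  dh : forall p q, {linear dob p q -> dob p.+1 q};
  dv : forall p q, {linear dob p q -> dob p q.+1};
  dh_dh : forall p q x, dh p.+1 q (dh p q x) = 0;
  dv_dv : forall p q x, dv p q.+1 (dv p q x) = 0;
  dh_dv : forall p q x, dh p q.+1 (dv p q x) + dv p.+1 q (dh p q x) = 0 }.

(* All families (x_{p,q}), of any degree; the total complex in degree n consists
   of those supported on p + q = n. *)
Definition tot (K : pzRingType) (D : double_complex K) : Type := forall p q, D p q.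

Section Total.
Variables (K : pzRingType) (D : double_complex K).
Local Notation C := (tot D).
HB.instance Definition _ := gen_eqMixin C.
HB.instance Definition _ := gen_choiceMixin C.

Lemma tot_ext (x y : C) : (forall p q, x p q = y p q) -> x = y.
Proof.
move=> xy; apply: functional_extensionality_dep => p.
exact: functional_extensionality_dep.
Qed.

Definition tadd (x y : C) : C := fun p q => x p q + y p q.
Definition topp (x : C) : C := fun p q => - x p q.
Definition tscale (a : K) (x : C) : C := fun p q => a *: x p q.
Lemma taddA : associative tadd. Proof. by move=> x y z; apply: tot_ext => p q; apply: addrA. Qed.
Lemma taddC : commutative tadd. Proof. by move=> x y; apply: tot_ext => p q; apply: addrC. Qed.
Lemma tadd0 : left_id ((fun p q => 0) : C) tadd.
Proof. by move=> x; apply: tot_ext => p q; apply: add0r. Qed.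
Lemma taddN : left_inverse ((fun p q => 0) : C) topp tadd.
Proof. by move=> x; apply: tot_ext => p q; apply: addNr. Qed.
HB.instance Definition _ := GRing.isZmodule.Build C taddA taddC tadd0 taddN.
Lemma tscaleA a b x : tscale a (tscale b x) = tscale (a * b) x.
Proof. by apply: tot_ext => p q; apply: scalerA. Qed.
Lemma tscale1 : left_id 1 tscale.
Proof. by move=> x; apply: tot_ext => p q; apply: scale1r. Qed.
Lemma tscaleDr : right_distributive tscale +%R.
Proof. by move=> a x y; apply: tot_ext => p q; apply: scalerDr. Qed.
Lemma tscaleDl x : {morph tscale^~ x : a b / a + b}.
Proof. by move=> a b; apply: tot_ext => p q; apply: scalerDl. Qed.
HB.instance Definition _ := GRing.Zmodule_isLmodule.Build K C tscaleA tscale1 tscaleDr tscaleDl.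

Lemma totD (x y : C) p q : (x + y) p q = x p q + y p q. Proof. by []. Qed.
Lemma totB (x y : C) p q : (x - y) p q = x p q - y p q. Proof. by []. Qed.
Lemma totZ a (x : C) p q : (a *: x) p q = a *: x p q. Proof. by []. Qed.
Lemma tot0 p q : (0 : C) p q = 0. Proof. by []. Qed.

Definition hpart (x : C) p q : D p q :=
  if p is p'.+1 return D p q then dh D p' q (x p' q) else 0.
Definition vpart (x : C) p q : D p q :=
  if q is q'.+1 return D p q then dv D p q' (x p q') else 0.
Definition tdif_fun (x : C) : C := fun p q => hpart x p q + vpart x p q.

Lemma tdif_linear : linear tdif_fun.
Proof.
move=> a x y; apply: tot_ext => p q; rewrite totD totZ /tdif_fun.
rewrite scalerDr addrACA; congr (_ + _).
  by case: p => [|p] /=; rewrite ?scaler0 ?addr0 // linearP.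
by case: q => [|q] /=; rewrite ?scaler0 ?addr0 // linearP.
Qed.
Definition tdif : {linear C -> C} := mkLinear tdif_linear.

Lemma tdifE x p q : tdif x p q = hpart x p q + vpart x p q. Proof. by []. Qed.
Lemma tdif0 : tdif 0 = 0. Proof. exact: linear0. Qed.
Lemma tdifD x y : tdif (x + y) = tdif x + tdif y. Proof. exact: linearD. Qed.
Lemma tdifB x y : tdif (x - y) = tdif x - tdif y. Proof. exact: linearB. Qed.
Lemma tdifP a x y : tdif (a *: x + y) = a *: tdif x + tdif y. Proof. exact: linearP. Qed.

Lemma tdif_dif x : tdif (tdif x) = 0.
Proof.
apply: tot_ext => p q; rewrite tdifE /hpart /vpart tot0.
case: p q => [|p] [|q]; rewrite ?addr0 ?add0r // !tdifE.
- by case: q => [|q] /=; rewrite !add0r ?linear0 // dv_dv.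
- by case: p => [|p] /=; rewrite !addr0 ?linear0 // dh_dh.
rewrite !linearD.
have -> : dh D p q.+1 (hpart x p q.+1) = 0 by case: p => [|p] /=; rewrite ?linear0 // dh_dh.
have -> : dv D p.+1 q (vpart x p.+1 q) = 0 by case: q => [|q] /=; rewrite ?linear0 // dv_dv.
by rewrite add0r addr0 /= dh_dv.
Qed.

Definition tdegP n (x : C) : Prop := forall p q, ((p + q).+1 != n)%N -> x p q = 0.
Lemma tdegP0 n : tdegP n 0. Proof. by []. Qed.
Lemma tdegPD n x y : tdegP n x -> tdegP n y -> tdegP n (x + y).
Proof. by move=> xn yn p q e; rewrite totD xn ?yn ?addr0. Qed.
Lemma tdegPZ n a x : tdegP n x -> tdegP n (a *: x).
Proof. by move=> xn p q e; rewrite totZ xn ?scaler0. Qed.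
Definition tdeg n : submod C := Submod (@tdegP0 n) (@tdegPD n) (@tdegPZ n).

Definition tfilP k (x : C) : Prop := forall p q, (p < k)%N -> x p q = 0.
Lemma tfilP0 n : tfilP n 0. Proof. by []. Qed.
Lemma tfilPD n x y : tfilP n x -> tfilP n y -> tfilP n (x + y).
Proof. by move=> xn yn p q e; rewrite totD xn ?yn ?addr0. Qed.
Lemma tfilPZ n a x : tfilP n x -> tfilP n (a *: x).
Proof. by move=> xn p q e; rewrite totZ xn ?scaler0. Qed.
Definition tfil n : submod C := Submod (@tfilP0 n) (@tfilPD n) (@tfilPZ n).

Lemma tdeg_dif n x : tdeg n x -> tdeg n.+1 (tdif x).
Proof.
move=> xn p q e; rewrite tdifE.
have -> : hpart x p q = 0 by case: p e => [|p] e //=; rewrite xn ?linear0.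
by case: q e => [|q] e /=; rewrite ?addr0 // xn ?linear0 ?addr0 // -addnS.
Qed.

Lemma tdeg_zero x : tdeg 0 x -> x = 0.
Proof. by move=> x0; apply: tot_ext => p q; apply: x0. Qed.

Lemma tfil_zero x : tfil 0 x. Proof. by []. Qed.
Lemma tfilS p x : tfil p.+1 x -> tfil p x.
Proof. by move=> xp p' q' l; apply/xp/leqW. Qed.
Lemma tfil_deg n x : tdeg n x -> tfil n x -> x = 0.
Proof.
move=> xd xf; apply: tot_ext => p q; have [e|] := eqVneq (p + q).+1 n; last exact: xd.
by apply: xf; rewrite -e ltnS leq_addr.
Qed.

Definition total_spectral_sequence : spectral_sequence K :=
  filtered_spectral_sequence tdif_dif tdeg_dif tfil_zero tfilS tfil_deg.

Definition total_cohomology n : lmodType K := fcohomology tdif tdeg n.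

Definition single p q (y : D p q) : C :=
  dfwith ((fun p q => 0) : forall p q, D p q) (dfwith ((fun q => 0) : forall q, D p q) y).

Lemma single_in p q (y : D p q) : single y p q = y.
Proof. by rewrite /single !dfwith_in. Qed.
Lemma single_out p q (y : D p q) p' q' : (p', q') != (p, q) -> single y p' q' = 0.
Proof.
rewrite /single xpair_eqE negb_and; have [->|pp _] := eqVneq p' p; last by rewrite dfwith_out // eq_sym.
by rewrite dfwith_in /= => qq; rewrite dfwith_out // eq_sym.
Qed.

Lemma tdif_single p q (y : D p q) : tdif (single y) = single (dh D p q y) + single (dv D p q y).
Proof.
apply: tot_ext => p' q'; rewrite tdifE totD; congr (_ + _).
  case: p' => [|p'] /=; first by rewrite single_out.
  have [e|ne] := eqVneq (p', q') (p, q); first by case: e => -> ->; rewrite !single_in.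
  by rewrite !single_out ?linear0 //; apply: contra ne => /eqP[-> ->].
case: q' => [|q'] /=; first by rewrite single_out // xpair_eqE andbF.
have [e|ne] := eqVneq (p', q') (p, q); first by case: e => -> ->; rewrite !single_in.
by rewrite !single_out ?linear0 //; apply: contra ne => /eqP[-> ->].
Qed.

Lemma tdeg_single p q (y : D p q) : tdeg (p + q).+1 (single y).
Proof. by move=> p' q' e; apply: single_out; apply: contra e => /eqP[-> ->]. Qed.

Lemma single_ext n p q (x : C) : tdeg n x -> n = (p + q).+1%N ->
  (forall p' q', p' != p -> x p' q' = 0) -> x = single (x p q).
Proof.
move=> xn en xp; apply: tot_ext => p' q'; have [e|ne] := eqVneq (p', q') (p, q).
  by case: e => -> ->; rewrite single_in.
rewrite single_out //; have [e|/xp //] := eqVneq p' p.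
apply: xn; rewrite en eqSS e eqn_add2l; apply: contra ne => /eqP ->.
by rewrite e.
Qed.

Lemma single0 p q : single (0 : D p q) = 0.
Proof. by rewrite -(@single_ext (p + q).+1 p q 0). Qed.

Section ExactRows.
Hypothesis row_exact : forall p q (y : D p.+1 q), dh D p.+1 q y = 0 -> exists z, y = dh D p q z.

(* Kills the components of x one at a time, from the largest p downwards. *)
Lemma column_reduction_aux k m x : tdeg m.+1 x ->
  (forall p q, tdif x p.+1 q = 0) -> (forall p q, (k < p)%N -> x p q = 0) ->
  exists2 z, tdeg m z & forall p q, (x - tdif z) p.+1 q = 0.
Proof.
elim: k x => [|k IH] x xm dx xk.
  by exists 0; [apply: tdegP0|move=> p q; rewrite tdif0 subr0 xk].
have [km|km] := ltnP m k.+1.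
  apply: IH => // p q kp; apply: xm; rewrite eqSS gtn_eqF //.
  exact: leq_trans km (leq_trans kp (leq_addr _ _)).
(* As x vanishes beyond column k + 1, the entry of [tdif x] at (k + 2, m - k - 1) is [dh] of this
   component. *)
have [z0 z0E] : exists z, x k.+1 (m - k.+1)%N = dh D k (m - k.+1)%N z.
  apply: row_exact; have := dx k.+1 (m - k.+1)%N; rewrite tdifE /=.
  suff -> : vpart x k.+2 (m - k.+1) = 0 by rewrite addr0.
  by case: (m - k.+1)%N => //= q; rewrite xk ?linear0.
have zm : tdeg m (single z0) by rewrite -[m in tdeg m](subnKC km) addSn; apply: tdeg_single.
have [|||w wm wE] := IH (x - tdif (single z0)).
- by apply: smemB => //; apply: tdeg_dif.
- by move=> p q; rewrite tdifB tdif_dif subr0.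
- move=> p q kp; rewrite totB tdif_single totD (single_out (dv D _ _ z0)) ?addr0; last first.
    by rewrite xpair_eqE gtn_eqF.
  have [e|ne] := eqVneq (p, q) (k.+1, (m - k.+1)%N).
    by case: e => -> ->; rewrite single_in z0E subrr.
  rewrite single_out // subr0; have [e|pk] := eqVneq p k.+1; last first.
    by apply: xk; rewrite ltn_neqAle eq_sym pk.
  apply: xm; rewrite eqSS e; apply: contra ne => /eqP <-.
  by rewrite e addKn.
exists (single z0 + w); first exact: smemD.
by move=> p q; rewrite tdifD opprD addrA wE.
Qed.

(** Only the part of [tdif x] off column 0 has to vanish. In [total_column] this serves for [w - z],
    whose differential lies in column 0 but may be nonzero. *)
Lemma column_reduction m x : tdeg m.+1 x -> (forall p q, tdif x p.+1 q = 0) ->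
  exists2 z, tdeg m z & forall p q, (x - tdif z) p.+1 q = 0.
Proof.
move=> xm dx; apply: (@column_reduction_aux m) => // p q mp.
by apply: xm; rewrite eqSS gtn_eqF // (leq_trans mp) // leq_addr.
Qed.

Variables (A : cocomplex K) (j : forall n, {linear A n -> D 0%N n}).
Hypothesis j_inj : forall n, injective (@j n).
Hypothesis j_ker : forall n y, dh D 0 n y = 0 <-> exists a, y = j n a.
Hypothesis j_dif : forall n a, dv D 0 n (j n a) = j n.+1 (dif A n a).

Lemma column_kernel x m : (forall p q, x p.+1 q = 0) -> (forall p q, tdif x p.+1 q = 0) ->
  exists a, x 0%N m = j m a.
Proof.
move=> x0 dx; apply/j_ker; have := dx 0%N m; rewrite tdifE /=.
suff -> : vpart x 1 m = 0 by rewrite addr0.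
by case: m => //= m; rewrite x0 linear0.
Qed.

(** Through [j], the complex [A] is the kernel of [dh] in column 0. The relation pairs x with a when
    x is homologous to an element of column 0 with entry j a. *)
Theorem total_column n : lmod_iso (total_cohomology n) (cohomology A n).
Proof.
have j0 m a : j m a = 0 -> a = 0 by rewrite -[RHS](linear0 (j m)) => /j_inj.
apply: (@subquo_subquo_iso _ _ _ _ _ _ _ (fun x a => exists z,
  [/\ tdeg n z, forall p q, (x - tdif z) p.+1 q = 0 & (x - tdif z) 0%N n = j n a])).
- move=> k x y a b [z [zn xz xa]] [w [wn yw yb]]; exists (k *: z + w).
  have E : k *: x + y - tdif (k *: z + w) = k *: (x - tdif z) + (y - tdif w).
    by rewrite tdifP opprD scalerBr addrACA.
  split; first by apply: smemD => //; apply: smemZ.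
    by move=> p q; rewrite E totD totZ xz yw scaler0 addr0.
  by rewrite E totD totZ xa yb -linearP.
- move=> x [xn dx]; have [|z zn xz] := column_reduction xn; first by rewrite dx.
  have dxz : tdif (x - tdif z) = 0 by rewrite tdifB dx tdif_dif subr0.
  have [|a xa] := column_kernel n xz; first by rewrite dxz.
  exists a; last by exists z.
  apply: j0; rewrite -j_dif -xa; have := congr1 (fun x : C => x 0%N n.+1) dxz.
  by rewrite tdifE /= add0r.
- move=> a da; have dja : dh D 0 n (j n a) = 0 by apply/j_ker; exists a.
  have ds : tdif (single (j n a)) = 0.
    by rewrite tdif_single dja j_dif da linear0 !single0 addr0.
  exists (single (j n a)); first by split=> //; apply: (tdeg_single (j n a)).
  exists 0; rewrite tdif0 subr0; split=> [//|p q|]; last by rewrite single_in.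
  by rewrite single_out.
- move=> x a [xn dx] _ [z [zn xz xa]]; split.
    case=> w wn xw; case: n a wn zn xn xa => [|n] a wn zn xn xa.
      move: xa; rewrite xw (tdeg_zero wn) (tdeg_zero zn) tdif0 subr0.
      by move/esym/j0 => a0; rewrite a0; apply: smem0.
    have yE : x - tdif z = tdif (w - z) by rewrite xw tdifB.
    have [||u un uE] := @column_reduction n (w - z); first exact: smemB.
      by move=> p q; rewrite -yE.
    have [|b bE] := column_kernel n uE.
      by move=> p q; rewrite tdifB tdif_dif subr0 -yE.
    exists b; apply: (@j_inj n.+1); rewrite -xa yE -j_dif -bE.
    rewrite -[tdif (w - z)]subr0 -(tdif_dif u) -tdifB.
    by rewrite tdifE /= add0r.
  case: n a zn xn xa => [|n] a zn xn xa.
    move=> /= a0; exists 0; first exact: tdegP0.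
    rewrite tdif0; move: xa; rewrite (tdeg_zero zn) tdif0 subr0 => x0.
    rewrite (@single_ext 1 0 0 x) //; last first.
      by case=> // p q _; have := xz p q; rewrite (tdeg_zero zn) tdif0 subr0.
    rewrite x0 a0 linear0.
    exact: single0.
  case=> b ab; exists (z + single (j n b)).
    by apply: smemD => //; apply: (tdeg_single (j n b)).
  rewrite tdifD; apply/eqP; rewrite addrC -subr_eq; apply/eqP.
  rewrite (@single_ext n.+2 0 n.+1 (x - tdif z)) //; first last.
  - by case=> // p q _; apply: xz.
  - by apply: smemB => //; apply: tdeg_dif.
  rewrite tdif_single; have -> : dh D 0 n (j n b) = 0 by apply/j_ker; exists b.
  by rewrite j_dif -ab xa single0 add0r.
Qed.
End ExactRows.
End Total.

Section Transpose.
Variables (K : pzRingType) (D : double_complex K).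

Lemma dv_dh p q (x : D q p) : dv D q.+1 p (dh D q p x) + dh D q p.+1 (dv D q p x) = 0.
Proof. by rewrite addrC dh_dv. Qed.

Definition transpose : double_complex K :=
  @DoubleComplex K (fun p q => D q p) (fun p q => dv D q p) (fun p q => dh D q p)
    (fun p q => @dv_dv _ D q p) (fun p q => @dh_dh _ D q p) dv_dh.

Definition tswap (x : tot D) : tot transpose := fun p q => x q p.
Definition tswap' (x : tot transpose) : tot D := fun p q => x q p.

Lemma tdif_swap x : tdif transpose (tswap x) = tswap (tdif D x).
Proof.
apply: tot_ext => p q; rewrite tdifE [RHS](tdifE x q p) [RHS]addrC.
by congr (_ + _); case: p => [|p]; case: q.
Qed.

(** Exchanging the indices lets [total_column] be applied in the other direction as well. *)
Lemma total_transpose n : lmod_iso (total_cohomology D n) (total_cohomology transpose n).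
Proof.
have sd m x : tdeg D m x -> tdeg transpose m (tswap x).
  by move=> xm p q; rewrite addnC => /xm.
have sd' m x : tdeg transpose m x -> tdeg D m (tswap' x).
  by move=> xm p q; rewrite addnC => /xm.
have d0 x : tdif transpose (tswap x) = 0 -> tdif D x = 0.
  rewrite tdif_swap => dx; apply: tot_ext => p q.
  exact: (congr1 (fun x : tot transpose => x q p) dx).
apply: (@subquo_subquo_iso _ _ _ _ _ _ _ (fun x y => y = tswap x)).
- by move=> a x y _ _ -> ->.
- by move=> x [xn dx]; exists (tswap x) => //; split; [apply: sd | rewrite tdif_swap dx].
- by move=> y [yn dy]; exists (tswap' y) => //; split; [apply: sd' | apply: d0].
- move=> x _ [xn dx] _ ->; split=> [[z zn ->]|[z zn xz]].
    by exists (tswap z); [apply: sd | rewrite tdif_swap].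
  exists (tswap' z); first exact: sd'.
  have e : tswap x = tswap (tdif D (tswap' z)) by rewrite -tdif_swap.
  by apply: tot_ext => p q; apply: (congr1 (fun x : tot transpose => x q p) e).
Qed.
End Transpose.

(** * The second page of the total complex *)

Section SecondPage.
Variables (K : pzRingType) (D : double_complex K).
Local Notation C := (tot D).

Lemma hpart0 (x : C) (p q : nat) : (forall p', p = p'.+1 -> x p' q = 0) -> hpart x p q = 0.
Proof. by case: p => //= p -> //; rewrite linear0. Qed.
Lemma vpart0 (x : C) (p q : nat) : (forall q', q = q'.+1 -> x p q' = 0) -> vpart x p q = 0.
Proof. by case: q => //= q -> //; rewrite linear0. Qed.
Lemma vpartN (x : C) (p q : nat) : vpart (- x) p q = - vpart x p q.
Proof. by case: q => [|q] /=; rewrite ?oppr0 // linearN. Qed.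

(* the component of x at (p, q - 1) *)
Definition below (p q : nat) (x : C) : C :=
  fun p' q' => if (p' == p) && (q'.+1 == q) then x p' q' else 0.

Lemma below_deg (p q : nat) x : tdeg D (p + q)%N (below p q x).
Proof.
move=> p' q' e; rewrite /below; case: ifP => // /andP[/eqP pe /eqP qe].
by rewrite pe -qe addnS eqxx in e.
Qed.
Lemma below_fil p q x : tfil D p (below p q x).
Proof. by move=> p' q' l; rewrite /below ltn_eqF. Qed.
Lemma below_dif p q x : tdif D (below p q x) p q = vpart x p q.
Proof.
rewrite tdifE hpart0 ?add0r => [|p' ->]; last by rewrite /below ltn_eqF.
by case: q => [//|q]; rewrite /= /below !eqxx.
Qed.
Lemma below_dif0 p q x p' q' : (p' <= p)%N -> (p', q') != (p, q) ->
  tdif D (below p q x) p' q' = 0.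
Proof.
move=> l ne; rewrite tdifE hpart0 ?add0r => [|p'' e]; last by rewrite /below ltn_eqF // -e.
apply: vpart0 => q'' e; rewrite /below; case: ifP => // /andP[/eqP pe /eqP qe].
by rewrite pe e qe eqxx in ne.
Qed.

Variables (q : nat) (W : cocomplex K) (Y : nat -> lmodType K).
Variables (i : forall p, {linear Y p -> D p q}) (c : forall p, {linear Y p -> W p}).
Variable (e : forall p, Y p -> Y p.+1).
Hypothesis iP : forall p y, dv D p q y = 0 <-> exists z, y = i p z.
Hypothesis c_surj : forall p w, exists z, w = c p z.
Hypothesis cP : forall p z, c p z = 0 <-> exists x : C, i p z = vpart x p q.
Hypothesis ie : forall p z, i p.+1 (e z) = dh D p q (i p z).
Hypothesis ce : forall p z, c p.+1 (e z) = dif W p (c p z).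

(** Here [Y p] stands for the vertical cocycles at (p, q), [W p] for the vertical cohomology and [e]
    for the horizontal differential on cocycles. They are kept abstract so that an exact functor
    applied to cocycles and cohomology can take their place. A class of the second page is read off
    from its component at (p, q). *)
Theorem second_page p : lmod_iso (page (total_spectral_sequence D) 2 p q) (cohomology W p).
Proof.
apply: (@subquo_subquo_iso _ _ _ _ _ _ _ (fun (x : C) w => exists2 y, i p y = x p q & w = c p y)).
- move=> a x x' w w' [y yx ->] [y' yx' ->]; exists (a *: y + y'); rewrite linearP //.
  by rewrite yx yx'.
- move=> x [xd xp xr].
  have [y yE] : exists y, x p q = i p y.
    apply/iP; have := xr p q.+1; rewrite addn2 ltnS leqnSn => /(_ isT); rewrite tdifE.
    rewrite hpart0 ?add0r // => p' pe.
    by apply: xp; rewrite pe.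
  exists (c p y); last by exists y.
  rewrite /= -ce; apply/cP; exists (- x).
  have := xr p.+1 q; rewrite addn2 ltnSn => /(_ isT); rewrite tdifE /= vpartN ie yE.
  by move/eqP; rewrite addr_eq0 => /eqP.
- move=> w dw; have [y yw] := c_surj w.
  have /cP [x' xE] : c p.+1 (e y) = 0 by rewrite ce -yw.
  (* The correction at (p + 1, q - 1) has a vertical image that cancels [dh] of the leading entry,
     which pushes the differential into F^(p+2). *)
  exists (single (i p y) - below p.+1 q x'); last first.
    exists y => //; rewrite totB single_in.
    by rewrite (below_fil (p := p.+1)) // subr0.
  have dy : dv D p q (i p y) = 0 by apply/iP; exists y.
  split.
  - by apply: smemB; [apply: tdeg_single | rewrite -addSn; apply: below_deg].
  - apply: smemB => [p' q' l|]; last exact/tfilS/below_fil.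
    by rewrite single_out // xpair_eqE ltn_eqF.
  move=> p' q'; rewrite addn2 ltnS => l; rewrite tdifB tdif_single totB totD dy single0 addr0 -ie.
  have [[-> ->]|ne] := eqVneq (p', q') (p.+1, q).
    by rewrite single_in below_dif xE subrr.
  by rewrite single_out // below_dif0 // subrr.
move=> x w [xd xp xr] dw [y yx yw]; split.
  case=> z [zd zp xz].
  have xpq : x p q = hpart z p q + vpart z p q.
    by apply/eqP; rewrite -subr_eq0 -tdifE -totB xz.
  case: p xp xd xr {dw} w y yx yw zd zp xz xpq => [|p] xp xd xr w y yx yw zd zp xz xpq.
    rewrite yw /=; apply/cP; exists z.
    by rewrite yx xpq /= add0r.
  have [y' zE] : exists y', z p q = i p y'.
    apply/iP; have := xz p q.+1; rewrite leqW // totB tdifE xp // sub0r => /(_ isT)/eqP.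
    rewrite oppr_eq0 hpart0 ?add0r => [/eqP //|p' pe].
    by apply: zp; rewrite subSS subn1 pe.
  exists (c p y'); rewrite /= -ce yw; apply/eqP; rewrite -subr_eq0 -linearB; apply/eqP/cP.
  by exists z; rewrite linearB yx ie xpq /= zE addrC addKr.
move=> wB.
case: p xp xd xr {dw} w y yx yw wB => [|p] xp xd xr w y yx yw wB.
  have /cP [x' x'E] : c 0 y = 0 by rewrite -yw.
  exists (below 0 q x'); split=> [||p' q' p0]; [exact: below_deg|by []|].
  case: p' p0 => // _; rewrite totB; have [->|ne] := eqVneq q' q.
    by rewrite below_dif -x'E yx subrr.
  by rewrite xd ?eqSS // below_dif0 ?subr0 // xpair_eqE.
case: wB => w' w'E; have [y' y'E] := c_surj w'.
have /cP [x' x'E] : c p.+1 (y - e y') = 0 by rewrite linearB -yw ce -y'E w'E subrr.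
have dy' : dv D p q (i p y') = 0 by apply/iP; exists y'.
(* Since w is the coboundary of w', the horizontal image of i y' gives x at (p + 1, q) up to a
   vertical coboundary, and the second summand supplies the latter. *)
exists (single (i p y') + below p.+1 q x'); split.
- by apply: smemD; [apply: tdeg_single | apply: below_deg].
- rewrite subSS subn1; apply: smemD => p' q' l; last by apply: below_fil; apply: leqW.
  by rewrite single_out // xpair_eqE ltn_eqF.
move=> p' q' l; rewrite tdifD tdif_single totB !totD dy' single0 addr0 -ie.
have [[-> ->]|ne] := eqVneq (p', q') (p.+1, q).
  by rewrite single_in below_dif -x'E linearB yx [i _ _ + _]addrC subrK subrr.
rewrite single_out // below_dif0 // addr0 subr0.
have [pe|pe] := eqVneq p' p.+1; last by apply: xp; rewrite ltn_neqAle pe.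
apply: xd; rewrite eqSS pe eqn_add2l; apply: contra ne => /eqP ->.
by rewrite pe.
Qed.
End SecondPage.

(** * Exact functors *)

Definition exact_at (R : pzRingType) (U V W : lmodType R) (f : {linear U -> V}) (g : {linear V -> W}) :=
  forall y, g y = 0 <-> exists x, y = f x.

Definition surjective (U V : Type) (f : U -> V) := forall y, exists x, y = f x.

Section ExactFunctors.
Variables (R R' : pzRingType).

Definition preserves_exact (T : modfunctor R R') := forall (U V W : lmodType R)
  (f : {linear U -> V}) (g : {linear V -> W}), exact_at f g -> exact_at (fmap T f) (fmap T g).

Definition preserves_ses (T : modfunctor R R') := forall (U V W : lmodType R)
  (f : {linear U -> V}) (g : {linear V -> W}), injective f -> surjective g -> exact_at f g ->
  [/\ injective (fmap T f), surjective (fmap T g) & exact_at (fmap T f) (fmap T g)].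

Lemma linear_inj (U V : lmodType R) (f : {linear U -> V}) :
  (forall x, f x = 0 -> x = 0) -> injective f.
Proof.
move=> f0 x y /eqP; rewrite -subr_eq0 -linearB => /eqP/f0/eqP.
by rewrite subr_eq0 => /eqP.
Qed.

Section Corestriction.
Variables (U V : lmodType R) (P : submod V) (f : {linear U -> V}).
Hypothesis fP : forall x, P (f x).
Lemma corestr_linear : linear (fun x => mksub (fP x)).
Proof. by move=> a x y; apply: incl_inj; rewrite [RHS]linearP !inclK; apply: linearP. Qed.
Definition corestr : {linear U -> subm P} := mkLinear corestr_linear.
Lemma corestrK x : incl (corestr x) = f x. Proof. exact: inclK. Qed.
End Corestriction.

Definition inclusion (V : lmodType R) (P : submod V) : {linear subm P -> V} := @incl R V P.
Definition projection (V : lmodType R) (P : submod V) : {linear V -> quo P} := proj P.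

Lemma kerm_exact (U V : lmodType R) (f : {linear U -> V}) : exact_at (inclusion (kerm f)) f.
Proof.
move=> y; split=> [fy|[x ->]]; last exact: (inclP x).
by exists (mksub (fy : kerm f y)); rewrite /= inclK.
Qed.

Section Preserves.
Variable T : modfunctor R R'.
Hypothesis Tses : preserves_ses T.

Lemma ses_inj (U V : lmodType R) (f : {linear U -> V}) : injective f -> injective (fmap T f).
Proof.
move=> fI; have fe : exact_at f (projection (imm f)).
  by move=> y; rewrite proj_eq0.
by have [] := Tses fI (@proj_surj _ _ _) fe.
Qed.

Lemma ses_surj (U V : lmodType R) (f : {linear U -> V}) : surjective f -> surjective (fmap T f).
Proof.
by move=> fs; have [] := Tses (@incl_inj _ _ (kerm f)) fs (kerm_exact f).
Qed.

(** Both maps factor through their images, which reduces the claim to the short exact sequence 0 ->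
    im f -> V -> im g -> 0. *)
Lemma ses_exact : preserves_exact T.
Proof.
move=> U V W f g fg.
pose f' := corestr (fun x => ex_intro _ x erefl : imm f (f x)).
pose g' := corestr (fun x => ex_intro _ x erefl : imm g (g x)).
have fE : f = inclusion _ \o f' by apply: lin_eq => x; rewrite /= inclK.
have gE : g = inclusion _ \o g' by apply: lin_eq => x; rewrite /= inclK.
have TfE x : fmap T f x = fmap T (inclusion (imm f)) (fmap T f' x).
  by rewrite -fmap_comp; congr (fmap T _ x).
have TgE x : fmap T g x = fmap T (inclusion (imm g)) (fmap T g' x).
  by rewrite -fmap_comp; congr (fmap T _ x).
have f's : surjective f'.
  move=> y; have [x yx] := inclP y; exists x; apply: incl_inj.
  by rewrite yx corestrK.
have g's : surjective g'.
  move=> y; have [x yx] := inclP y; exists x; apply: incl_inj.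
  by rewrite yx corestrK.
have e : exact_at (inclusion (imm f)) g'.
  move=> y; have -> : (g' y = 0) <-> g y = 0.
    split=> [e|e]; last by apply: incl_inj; rewrite corestrK e [RHS](linear0 (inclusion _)).
    by rewrite -[g y](corestrK (fun x => ex_intro _ x erefl : imm g (g x))) -/g' e
      (linear0 (inclusion _)).
  rewrite fg; split=> [[x ->]|[x ->]]; last exact: (inclP x).
  by exists (f' x); rewrite /= inclK.
have [fI _ Te] := Tses (@incl_inj _ _ _) g's e.
move=> y; rewrite TgE; split=> [|[x ->]].
  rewrite -[X in _ = X](linear0 (fmap T (inclusion (imm g)))) => /(ses_inj (@incl_inj _ _ _)).
  move=> /Te [z ->]; have [x ->] := ses_surj f's z; exists x.
  by rewrite TfE.
have -> : fmap T g' (fmap T f x) = 0; last exact: linear0.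
by apply/Te; exists (fmap T f' x); rewrite TfE.
Qed.
End Preserves.
End ExactFunctors.

Section ComposeFunctors.
Variables (R R' R'' : pzRingType) (T' : modfunctor R' R'') (T : modfunctor R R').
Definition comp_functor : modfunctor R R''.
Proof.
refine (@ModFunctor R R'' (fun M => T' (T M)) (fun M N f => fmap T' (fmap T f)) _ _ _).
- move=> M x; rewrite -[RHS](fmap_id (m := T')); congr (fmap T' _ x).
  by apply: lin_eq => y; rewrite fmap_id.
- move=> M N P g f x; rewrite -(fmap_comp (m := T')); congr (fmap T' _ x).
  by apply: lin_eq => y; rewrite /= fmap_comp.
- move=> M N f g x; rewrite -(fmap_add (m := T')); congr (fmap T' _ x).
  by apply: lin_eq => y; rewrite /= fmap_add.
Defined.
Lemma comp_preserves_ses : preserves_ses T' -> preserves_ses T -> preserves_ses comp_functor.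
Proof.
by move=> sT' sT U V W f g fI gs fg; have [fI' gs' fg'] := sT _ _ _ _ _ fI gs fg; apply: sT'.
Qed.
End ComposeFunctors.

Section CoinducedFunctor.
Variables (K : fieldType) (R : ualgType K).

Definition coind_sub (V : lmodType K) : submod (R -> V : lmodType K) :=
  Submod (@coindP0 K R V) (@coindPD K R V) (@coindPZ K R V).

Section KMap.
Variables (M N : lmodType R) (f : {linear M -> N}).
Lemma kmap_linear : linear (f : kmod M -> kmod N).
Proof. by move=> a x y; rewrite !kmodZ; apply: linearP. Qed.
Definition kmap : {linear kmod M -> kmod N} := mkLinear kmap_linear.
End KMap.

Section CoindMap.
Variables (V W : lmodType K) (f : {linear V -> W}).
Lemma coind_mapP (h : coind R V) : @coindP K R W (fun x => f (cfun h x)).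
Proof. by split=> [x y|k x]; rewrite ?cfunD ?linearD ?cfunZ ?linearZ. Qed.
Definition coind_fun (h : coind R V) : coind R W :=
  mksub (coind_mapP h : coind_sub W _).
Lemma coind_funE h x : cfun (coind_fun h) x = f (cfun h x).
Proof. by rewrite /cfun inclK. Qed.
Lemma coind_fun_linear : linear coind_fun.
Proof.
move=> a g h; apply: coind_eq => x.
by rewrite coind_funE !cfun_add !cfun_scale !coind_funE linearD.
Qed.
Definition coind_map : {linear coind R V -> coind R W} := mkLinear coind_fun_linear.
Lemma coind_mapE h x : cfun (coind_map h) x = f (cfun h x).
Proof. exact: coind_funE. Qed.
End CoindMap.

Lemma coind_mapK (V W : lmodType K) (f : {linear V -> W}) (g : {linear W -> V}) :
  cancel f g -> cancel (coind_map f) (coind_map g).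
Proof. by move=> fK h; apply: coind_eq => x; rewrite !coind_mapE fK. Qed.

(** For a K-linear retraction r onto the kernel of g, the vector v - r v depends on g v only. *)
Lemma surjective_section (V W : lmodType K) (g : {linear V -> W}) :
  surjective g -> exists s : {linear W -> V}, cancel s g.
Proof.
move=> gs; pose Q := kerm g.
have [r rP] := @extend_linear _ _ _ _ (inclusion Q) idfun (@incl_inj _ _ Q).
pose s w := let v := projT1 (cid (gs w)) in v - incl (r v).
have sE v : s (g v) = v - incl (r v).
  rewrite /s; case: cid => v' /= e.
  have k : Q (v' - v) by rewrite /= linearB -e subrr.
  have := congr1 (inclusion Q) (rP (mksub k)); rewrite /= !inclK linearB.
  rewrite [LHS](linearB (inclusion Q)) /= => /eqP; rewrite subr_eq => /eqP ->.
  by rewrite opprD opprB addrA [v' + _]addrC subrK.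
have sL : linear s.
  move=> a x y; have [[u ->] [v ->]] := (gs x, gs y).
  by rewrite -linearP !sE (linearP r) [incl (_ *: _ + _)](linearP (inclusion Q)) /=
    scalerBr opprD addrACA.
exists (mkLinear sL) => w; have [v ->] := gs w.
rewrite /= sE linearB; have -> : g (incl (r v)) = 0 by apply: (inclP (r v)).
by rewrite subr0.
Qed.

Definition coind_functor : modfunctor R R.
Proof.
refine (@ModFunctor R R (fun M => coind R (kmod M)) (fun M N f => coind_map (kmap f)) _ _ _).
- by move=> M h; apply: coind_eq => x; rewrite coind_mapE.
- by move=> M N P g f h; apply: coind_eq => x; rewrite !coind_mapE.
- by move=> M N f g h; apply: coind_eq => x; rewrite cfun_add !coind_mapE.
Defined.

Lemma coind_lift (U V W : lmodType R) (f : {linear U -> V}) (g : {linear V -> W})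
    (h : coind R (kmod V)) :
  injective f -> exact_at f g -> coind_map (kmap g) h = 0 -> exists h', h = coind_map (kmap f) h'.
Proof.
move=> fI fg h0.
have ex x : exists u : U, cfun h x = f u.
  by apply/fg; have := congr1 (fun h => cfun h x) h0; rewrite coind_mapE.
pose h' x : kmod U := projT1 (cid (ex x)).
have h'E x : f (h' x) = cfun h x by rewrite /h'; case: cid => u /= ->.
have h'P : coindP h'.
  split=> [x y|k x]; apply: fI; first by rewrite linearD !h'E cfunD.
  by rewrite kmodZ linearZ_LR !h'E cfunZ.
exists (mksub (h'P : coind_sub (kmod U) _)).
by apply: coind_eq => x; rewrite coind_mapE [cfun (mksub _)]inclK /= h'E.
Qed.

Lemma coind_ses : preserves_ses coind_functor.
Proof.
move=> U V W f g fI gs fg; split.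
- move=> h k e; apply: coind_eq => x; apply: fI.
  by have := congr1 (fun h => cfun h x) e; rewrite !coind_mapE.
- have [s sK] := @surjective_section (kmod V) (kmod W) (kmap g) gs.
  by move=> h; exists (coind_map s h); apply/esym/(coind_mapK sK).
- move=> h; split=> [|[h' ->]]; first exact: coind_lift.
  apply: coind_eq => x; rewrite !coind_mapE; apply/fg.
  by exists (cfun h' x).
Qed.

(* M |-> Hom_R(N, Hom_K(R, M)) is exact, being isomorphic to M |-> Hom_K(N, M). *)
Lemma hom_coind_ses (N : lmodType R) : preserves_ses (comp_functor (hom_functor N) coind_functor).
Proof.
move=> U V W f g fI gs fg; have [cI _ ce] := coind_ses fI gs fg; split.
- move=> h k e; apply: homP => x; apply: cI.
  by have := congr1 (fun h => homlin h x) e.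
(* The section s is merely K-linear, but [coind_map s] is R-linear, so composing with it stays among
   R-linear maps. *)
- have [s sK] := @surjective_section (kmod V) (kmod W) (kmap g) gs.
  move=> h; exists (mkhom (coind_map s \o homlin h)); apply: homP => x.
  exact/esym/(coind_mapK sK).
- move=> h; split=> [h0|[h' ->]]; last first.
    by apply: homP => x; apply/ce; exists (homlin h' x).
  have ex x : exists u : coind R (kmod U), homlin h x = coind_map (kmap f) u.
    by apply/ce; have := congr1 (fun h => homlin h x) h0.
  pose h' x := projT1 (cid (ex x)).
  have h'E x : coind_map (kmap f) (h' x) = homlin h x by rewrite /h'; case: cid => u /= ->.
  have h'L : linear h'.
    move=> a x y; apply: cI.
    by rewrite [RHS](linearP (coind_map (kmap f))) [LHS]h'E !h'E linearP.
  by exists (mkhom (mkLinear h'L)); apply: homP => x; apply/esym/h'E.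
Qed.
End CoinducedFunctor.

(** * The standard injective resolution is functorial and exact *)

Section Cosyzygies.
Variables (K : fieldType) (R : ualgType K).
Local Notation emb_ M := (@emb K R M : {linear _ -> _}).

Section Step.
Variables (M N : lmodType R) (f : {linear M -> N}).
Lemma emb_natural x : coind_map R (kmap f) (emb x) = emb (f x).
Proof. by apply: coind_eq => y; rewrite coind_mapE /cfun !inclK /= linearZ. Qed.
Lemma cosyz_stepP h : imm (emb_ M) h -> (projection (imm (emb_ N)) \o coind_map R (kmap f)) h = 0.
Proof. by case=> m ->; apply/proj_eq0; exists (f m); rewrite emb_natural. Qed.
Definition cosyz_step : {linear quo (imm (emb_ M)) -> quo (imm (emb_ N))} :=
  mkLinear (qlift_is_linear cosyz_stepP).
Lemma cosyz_stepE h : cosyz_step (proj _ h) = proj _ (coind_map R (kmap f) h).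
Proof. exact: (qliftE cosyz_stepP). Qed.
End Step.

Definition cosyz_functor1 : modfunctor R R.
Proof.
refine (@ModFunctor R R (fun M => quo (imm (emb_ M))) cosyz_step _ _ _).
- move=> M q; have [h ->] := proj_surj q; rewrite cosyz_stepE; congr proj.
  exact: (@fmap_id _ _ (coind_functor R) M h).
- move=> M N P g f q; have [h ->] := proj_surj q.
  rewrite (cosyz_stepE f) (cosyz_stepE g) (cosyz_stepE (g \o f)); congr proj.
  exact: (@fmap_comp _ _ (coind_functor R) M N P g f h).
- move=> M N f g q; have [h ->] := proj_surj q; rewrite !cosyz_stepE -linearD; congr proj.
  exact: (@fmap_add _ _ (coind_functor R) M N f g h).
Defined.

Lemma cosyz1E (M N : lmodType R) (f : {linear M -> N}) h :
  fmap cosyz_functor1 f (proj _ h) = proj _ (fmap (coind_functor R) f h).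
Proof. exact: cosyz_stepE. Qed.

Lemma fmap_emb (M N : lmodType R) (f : {linear M -> N}) x :
  fmap (coind_functor R) f (emb x) = emb (f x).
Proof. exact: emb_natural. Qed.

(* the 3 x 3 lemma *)
Lemma cosyz1_ses : preserves_ses cosyz_functor1.
Proof.
move=> U V W f g fI gs fg; have [cI cs ce] := coind_ses fI gs fg; split.
- apply: linear_inj => q; have [h ->] := proj_surj q; rewrite cosyz1E !proj_eq0 => -[v hv].
  have [u vu] : exists u, v = f u.
    apply/fg; apply: (@emb_inj _ _ W); rewrite [RHS]linear0 -fmap_emb -hv.
    by apply/ce; exists h.
  by exists u; apply: cI; rewrite hv fmap_emb vu.
- move=> q; have [h ->] := proj_surj q; have [h' ->] := cs h.
  by exists (proj _ h'); rewrite cosyz1E.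
- move=> q; split=> [|[r ->]]; last first.
    have [h ->] := proj_surj r; rewrite !cosyz1E; apply/proj_eq0; exists 0.
    by rewrite linear0; apply/ce; exists h.
  have [h ->] := proj_surj q; rewrite cosyz1E proj_eq0 => -[w hw].
  have [v vw] := gs w.
  have [h' hE] : exists h', h - emb v = fmap (coind_functor R) f h'.
    by apply/ce; rewrite linearB hw fmap_emb vw subrr.
  exists (proj _ h'); rewrite cosyz1E; apply/projP; exists v.
  by rewrite -hE opprB addrC subrK.
Qed.

Fixpoint cosyz_map (M N : lmodType R) (f : {linear M -> N}) n :
    {linear cosyzygy M n -> cosyzygy N n} :=
  match n with 0%N => f | m.+1 => cosyz_step (cosyz_map f m) end.

Definition cosyz_functor (n : nat) : modfunctor R R.
Proof.
refine (@ModFunctor R R (fun M => cosyzygy M n) (fun M N f => cosyz_map f n) _ _ _).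
- move=> M; elim: n => [//|n IH] x /=; rewrite -[RHS](fmap_id (m := cosyz_functor1)).
  by congr (fmap cosyz_functor1 _ x); apply: lin_eq => y; rewrite IH.
- move=> M N P g f; elim: n => [//|n IH] x /=; rewrite -[RHS](fmap_comp (m := cosyz_functor1)).
  by congr (fmap cosyz_functor1 _ x); apply: lin_eq => y; rewrite IH.
- move=> M N f g; elim: n => [//|n IH] x /=; rewrite -[RHS](fmap_add (m := cosyz_functor1)).
  by congr (fmap cosyz_functor1 _ x); apply: lin_eq => y; rewrite IH.
Defined.

Lemma cosyz_ses n : preserves_ses (cosyz_functor n).
Proof.
elim: n => [|n IH] U V W f g fI gs fg; first by split.
by have [fI' gs' fg'] := IH _ _ _ _ _ fI gs fg; have := cosyz1_ses fI' gs' fg'.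
Qed.

Variable N : lmodType R.

(** The functor [ext_term n] unfolds to this composite, and takes its functor laws and its exactness
    from it. *)
Let ext_comp n : modfunctor R K :=
  comp_functor (comp_functor (hom_functor N) (coind_functor R)) (cosyz_functor n).

Definition ext_map n (V W : lmodType R) (f : {linear V -> W}) :
  {linear hom N (sob V n) -> hom N (sob W n)} := hom_map (coind_map R (kmap (cosyz_map f n))).

(* the n-th term of the complex computing Ext_R(N, -), as a functor *)
Definition ext_term (n : nat) : modfunctor R K.
Proof.
refine (@ModFunctor R K (fun V => hom N (sob V n)) (@ext_map n) _ _ _).
- exact: (@fmap_id _ _ (ext_comp n)).
- exact: (@fmap_comp _ _ (ext_comp n)).
- exact: (@fmap_add _ _ (ext_comp n)).
Defined.

Lemma ext_term_ses n : preserves_ses (ext_term n).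
Proof. exact: comp_preserves_ses (@hom_coind_ses _ _ N) (@cosyz_ses n). Qed.

Definition ext_dif V n : {linear hom N (sob V n) -> hom N (sob V n.+1)} := hom_map (sdif V n).

Lemma ext_dif_dif V n x : ext_dif V n.+1 (ext_dif V n x) = 0.
Proof. exact: (dif_dif (c := map_cocomplex (hom_functor N) (standard_resolution V))). Qed.

Definition ext_complex (V : lmodType R) : cocomplex K := Cocomplex (@ext_dif_dif V).

Lemma ExtE n V : Ext n N V = cohomology (ext_complex V) n.
Proof. by []. Qed.

Lemma ext_dif_natural n (V W : lmodType R) (f : {linear V -> W}) (x : ext_complex V n) :
  fmap (ext_term n.+1) f (dif (ext_complex V) n x) = dif (ext_complex W) n (fmap (ext_term n) f x).
Proof.
apply: homP => y.
transitivity (emb (cosyz_map f n.+1 (proj _ (homlin x y)))).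
  exact: (emb_natural (cosyz_map f n.+1) (proj _ (homlin x y))).
exact: (congr1 (@emb K R _) (cosyz_stepE (cosyz_map f n) (homlin x y))).
Qed.

Lemma alternating_square (X Y Z W : lmodType K) (h : {linear X -> Y}) (h' : {linear Z -> W})
    (v : {linear X -> Z}) (v' : {linear Y -> W}) n x :
  (forall x, v' (h x) = h' (v x)) -> h' ((-1) ^+ n *: v x) + (-1) ^+ n.+1 *: v' (h x) = 0.
Proof. by move=> vh; rewrite linearZ_LR vh exprS mulN1r scaleNr subrr. Qed.

Section ExtDoubleComplex.
Variable U : cocomplex R.

Definition extd_ob p q := ext_term p (U q).
Definition extd_h p q : {linear extd_ob p q -> extd_ob p.+1 q} := dif (ext_complex (U q)) p.
(** The sign makes the squares, which commute by naturality, anticommute. *)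
Definition extd_v_fun p q (x : extd_ob p q) : extd_ob p q.+1 :=
  (-1) ^+ p *: fmap (ext_term p) (dif U q) x.
Lemma extd_v_linear p q : linear (@extd_v_fun p q).
Proof.
by move=> a x y; rewrite /extd_v_fun linearP scalerDr !scalerA mulrC.
Qed.
Definition extd_v p q : {linear extd_ob p q -> extd_ob p q.+1} := mkLinear (@extd_v_linear p q).

Lemma extd_vE p q x : extd_v p q x = (-1) ^+ p *: fmap (ext_term p) (dif U q) x.
Proof. by []. Qed.

Lemma extd_v0 p q x : extd_v p q x = 0 <-> fmap (ext_term p) (dif U q) x = 0.
Proof.
rewrite extd_vE; split=> [/eqP|->]; last exact: scaler0.
by rewrite scaler_eq0 signr_eq0 => /eqP.
Qed.

Lemma extd_hh p q x : extd_h p.+1 q (extd_h p q x) = 0.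
Proof. exact: (dif_dif (c := ext_complex (U q))). Qed.
Lemma extd_vv p q x : extd_v p q.+1 (extd_v p q x) = 0.
Proof.
rewrite !extd_vE linearZ_LR (_ : fmap _ _ (fmap _ _ _) = 0) ?scaler0 //.
exact: (dif_dif (c := map_cocomplex (ext_term p) U)).
Qed.
Lemma extd_hv p q x : extd_h p q.+1 (extd_v p q x) + extd_v p.+1 q (extd_h p q x) = 0.
Proof. exact/alternating_square/(@ext_dif_natural p). Qed.

Definition ext_double_complex : double_complex K :=
  DoubleComplex extd_hh extd_vv extd_hv.
End ExtDoubleComplex.
End Cosyzygies.

(** * Cohomology in the direction of q: the second page as Ext modules *)

Section ExtPages.
Variables (K : fieldType) (R : ualgType K) (N : lmodType R) (U : cocomplex R).
Local Notation D := (ext_double_complex N U).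
Local Notation G p f := (fmap (ext_term N p) f).

Lemma single_vpart (p q : nat) (y : D p q) :
  vpart (single ((-1) ^+ p *: y) : tot D) p q.+1 = G p (dif U q) y.
Proof.
rewrite /= single_in; transitivity (extd_v N U p q ((-1) ^+ p *: y)); first by [].
by rewrite linearZ_LR extd_vE scalerA -exprD addnn -signr_odd odd_double scale1r.
Qed.

Definition cocycle_incl q : {linear subm (cocycles U q) -> U q} := inclusion (cocycles U q).
Definition cocycle_class q : {linear subm (cocycles U q) -> cohomology U q} := projection _.

(** An exact functor preserves the exactness of U^(q-1) -> Z^q -> H^q at Z^q. For q = 0 the class
    map is injective instead, and remains so after applying the functor. *)
Lemma cocycle_classP p q z :
  G p (cocycle_class q) z = 0 <-> exists x : tot D, G p (cocycle_incl q) z = vpart x p q.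
Proof.
have Gi : injective (G p (cocycle_incl q)) := ses_inj (@ext_term_ses _ _ N p) (@incl_inj _ _ _).
case: q z Gi => [|m] z Gi.
  have cI : injective (cocycle_class 0).
    by apply: linear_inj => y; rewrite proj_eq0 => y0; apply: incl_inj; rewrite [LHS]y0 [RHS]linear0.
  have Gc : injective (G p (cocycle_class 0)) := ses_inj (@ext_term_ses _ _ N p) cI.
  split=> [z0|[x zx]]; first by exists 0; rewrite (Gc z 0) ?z0 ?linear0.
  by rewrite (Gi z 0) ?linear0.
pose b := corestr (fun x => dif_dif x : cocycles U m.+1 (dif U m x)).
have bc : exact_at b (cocycle_class m.+1).
  move=> y; rewrite proj_eq0; split=> [[x yx]|[x ->]].
    by exists x; apply: incl_inj; rewrite [LHS]yx corestrK.
  by exists x; rewrite [LHS]corestrK.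
have Gbc : exact_at (G p b) (G p (cocycle_class m.+1)) := ses_exact (@ext_term_ses _ _ N p) bc.
have ib x : G p (cocycle_incl m.+1) (G p b x) = G p (dif U m) x.
  rewrite -fmap_comp; congr (fmap (ext_term N p) _ x).
  by apply: lin_eq => y; rewrite [LHS]corestrK.
split=> [/Gbc [y ->]|[x zx]].
  by exists (single ((-1) ^+ p *: y : D p m)); rewrite ib single_vpart.
apply/Gbc; exists ((-1) ^+ p *: x p m); apply: Gi.
by rewrite ib linearZ_LR zx.
Qed.

(** Exactness of [ext_term N p] identifies its values on cocycles and cohomology of U with the
    vertical cocycles and cohomology of the double complex. *)
Theorem ext_second_page p q :
  lmod_iso (page (total_spectral_sequence D) 2 p q) (Ext p N (cohomology U q)).
Proof.
pose Y p := ext_term N p (subm (cocycles U q)).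
pose W := ext_complex N (cohomology U q).
rewrite ExtE -/W.
pose i p : {linear Y p -> D p q} := G p (cocycle_incl q).
pose c p : {linear Y p -> W p} := G p (cocycle_class q).
pose e p : Y p -> Y p.+1 := dif (ext_complex N (subm (cocycles U q))) p.
apply: (@second_page K D q W Y i c e).
- move=> {}p y; apply: iff_trans (extd_v0 _) _.
  exact: (ses_exact (@ext_term_ses _ _ N p) (@kerm_exact _ _ _ (dif U q))).
- move=> {}p; have cs : surjective (cocycle_class q) := @proj_surj _ _ _.
  exact: (ses_surj (@ext_term_ses _ _ N p) cs).
- by move=> {}p; apply: cocycle_classP.
- by move=> {}p z; apply: ext_dif_natural.
- by move=> {}p z; apply: ext_dif_natural.
Qed.
End ExtPages.

(** * Injective coefficients and collapse *)

Section InjectiveRows.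
Variables (K : fieldType) (R : ualgType K).
Local Notation emb_ M := (@emb K R M : {linear _ -> _}).

Definition hom_emb (N V : lmodType R) n : {linear hom N (cosyzygy V n) -> ext_complex N V n} :=
  fmap (hom_functor N) (emb_ (cosyzygy V n)).

Lemma hom_emb_inj N V n : injective (@hom_emb N V n).
Proof.
move=> f g fg; apply: homP => x; apply: (@emb_inj _ _ (cosyzygy V n)).
exact: (congr1 (fun h => homlin h x) fg).
Qed.

Lemma ext_kernel N V n (f : ext_complex N V n) :
  dif (ext_complex N V) n f = 0 <-> exists g, f = hom_emb N V n g.
Proof.
split=> [f0|[g ->]]; last first.
  by apply: homP => x; apply/sdif0; exists (homlin g x).
have ex x : exists m : cosyzygy V n, homlin f x = emb m.
  by apply/sdif0; apply: (congr1 (fun h => homlin h x) f0).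
pose g x := projT1 (cid (ex x)).
have gE x : emb (g x) = homlin f x by rewrite /g; case: cid => m /= ->.
have gL : linear g.
  move=> a x y; apply: (@emb_inj _ _ (cosyzygy V n)).
  by rewrite gE [RHS](@emb_linear K R) !gE; apply: linearP.
by exists (mkhom (mkLinear gL)); apply: homP => x; apply: esym (gE x).
Qed.

(* An injective module is a direct summand of Hom_K(R, J), hence so is the cokernel. *)
Lemma cosyz1_section (J : lmodType R) : injective_module J ->
  exists s : {linear quo (imm (emb_ J)) -> coind R (kmod J)}, cancel s (proj (imm (emb_ J))).
Proof.
move=> Ji; have [r rP] := Ji _ _ (emb_ J) idfun (@emb_inj _ _ J).
pose f := idfun \- (emb_ J \o r) : {linear coind R (kmod J) -> coind R (kmod J)}.
have f0 h : imm (emb_ J) h -> f h = 0 by case=> m ->; rewrite /= rP /= subrr.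
exists (mkLinear (qlift_is_linear f0)) => q; have [h ->] := proj_surj q.
rewrite [X in proj _ X](qliftE f0); apply/projP; exists (- r h).
by rewrite linearN /= addrAC subrr add0r.
Qed.

Lemma retract_injective (I J : lmodType R) (s : {linear J -> I}) (p : {linear I -> J}) :
  cancel s p -> injective_module I -> injective_module J.
Proof.
move=> sK Ii M M' i f iI; have [g gP] := Ii _ _ i (s \o f) iI.
by exists (p \o g) => x; rewrite /= gP /= sK.
Qed.

Lemma cosyz_injective (J : lmodType R) n : injective_module J -> injective_module (cosyzygy J n).
Proof.
move=> Ji; elim: n => [//|n IH]; have [s sK] := cosyz1_section IH.
exact: (retract_injective (p := projection _) sK (@coind_injective _ _ _)).
Qed.

(** When J is injective, the projection from [sob J n] onto the next cosyzygy splits, so every map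
    from N to that cosyzygy lifts. *)
Lemma ext_injective (N J : lmodType R) n (f : ext_complex N J n.+1) : injective_module J ->
  dif (ext_complex N J) n.+1 f = 0 -> exists g, f = dif (ext_complex N J) n g.
Proof.
move=> Ji /ext_kernel [g ->]; have [s sK] := cosyz1_section (@cosyz_injective _ n Ji).
exists (mkhom (s \o homlin g)); apply: homP => x.
by congr (emb _); rewrite [RHS]sK.
Qed.
End InjectiveRows.

Section Degenerate.
Variables (K : fieldType) (R : ualgType K) (N : lmodType R) (U : cocomplex R).
Hypothesis U_injective : forall q, injective_module (U q).
Local Notation D := (ext_double_complex N U).

Theorem ext_total n :
  lmod_iso (total_cohomology D n) (cohomology (map_cocomplex (hom_functor N) U) n).
Proof.
apply: (@total_column K D _ (map_cocomplex (hom_functor N) U) (fun n => hom_emb N (U n) 0)).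
- by move=> p q y; apply: ext_injective.
- by move=> {}n; apply: hom_emb_inj.
- by move=> {}n y; apply: ext_kernel.
- move=> {}n f; rewrite [LHS]extd_vE expr0 scale1r.
  by apply: homP => x; apply: emb_natural.
Qed.

Variables (V : lmodType R) (aug : {linear V -> U 0%N}).
Hypothesis aug_inj : injective aug.
Hypothesis aug_exact : exact_at aug (dif U 0).
Hypothesis U_exact : forall q, exact_at (dif U q) (dif U q.+1).

(** [Ext] is defined by the standard resolution. The double complex of Hom(N, J^p(U^q)) compares it
    with U: it collapses in one direction since the U^q are injective, and in the other since
    [ext_term] is exact. *)
Theorem injective_resolution_Ext n :
  lmod_iso (cohomology (map_cocomplex (hom_functor N) U) n) (Ext n N V).
Proof.
apply: lmod_iso_trans (lmod_iso_sym (ext_total n)) _.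
apply: lmod_iso_trans (total_transpose D n) _.
apply: (@total_column K (transpose D) _ (ext_complex N V) (fun n => fmap (ext_term N n) aug)).
- move=> p q y /extd_v0 /(ses_exact (@ext_term_ses _ _ N q) (@U_exact p)) [z ->].
  exists ((-1) ^+ q *: z); rewrite [RHS]extd_vE linearZ_LR scalerA -exprD addnn.
  by rewrite -signr_odd odd_double scale1r.
- by move=> {}n; apply: (ses_inj (@ext_term_ses _ _ N n) aug_inj).
- move=> {}n y; apply: iff_trans (extd_v0 _) _.
  exact: (ses_exact (@ext_term_ses _ _ N n) aug_exact).
- by move=> {}n x; apply/esym/ext_dif_natural.
Qed.
End Degenerate.

(** * Central elements of bimodules *)

Section CocomplexIso.
Variables (K : pzRingType) (C C' : cocomplex K) (W : nat -> lmodType K).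
Variables (dW : forall n, {linear W n -> W n.+1}).
Variables (v : forall n, {linear C n -> W n}) (v' : forall n, {linear C' n -> W n}).
Hypotheses (vI : forall n, injective (v n)) (v'I : forall n, injective (v' n)).
Hypothesis vd : forall n x, v n.+1 (dif C n x) = dW n (v n x).
Hypothesis v'd : forall n x, v' n.+1 (dif C' n x) = dW n (v' n x).
Hypothesis vv' : forall n w, (exists x, w = v n x) <-> (exists x, w = v' n x).

(** Both complexes embed in [W] with the same image in each degree, and matching elements with equal
    images gives the isomorphism. *)
Lemma cocomplex_iso n : lmod_iso (cohomology C n) (cohomology C' n).
Proof.
have v0 m x : v m x = 0 <-> x = 0.
  by split=> [|->]; rewrite ?linear0 // -[X in _ = X](linear0 (v m)) => /vI.
have v'0 m x : v' m x = 0 <-> x = 0.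
  by split=> [|->]; rewrite ?linear0 // -[X in _ = X](linear0 (v' m)) => /v'I.
have ex m x : exists x', v m x = v' m x' by apply/vv'; exists x.
have ex' m x' : exists x, v m x = v' m x'.
  by have /vv'[x ->] : exists y, v' m x' = v' m y; [exists x' | exists x].
have dd m x x' : v m x = v' m x' -> v m.+1 (dif C m x) = v' m.+1 (dif C' m x').
  by move=> e; rewrite vd v'd e.
apply: (@subquo_subquo_iso _ _ _ _ _ _ _ (fun x x' => v n x = v' n x')).
- by move=> a x y x' y' e e'; rewrite !linearP e e'.
- move=> x dx; have [x' e] := ex _ x; exists x' => //.
  by apply/v'0; rewrite -(dd _ _ _ e) (_ : dif C n x = 0) ?linear0.
- move=> x' dx'; have [x e] := ex' _ x'; exists x => //.
  by apply/v0; rewrite (dd _ _ _ e) (_ : dif C' n x' = 0) ?linear0.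
move=> x x' _ _ e; case: n x x' e => [|n] x x' e.
  split=> [x0|x0]; first by apply/v'0; rewrite -e (_ : x = 0) ?linear0.
  by apply/v0; rewrite e (_ : x' = 0) ?linear0.
split=> -[y yx].
  have [y' e'] := ex _ y; exists y'; apply: v'I.
  by rewrite -e yx; apply: dd.
have [y' e'] := ex' _ y; exists y'; apply: vI.
by rewrite e yx; apply/esym/dd.
Qed.
End CocomplexIso.

Section Bimodules.
Variables (K : fieldType) (R : ualgType K) (N : lmodType (env R)).
Implicit Types (a b : R) (n : N).

Lemma tens_lr a b n : tens a b *: n = tens a 1 *: (tens 1 b *: n).
Proof. by rewrite scalerA tensM mulr1 mulr1. Qed.
Lemma tens_rl a b n : tens a b *: n = tens 1 b *: (tens a 1 *: n).
Proof. by rewrite scalerA tensM mul1r mul1r. Qed.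
Lemma tens_ll a b n : tens a 1 *: (tens b 1 *: n) = tens (a * b) 1 *: n.
Proof. by rewrite scalerA tensM mul1r. Qed.
Lemma tens_rr a b n : tens 1 a *: (tens 1 b *: n) = tens 1 (b * a) *: n.
Proof. by rewrite scalerA tensM mul1r. Qed.
Lemma tens0l b : tens (0 : R) b = 0.
Proof. by apply: (addrI (tens 0 b)); rewrite -tensDl !addr0. Qed.
Lemma tens0r a : tens a (0 : R) = 0.
Proof. by apply: (addrI (tens a 0)); rewrite -tensDr !addr0. Qed.
End Bimodules.

Section CentralElements.
Variables (K : fieldType) (R : ualgType K) (N : lmodType (env R)).

(** These elements form Hom_(R^e)(R, N): a bimodule map from R is determined by its value at 1,
    which can be any central element. *)
Definition central (n : N) : Prop := forall a : R, tens a 1 *: n = tens 1 a *: n.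

Lemma hom_value (h : hom (regbimod R) N) (x : R) : homlin h x = tens x 1 *: homlin h (1 : R).
Proof. by rewrite -linearZ regbimodE !mulr1. Qed.

Lemma hom_value_central (h : hom (regbimod R) N) : central (homlin h (1 : R)).
Proof. by move=> a; rewrite -!linearZ !regbimodE !mulr1 mul1r. Qed.

Lemma hom_value_inj (g h : hom (regbimod R) N) : homlin g (1 : R) = homlin h (1 : R) -> g = h.
Proof. by move=> e; apply: homP => x; rewrite !(hom_value _ x) e. Qed.

Variables (n : N) (cn : central n).
Lemma central_tens (a b c : R) : tens a (b * c) *: n = tens (a * b) c *: n.
Proof.
have -> : tens a (b * c) = tens a c * tens 1 b by rewrite tensM mulr1.
by rewrite -scalerA -cn scalerA tensM mul1r.
Qed.

Definition central_fun (x : regbimod R) : N := tens (x : R) 1 *: n.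
Lemma central_fun_linear : linear central_fun.
Proof.
have D : {morph central_fun : x y / x + y}.
  by move=> x y; rewrite /central_fun [tens _ _]tensDl scalerDl.
have Z0 : central_fun 0 = 0 by apply: (addrI (central_fun 0)); rewrite -D !addr0.
move=> w x y; rewrite D; congr (_ + _).
elim/env_ind: w => [|u w IHu IHw|b c]; first by rewrite !scale0r.
  by rewrite !scalerDl D IHu IHw.
rewrite regbimodE /central_fun scalerA tensM.
by rewrite mul1r -[c in RHS]mulr1 central_tens.
Qed.
Definition central_hom : hom (regbimod R) N := mkhom (mkLinear central_fun_linear).
Lemma central_homE (x : R) : homlin central_hom x = tens x 1 *: n. Proof. by []. Qed.
End CentralElements.

Lemma repmod_scal (K : fieldType) (S : monoidType) (V : monoid_rep K S) k (x : repmod V) :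
  (scal k : monalg K S) *: x = (k *: (x : V) : V).
Proof.
transitivity (rmscale (<< k *g 1%g >> : monalg K S) x); first by [].
by rewrite rmscaleU ract1.
Qed.

(** Every element of KS is a sum of products of a scalar and an element of S. *)
Lemma monalg_linear (K : fieldType) (S : monoidType) (V W : lmodType (monalg K S)) (f : V -> W) :
  {morph f : x y / x + y} ->
  (forall k x, f ((scal k : monalg K S) *: x) = (scal k : monalg K S) *: f x) ->
  (forall s x, f (ms K s *: x) = ms K s *: f x) -> linear f.
Proof.
move=> fD fK fS w x y; rewrite fD; congr (_ + _).
have f0 : f 0 = 0 by apply: (addrI (f 0)); rewrite -fD !addr0.
elim/malg_ind: w => [|v w IHv IHw|k s]; first by rewrite !scale0r.
  by rewrite !scalerDl fD IHv IHw.
have -> : << k *g s >> = (scal k : monalg K S) * ms K s.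
  rewrite scal_monalg; apply/malgP => t.
  by rewrite mcoeffZ !mcoeffU mulrnAr mulr1.
by rewrite -!scalerA fK fS.
Qed.

(** * Crossed products *)

Section CrossedProduct.
Variables (K : fieldType) (S : invMonoidType) (A : ualgType K) (th : unital_action S A).
Local Notation Lam := (crossed th).
Local Notation u := (aunit th).

Lemma cls_delta s a : cls (delta th s a) = eta th a * gen th s.
Proof.
rewrite /eta /gen -clsM deltaM mul1g sact1; congr cls; apply: delta_eq.
by rewrite -aunitC mulrA aunit_idem.
Qed.

Lemma crossed_ind (P : Lam -> Prop) :
  P 0 -> (forall x y, P x -> P y -> P (x + y)) -> (forall a s, P (eta th a * gen th s)) ->
  forall x, P x.
Proof.
move=> P0 PD PU x; have [w ->] := qpi_surj x.
elim/skew_ind: w => [|v w IHv IHw|s a]; first by rewrite raddf0.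
  by rewrite raddfD; apply: PD.
by rewrite -[qpi _ _]/(cls _) cls_delta.
Qed.

Lemma eta_gen_le s t a : natural_le s t -> u s * a = a -> eta th a * gen th s = eta th a * gen th t.
Proof.
move=> st ua; rewrite -!cls_delta; apply/qpiP => I; apply.
by exists s, t, a.
Qed.

(** As e <= 1, the defining relation of the crossed product identifies 1_e delta_e with 1_e
    delta_1. *)
Lemma gen_idem e : idempotent e -> gen th e = eta th (u e).
Proof.
move=> ee; have := @eta_gen_le e 1%g (u e); rewrite gen1 mulr1 eta_gen; apply.
  by exists e => //; rewrite mulg1.
exact: aunit_idem.
Qed.

Lemma gen_idemC e a : idempotent e -> gen th e * eta th a = eta th a * gen th e.
Proof. by move=> ee; rewrite gen_idem // -!etaM aunitC. Qed.
End CrossedProduct.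

Lemma idem_range (S : invMonoidType) (e : S) : idempotent e -> (e * ginv e)%g = e.
Proof. by move=> ee; rewrite (idem_ginv ee) ee. Qed.

Lemma idem_conj_range (S : invMonoidType) (s e : S) : idempotent e ->
  (s * e * ginv (s * e) = s * e * ginv s)%g.
Proof. by move=> ee; rewrite ginvM (idem_ginv ee) mulgA -(mulgA s e e) ee. Qed.

(** * K E(S) by one generator and relations *)

Section Idempotents.
Variables (K : fieldType) (S : invMonoidType).
Local Notation KE := (KE K S).

Definition idem1 : idems S := exist _ 1%g (introT eqP (mulg1 1%g)).
Definition KE_unit (e : idems S) : KE := << 1 *g e >>.

Lemma ms_KE s e : ms K s *: KE_unit e = KE_unit (idems_conj s e).
Proof. by rewrite repmodE [LHS]KE_actU. Qed.

Lemma KE_unitE e : KE_unit e = ms K (val e) *: KE_unit idem1.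
Proof.
rewrite ms_KE; congr KE_unit; apply: val_inj.
rewrite -[RHS]/(val e * 1 * ginv (val e))%g mulg1 (idem_ginv (idemsP e)).
exact: esym (idemsP e).
Qed.

Lemma KE_ext (V : lmodType (monalg K S)) (f g : {linear KE -> V}) :
  (forall e, f (KE_unit e) = g (KE_unit e)) -> f =1 g.
Proof.
move=> fg w.
have fL (h : {linear KE -> V}) : linear (h : {malg K[idems S]} -> kmod V).
  move=> k x y; rewrite kmodZ; have := linearP h (scal k) x y.
  by rewrite [(_ : monalg K S) *: (x : KE)]repmod_scal.
exact: (@malg_eq _ _ _ (mkLinear (fL f)) (mkLinear (fL g))).
Qed.

Lemma scale_kmod_linear (R : ualgType K) (V : lmodType R) (r : R) :
  linear ((fun x => r *: (x : V)) : kmod V -> kmod V).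
Proof. by move=> k x y; rewrite scalerDr !kmodZ !scalerA scalC. Qed.

(** The relations t 1 = (t t^-1) 1 between multiples of the generator 1 present K E(S) as a
    KS-module. The map sends e to e m. *)
Lemma KE_lift (V : lmodType (monalg K S)) (m : V) :
  (forall t, ms K t *: m = ms K (t * ginv t)%g *: m) ->
  exists f : {linear KE -> V}, f (KE_unit idem1) = m.
Proof.
move=> mP; pose f (w : {malg K[idems S]}) : kmod V := mext (fun e => ms K (val e) *: m : kmod V) w.
have fU e : f << 1 *g e >> = ms K (val e) *: m by rewrite [LHS]mextU scale1r.
have fL : linear f by apply: mext_linear.
have fD : {morph (f : KE -> V) : x y / x + y} := linearD (mkLinear fL).
have fK k (x : KE) : f ((scal k : monalg K S) *: x) = (scal k : monalg K S) *: (f x : V).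
  rewrite [(_ : monalg K S) *: (x : KE)]repmod_scal.
  exact: (linearZ_LR (mkLinear fL)).
have fS s (x : KE) : f (ms K s *: x) = ms K s *: (f x : V).
  rewrite repmodE; apply: (@malg_eq _ _ _ (mkLinear fL \o mkLinear (@KE_actL K S s))
    (mkLinear (scale_kmod_linear (ms K s)) \o mkLinear fL)) => e /=.
  (* By hypothesis t acts on m as its range idempotent t t^-1 does, and s e s^-1 and s e have the
     same range idempotent. *)
  rewrite KE_actU !fU scalerA -msM mP [RHS]mP; congr (ms K _ *: m).
  have ee := idemsP e.
  exact: etrans (idem_range (idem_conj s ee)) (esym (idem_conj_range s ee)).
exists (mkLinear (monalg_linear fD fK fS)).
by rewrite /= [f _]fU ms1 scale1r.
Qed.
End Idempotents.

(** * T1 M as the A-central elements of M *)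

Section T1Values.
Variables (K : fieldType) (S : invMonoidType) (A : ualgType K) (th : unital_action S A).
Local Notation Lam := (crossed th).
Local Notation u := (aunit th).
Local Notation eta := (eta th).
Local Notation gen := (gen th).

Lemma eta_envE a b : eta_env th (tens a b) = tens (eta a) (eta b).
Proof. exact: env_mapE. Qed.

Section Module.
Variable M : lmodType (env Lam).
Local Notation resM := (res (eta_env th) M).

Definition eta_central (n : M) : Prop := forall a, tens (eta a) 1 *: n = tens 1 (eta a) *: n.

Definition T1_value (f : T1_ob M) : M := homlin (f : hom (regbimod A) resM) (1 : A).

Lemma eta_centralP (n : M) : eta_central n <-> central (n : resM).
Proof.
have E1 a : tens (eta a) 1 = eta_env th (tens a 1) by rewrite eta_envE [eta 1]rmorph1.
have E2 a : tens 1 (eta a) = eta_env th (tens 1 a) by rewrite eta_envE [eta 1]rmorph1.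
by split=> nc a; have := nc a; rewrite ?E1 ?E2.
Qed.

Lemma T1_valueD f g : T1_value (f + g) = T1_value f + T1_value g.
Proof. by []. Qed.

Lemma T1_value_scal k f : T1_value ((scal k : monalg K S) *: f) = (scal k : env Lam) *: T1_value f.
Proof.
rewrite /T1_value repmod_scal homZ -[LHS]/(eta_env th (scal k) *: (_ : M)).
by rewrite eta_env_scal.
Qed.

Lemma T1_value_inj : injective T1_value.
Proof. by move=> f g fg; apply: (@hom_value_inj _ _ resM _ _ fg). Qed.

Lemma T1_value_central f : eta_central (T1_value f).
Proof. exact/eta_centralP/hom_value_central. Qed.

Lemma T1_hom_value (f : T1_ob M) a :
  (homlin (f : hom (regbimod A) resM) a : M) = tens (eta a) 1 *: T1_value f.
Proof.
transitivity (eta_env th (tens a 1) *: T1_value f); first exact: (@hom_value _ _ resM f a).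
by rewrite eta_envE [eta 1]rmorph1.
Qed.

(** The value of s f at 1 involves f at s^-1 1 = 1_(s^-1), and this idempotent is absorbed by the
    class of 1_s delta_s. *)
Lemma T1_value_ms s f : T1_value (ms K s *: f) = cross_gen th s *: T1_value f.
Proof.
transitivity (cross_gen th s *: (homlin (f : hom (regbimod A) resM) (sact th (ginv s) 1) : M)).
  by rewrite /T1_value repmodE.
rewrite sact_unit T1_hom_value scalerA /cross_gen tensM mul1r gen_eta.
by rewrite -(sact_unit th (ginv s)) sactV mulr1 eta_gen.
Qed.

Definition T1_mk (n : M) (cn : eta_central n) : T1_ob M :=
  central_hom (iffLR (eta_centralP n) cn).

Lemma T1_mkK n (cn : eta_central n) : T1_value (T1_mk cn) = n.
Proof. by rewrite /T1_value /T1_mk central_homE tens1 scale1r. Qed.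

Lemma eta_central_gen e n : idempotent e -> eta_central n ->
  tens (gen e) 1 *: n = tens 1 (gen e) *: n.
Proof. by move=> ee cn; rewrite gen_idem. Qed.

(* For a central n, the invariance s n = s s^-1 n means that n commutes with s. *)
Lemma cross_gen_central n s : eta_central n ->
  cross_gen th s *: n = cross_gen th (s * ginv s)%g *: n ->
  tens (gen s) 1 *: n = tens 1 (gen s) *: n.
Proof.
have eV := idem_gV s; have Ve := idem_Vg s.
move=> cn; rewrite /cross_gen (idem_ginv eV).
have -> : tens (gen (s * ginv s)%g) (gen (s * ginv s)%g) *: n = tens 1 (gen (s * ginv s)%g) *: n.
  by rewrite tens_rl eta_central_gen // tens_rr -genM eV.
rewrite tens_rl => /(congr1 (fun m => tens 1 (gen s) *: m)).
rewrite (tens_rr (gen s) (gen (ginv s))) (tens_rr (gen s)) -!genM mulgVK => <-.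
rewrite -(tens_rl (gen s)) (tens_lr (gen s) (gen (ginv s * s)%g)) -(eta_central_gen Ve cn).
by rewrite tens_ll -genM mulgA mulgVK.
Qed.

Lemma gen_central_cross (n : M) s : central n ->
  cross_gen th s *: n = tens (gen (s * ginv s)%g) 1 *: n.
Proof. by move=> cn; rewrite /cross_gen tens_lr -cn tens_ll -genM. Qed.

Lemma crossed_central n : eta_central n ->
  (forall s, cross_gen th s *: n = cross_gen th (s * ginv s)%g *: n) ->
  central (n : M).
Proof.
move=> cn sn; elim/crossed_ind => [|x y IHx IHy|a s]; first by rewrite tens0l tens0r.
  by rewrite tensDl tensDr !scalerDl IHx IHy.
by rewrite -tens_ll cross_gen_central // -tens_lr tens_rl cn tens_rr.
Qed.
End Module.

Section KEValues.
Variable M : lmodType (env Lam).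
Local Notation KE := (KE K S).
Local Notation KE_unit := (@KE_unit K S).
Local Notation idem1 := (@idem1 S).

Definition KE_value (f : hom KE (T1_ob M)) : M := T1_value (homlin f (KE_unit idem1)).

Lemma KE_value_inj : injective KE_value.
Proof.
move=> f g /T1_value_inj fg; apply: homP; apply: KE_ext => e.
by rewrite KE_unitE !linearZ_LR fg.
Qed.

Lemma KE_value_central f : central (KE_value f).
Proof.
apply: crossed_central => [|s]; first exact: T1_value_central.
rewrite /KE_value -(T1_value_ms s) -(T1_value_ms (s * ginv s)%g) -!(linearZ_LR (homlin f)).
apply: (congr1 (fun z => T1_value (homlin f z))).
rewrite !ms_KE; congr KE_unit; apply: val_inj => /=.
by rewrite !mulg1 (idem_ginv (idem_gV s)) (idem_gV s).
Qed.

(** For a central n, both s n and (s s^-1) n equal the left multiple of n by [gen (s * ginv s)],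
    which is the relation that [KE_lift] asks for. *)
Lemma KE_value_surj (n : M) : central n -> exists f, n = KE_value f.
Proof.
move=> cn; have ecn : eta_central n by move=> a; apply: cn.
pose m := T1_mk ecn.
have mP t : ms K t *: m = ms K (t * ginv t)%g *: m.
  apply: T1_value_inj; rewrite (T1_value_ms t) (T1_value_ms (t * ginv t)%g) T1_mkK.
  rewrite (gen_central_cross t cn) (gen_central_cross (t * ginv t)%g cn).
  by rewrite (idem_ginv (idem_gV t)) (idem_gV t).
have [f fm] := KE_lift mP.
by exists (mkhom f); rewrite /KE_value [homlin _ _]fm T1_mkK.
Qed.
End KEValues.
End T1Values.

(** * Injectivity of T1 of a coinduced module *)

Lemma span_min (R : pzRingType) (V : lmodType R) (G : V -> Prop) (P : submod V) w :
  span G w -> (forall y, G y -> P y) -> P w.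
Proof. by move=> Gw GP; apply: (Gw P GP). Qed.

(* Extension of balanced bilinear maps: modules over an algebra generated by
   commuting idempotents are flat, since any element of a tensor product only
   involves finitely many idempotents, over which K-linear retractions can be averaged. *)
Section BalancedTensor.
Variables (K : fieldType) (X : lmodType K) (E : eqType) (p : E -> X -> X).

Section Relations.
Variables (V : lmodType K) (a : E -> V -> V).
Local Notation F := {malg K[(X * V)%type]}.
Definition pair_pt (x : X) (v : V) : F := << 1 *g (x, v) >>.

(** The predicate limits the idempotents that may cross, so that membership in the span can be cut
    down to a finite list of them. *)
Variant idem_balanced (P : E -> Prop) : F -> Prop :=
| IdemBalancedDl x x' v : idem_balanced P (pair_pt (x + x') v - pair_pt x v - pair_pt x' v)
| IdemBalancedDr x v v' : idem_balanced P (pair_pt x (v + v') - pair_pt x v - pair_pt x v')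
| IdemBalancedZl k x v : idem_balanced P (pair_pt (k *: x) v - k *: pair_pt x v)
| IdemBalancedZr k x v : idem_balanced P (pair_pt x (k *: v) - k *: pair_pt x v)
| IdemBalancedM e x v : P e -> idem_balanced P (pair_pt (p e x) v - pair_pt x (a e v)).

Lemma idem_balanced_sub (P Q : E -> Prop) w :
  (forall e, P e -> Q e) -> span (idem_balanced P) w -> span (idem_balanced Q) w.
Proof.
move=> PQ wB; apply: (span_min wB) => y [x x' v|x v v'|k x v|k x v|e x v /PQ Qe].
- exact/span_gen/IdemBalancedDl.
- exact/span_gen/IdemBalancedDr.
- exact/span_gen/IdemBalancedZl.
- exact/span_gen/IdemBalancedZr.
- exact/span_gen/IdemBalancedM.
Qed.

Lemma idem_balanced_finite w : span (idem_balanced (fun=> True)) w ->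
  exists L : seq E, span (idem_balanced (fun e => e \in L)) w.
Proof.
pose fin w := exists L : seq E, span (idem_balanced (fun e => e \in L)) w.
have f0 : fin 0 by exists [::]; apply: smem0.
have fD x y : fin x -> fin y -> fin (x + y).
  case=> L Lx [L' Ly]; exists (L ++ L'); apply: smemD.
    by apply: idem_balanced_sub Lx => e; rewrite mem_cat => ->.
  by apply: idem_balanced_sub Ly => e; rewrite mem_cat orbC => ->.
have fZ k x : fin x -> fin (k *: x) by case=> L Lx; exists L; apply: smemZ.
move=> wB; apply: (span_min (P := Submod f0 fD fZ) wB) => y [x x' v|x v v'|k x v|k x v|e x v _].
- by exists [::]; apply/span_gen/IdemBalancedDl.
- by exists [::]; apply/span_gen/IdemBalancedDr.
- by exists [::]; apply/span_gen/IdemBalancedZl.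
- by exists [::]; apply/span_gen/IdemBalancedZr.
- by exists [:: e]; apply/span_gen/IdemBalancedM; rewrite inE.
Qed.

Definition btensor : lmodType K := quo (span (idem_balanced (fun=> True))).
Definition btensor_pt x v : btensor := proj _ (pair_pt x v).

Lemma btensor_ptDl x x' v : btensor_pt (x + x') v = btensor_pt x v + btensor_pt x' v.
Proof.
rewrite /btensor_pt -[RHS]linearD; apply/projP; rewrite opprD addrA.
exact/span_gen/IdemBalancedDl.
Qed.
Lemma btensor_ptDr x v v' : btensor_pt x (v + v') = btensor_pt x v + btensor_pt x v'.
Proof.
rewrite /btensor_pt -[RHS]linearD; apply/projP; rewrite opprD addrA.
exact/span_gen/IdemBalancedDr.
Qed.
Lemma btensor_ptZl k x v : btensor_pt (k *: x) v = k *: btensor_pt x v.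
Proof. by rewrite /btensor_pt -[RHS]linearZ_LR; apply/projP/span_gen/IdemBalancedZl. Qed.
Lemma btensor_ptZr k x v : btensor_pt x (k *: v) = k *: btensor_pt x v.
Proof. by rewrite /btensor_pt -[RHS]linearZ_LR; apply/projP/span_gen/IdemBalancedZr. Qed.
Lemma btensor_ptM e x v : btensor_pt (p e x) v = btensor_pt x (a e v).
Proof. by apply/projP/span_gen/IdemBalancedM. Qed.

Record balanced_map (W : lmodType K) (f : X -> V -> W) : Prop := BalancedMap {
  balDl : forall x x' v, f (x + x') v = f x v + f x' v;
  balDr : forall x v v', f x (v + v') = f x v + f x v';
  balZl : forall k x v, f (k *: x) v = k *: f x v;
  balZr : forall k x v, f x (k *: v) = k *: f x v;
  balM : forall e x v, f (p e x) v = f x (a e v) }.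

Section Lift.
Variables (W : lmodType K) (f : X -> V -> W).
Hypothesis fB : balanced_map f.
Definition pair_lift : {linear F -> W} :=
  mext (fun q : X * V => f q.1 q.2) : {linear {malg K[(X * V)%type]} -> W}.
Lemma pair_liftE x v : pair_lift (pair_pt x v) = f x v.
Proof. by rewrite [LHS]mextU scale1r. Qed.
Lemma btensor_liftP w : span (idem_balanced (fun=> True)) w -> pair_lift w = 0.
Proof.
move=> wB; apply: (span_min (P := kerm pair_lift) wB) => _ [x x' v|x v v'|k x v|k x v|e x v _].
- by rewrite /= !linearB !pair_liftE (balDl fB) addrAC addrK subrr.
- by rewrite /= !linearB !pair_liftE (balDr fB) addrAC addrK subrr.
- by rewrite /= linearB linearZ_LR !pair_liftE (balZl fB) subrr.
- by rewrite /= linearB linearZ_LR !pair_liftE (balZr fB) subrr.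
- by rewrite /= linearB !pair_liftE (balM fB) subrr.
Qed.
Definition btensor_lift : {linear btensor -> W} := mkLinear (qlift_is_linear btensor_liftP).
Lemma btensor_liftE x v : btensor_lift (btensor_pt x v) = f x v.
Proof. by rewrite [LHS](qliftE btensor_liftP) pair_liftE. Qed.
End Lift.
End Relations.

Variables (V V' : lmodType K) (a : E -> {linear V -> V}) (a' : E -> {linear V' -> V'}).
Variable i : {linear V -> V'}.
Hypothesis i_inj : injective i.
Hypothesis ia : forall e v, i (a e v) = a' e (i v).
Hypothesis a'_idem : forall e v, a' e (a' e v) = a' e v.
Hypothesis a'C : forall e f v, a' e (a' f v) = a' f (a' e v).

(** Induction on the list: e r e + (1 - e) r (1 - e) is again a retraction and commutes with e. It
    keeps commuting with the earlier idempotents because these commute with e. *)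
Lemma equivariant_retraction (L : seq E) : exists r : {linear V' -> V},
  cancel i r /\ forall e v, e \in L -> r (a' e v) = a e (r v).
Proof.
have a_idem e v : a e (a e v) = a e v by apply: i_inj; rewrite !ia a'_idem.
have aC e f v : a e (a f v) = a f (a e v) by apply: i_inj; rewrite !ia a'C.
elim: L => [|e L [r [iK rL]]].
  by have [r rP] := extend_linear idfun i_inj; exists r; split.
pose s v := a e (r (a' e v)) + (r (v - a' e v) - a e (r (v - a' e v))).
have rearr k (A B D A' B' D' : V) :
    (k *: A + A') + ((k *: B + B') - (k *: D + D')) = k *: (A + (B - D)) + (A' + (B' - D')).
  by rewrite !scalerDr scalerN opprD (addrACA (k *: B)) (addrACA (k *: A)).
have sL : linear s.
  move=> k x y; rewrite /s.
  have -> : k *: x + y - a' e (k *: x + y) = k *: (x - a' e x) + (y - a' e y).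
    by rewrite (linearP (a' e)) opprD addrACA scalerBr.
  rewrite !(linearP (a' e), linearP r, linearP (a e)).
  exact: rearr.
exists (mkLinear sL); split=> [v|f v].
  rewrite /= /s -ia -linearB !iK a_idem linearB a_idem subrr subr0.
  by rewrite addrC subrK.
rewrite inE => /orP[/eqP -> | fL]; rewrite /= /s.
  by rewrite a'_idem subrr (linear0 r) (linear0 (a e)) subr0 addr0
    (linearD (a e)) (linearB (a e)) !a_idem subrr addr0.
rewrite a'C -(linearB (a' f)) !(rL f _ fL) (linearD (a f)) (linearB (a f)).
by rewrite ![a f (a e _)]aC.
Qed.

Definition pair_map (U U' : lmodType K) (r : U -> U') :
    {linear {malg K[(X * U)%type]} -> {malg K[(X * U')%type]}} :=
  mext (fun q : X * U => pair_pt q.1 (r q.2)).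
Lemma pair_mapE (U U' : lmodType K) (r : U -> U') x v : pair_map r (pair_pt x v) = pair_pt x (r v).
Proof. by rewrite [LHS]mextU scale1r. Qed.

Lemma bmap_balanced : balanced_map a (fun x v => btensor_pt a' x (i v)).
Proof.
split=> [x x' v|x v v'|k x v|k x v|e x v].
- exact: btensor_ptDl.
- by rewrite linearD btensor_ptDr.
- exact: btensor_ptZl.
- by rewrite linearZ_LR btensor_ptZr.
- by rewrite btensor_ptM ia.
Qed.
Definition btensor_map : {linear btensor a -> btensor a'} := btensor_lift bmap_balanced.

Lemma btensor_mapE w : btensor_map (proj _ w) = proj _ (pair_map i w).
Proof.
rewrite [LHS](qliftE (btensor_liftP bmap_balanced)).
apply: (@malg_eq _ _ _ (pair_lift _) (projection _ \o pair_map i)) => -[x v].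
by rewrite [LHS]pair_liftE /= [pair_map i _]pair_mapE.
Qed.

Lemma btensor_map_inj : injective btensor_map.
Proof.
apply: linear_inj => q; have [w ->] := proj_surj q; rewrite btensor_mapE !proj_eq0.
(* The relation satisfied by the image of w uses the idempotents of L only. A retraction commuting
   with these carries it back to a relation for w. *)
move=> /idem_balanced_finite [L Lw]; have [r [iK rL]] := equivariant_retraction L.
have -> : w = pair_map r (pair_map i w).
  apply: (@malg_eq _ _ _ idfun (pair_map r \o pair_map i)) => -[x v].
  by rewrite /= [pair_map i _]pair_mapE pair_mapE iK.
pose Q w := span (idem_balanced a (fun=> True)) (pair_map r w).
have Q0 : Q 0 by rewrite /Q linear0; apply: smem0.
have QD x y : Q x -> Q y -> Q (x + y) by rewrite /Q linearD; apply: smemD.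
have QZ k x : Q x -> Q (k *: x) by rewrite /Q linearZ_LR; apply: smemZ.
apply: (span_min (P := Submod Q0 QD QZ) Lw) => _ [x x' v|x v v'|k x v|k x v|e x v eL]; rewrite /= /Q.
- by rewrite !linearB !pair_mapE; apply/span_gen/IdemBalancedDl.
- by rewrite !linearB !pair_mapE linearD; apply/span_gen/IdemBalancedDr.
- by rewrite linearB linearZ_LR !pair_mapE; apply/span_gen/IdemBalancedZl.
- by rewrite linearB linearZ_LR !pair_mapE linearZ_LR; apply/span_gen/IdemBalancedZr.
- by rewrite linearB !pair_mapE rL //; apply/span_gen/IdemBalancedM.
Qed.

(** A balanced map is a K-linear map on the tensor product, and K-linear maps extend along the
    injection [btensor_map]. *)
Theorem balanced_extension (W : lmodType K) (f : X -> V -> W) : balanced_map a f ->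
  exists2 f' : X -> V' -> W, balanced_map a' f' & forall x v, f' x (i v) = f x v.
Proof.
move=> fB; have [g gP] := extend_linear (btensor_lift fB) btensor_map_inj.
exists (fun x v => g (btensor_pt a' x v)); last first.
  move=> x v; rewrite -(btensor_liftE fB) -gP; congr (g _).
  by rewrite btensor_liftE.
split=> [x x' v|x v v'|k x v|k x v|e x v].
- by rewrite btensor_ptDl linearD.
- by rewrite btensor_ptDr linearD.
- by rewrite btensor_ptZl linearZ_LR.
- by rewrite btensor_ptZr linearZ_LR.
- by rewrite btensor_ptM.
Qed.
End BalancedTensor.

Section AdditiveExtension.
Local Open Scope fset.
Local Open Scope ring_scope.
Variables (T : choiceType) (G W : zmodType) (h : T -> G -> W).
Hypothesis hD : forall t, {morph h t : x y / x + y}.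

Lemma add_ext0 t : h t 0 = 0.
Proof. by apply: (addrI (h t 0)); rewrite -hD !addr0. Qed.

(** Unlike in [mext], the coefficients lie in a group [G] (the algebra A below) and each [h t] is
    merely additive. *)
Definition add_ext (w : {malg G[T]}) : W := \sum_(t <- msupp w) h t w@_t.

Lemma add_extw (d : {fset T}) w : msupp w `<=` d -> add_ext w = \sum_(t <- d) h t w@_t.
Proof.
move=> wd; rewrite /add_ext (big_fset_incl _ wd) //= => t _ /mcoeff_outdom ->.
exact: add_ext0.
Qed.

Lemma add_extD x y : add_ext (x + y) = add_ext x + add_ext y.
Proof.
pose d := msupp x `|` msupp y `|` msupp (x + y).
rewrite !(@add_extw d) ?fsubsetUr //.
- by rewrite -big_split; apply: eq_bigr => t _ /=; rewrite mcoeffD hD.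
- by rewrite /d (fsubset_trans _ (fsubsetUl _ _)) // fsubsetUr.
- by rewrite /d (fsubset_trans _ (fsubsetUl _ _)) // fsubsetUl.
Qed.

Lemma add_extU g t : add_ext << g *g t >> = h t g.
Proof. by rewrite (add_extw msuppU_le) big_seq_fset1 mcoeffUU. Qed.

End AdditiveExtension.

(* A KS-linear map V -> T1 (Hom_K((A x S)^e, W)) amounts to a bilinear map
   phi : (A x S) x V -> W with phi (x 1_e) v = phi x (e v) for e in E(S),
   because (A x S)^e (x)_(A^e) A is isomorphic to (A x S) (x)_KE(S) KS. *)
Section T1Injective.
Variables (K : fieldType) (S : invMonoidType) (A : ualgType K) (th : unital_action S A).
Variable W : lmodType K.
Local Notation Lam := (crossed th).
Local Notation u := (aunit th).
Local Notation eta := (eta th).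
Local Notation gen := (gen th).
Local Notation KS := (monalg K S).

Record balanced (V : lmodType KS) (f : Lam -> V -> W) : Prop := Balanced {
  bDl : forall x x' v, f (x + x') v = f x v + f x' v;
  bDr : forall x v v', f x (v + v') = f x v + f x v';
  bZl : forall k x v, f (scal k * x) v = k *: f x v;
  bZr : forall k x v, f x ((scal k : KS) *: v) = k *: f x v;
  bM : forall e x v, idempotent e -> f (x * eta (u e)) v = f x (ms K e *: v) }.

Lemma balanced_extend (V V' : lmodType KS) (i : {linear V -> V'}) f :
  injective i -> balanced f -> exists2 f', balanced f' & forall x v, f' x (i v) = f x v.
Proof.
move=> iI fB.
pose p (e : idems S) (x : kalg Lam) : kalg Lam := (x : Lam) * eta (u (val e)).
pose a (U : lmodType KS) (e : idems S) : {linear kmod U -> kmod U} :=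
  mkLinear (scale_kmod_linear (ms K (val e)) :
    linear ((fun x => ms K (val e) *: (x : U)) : kmod U -> kmod U)).
have fB' : @balanced_map K (kalg Lam) (idems S) p (kmod V) (a V) W f.
  split=> [x x' v|x v v'|k x v|k x v|e x v].
  - exact: (bDl fB).
  - exact: (bDr fB).
  - exact: (bZl fB).
  - exact: (bZr fB).
  - exact/(bM fB)/idemsP.
have [|||f' f'B f'P] := @balanced_extension K (kalg Lam) (idems S) p (kmod V) (kmod V') (a V) (a V')
  (kmap i) iI _ _ _ W f fB'.
- by move=> e v; apply: linearZ_LR.
- by move=> e v; rewrite /= scalerA -msM (idemsP e).
- by move=> e e' v; rewrite /= !scalerA -!msM (idemC (idemsP e) (idemsP e')).
exists f' => //; split=> [x x' v|x v v'|k x v|k x v|e x v ee].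
- exact: (balDl f'B).
- exact: (balDr f'B).
- exact: (balZl f'B).
- exact: (balZr f'B).
- exact: (balM f'B (exist _ e (introT eqP ee))).
Qed.

Section Balanced.
Variable V : lmodType KS.
Implicit Types (f : Lam -> V -> W) (v : V) (x y : Lam) (w : skew th).

(** Since e t = t (t^-1 e t), the idempotent t^-1 e t can cross to v, where it meets t^-1 and leaves
    t^-1 e. *)
Lemma balanced_gen f t e x v : balanced f -> idempotent e ->
  f (x * (gen e * gen t)) (ms K (ginv t) *: v) = f (x * gen t) (ms K (ginv t * e)%g *: v).
Proof.
move=> fB ee.
have ef : idempotent (ginv t * e * t)%g by rewrite -{2}[t]ginvK; apply: idem_conj.
have te : (e * t = t * (ginv t * e * t))%g.
  by rewrite !mulgA (idemC (idem_gV t) ee) -!mulgA (mulgA t) mulgVK.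
rewrite -genM te genM mulrA (gen_idem th ef) (bM fB) // scalerA -msM.
congr (f _ (ms K _ *: v)).
by rewrite -!mulgA (idemC ee (idem_gV t)) !mulgA mulVgK.
Qed.

(** This is the value that f forces at x (x) y, for y the class of w: with y = a s, the element x
    (x) a s is (x a s (x) 1) s^-1. *)
Definition skew_act f w x v : W :=
  add_ext (fun s a => f (x * (eta a * gen s)) (ms K (ginv s) *: v)) (skv w).

Lemma skew_act_additive f x v s : balanced f ->
  {morph (fun a => f (x * (eta a * gen s)) (ms K (ginv s) *: v)) : a b / a + b}.
Proof. by move=> fB a b; rewrite [eta _]raddfD mulrDl mulrDr (bDl fB). Qed.

Lemma skew_actD f w w' x v : balanced f ->
  skew_act f (w + w') x v = skew_act f w x v + skew_act f w' x v.
Proof. by move=> fB; rewrite /skew_act raddfD add_extD // => s; apply: skew_act_additive. Qed.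

Lemma skew_act0 f x v : balanced f -> skew_act f 0 x v = 0.
Proof. by move=> fB; apply: (addrI (skew_act f 0 x v)); rewrite -skew_actD // !addr0. Qed.

Lemma skew_act_delta f s a x v : balanced f ->
  skew_act f (delta th s a) x v = f (x * (eta a * gen s)) (ms K (ginv s) *: v).
Proof.
move=> fB; rewrite /skew_act deltaE add_extU; last by move=> t; apply: skew_act_additive.
by rewrite aunitC etaM -(mulrA (eta a)) eta_gen.
Qed.

Lemma skew_act_balanced f w : balanced f -> balanced (skew_act f w).
Proof.
move=> fB; split=> [x x' v|x v v'|k x v|k x v|e x v ee];
  elim/skew_ind: w => [|w w' IH IH'|s a]; rewrite ?skew_act0 ?skew_actD ?skew_act_delta //.
- by rewrite addr0.
- by rewrite IH IH' addrACA.
- by rewrite mulrDl (bDl fB).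
- by rewrite addr0.
- by rewrite IH IH' addrACA.
- by rewrite scalerDr (bDr fB).
- by rewrite scaler0.
- by rewrite IH IH' scalerDr.
- by rewrite -mulrA (bZl fB).
- by rewrite scaler0.
- by rewrite IH IH' scalerDr.
- by rewrite scalerA -scalC -scalerA (bZr fB).
- by rewrite IH IH'.
rewrite -(gen_idem th ee) -mulrA (mulrA (gen e)) gen_idemC // -mulrA mulrA.
by rewrite (balanced_gen _ _ _ fB ee) -mulrA scalerA -msM.
Qed.

(** The factor nearest to x, here w, is moved across last: first w' transforms f, then w transforms
    the result. *)
Lemma skew_actM f w w' x v : balanced f ->
  skew_act f (w * w') x v = skew_act (skew_act f w') w x v.
Proof.
move=> fB; elim/skew_ind: w => [|w1 w2 IH IH'|s a].
- by rewrite mul0r !skew_act0 //; apply: skew_act_balanced.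
- by rewrite mulrDl !skew_actD ?IH ?IH' //; apply: skew_act_balanced.
rewrite (skew_act_delta _ _ _ _ (skew_act_balanced w' fB)).
elim/skew_ind: w' => [|w1 w2 IH IH'|t b].
- by rewrite mulr0 !skew_act0.
- by rewrite mulrDr !skew_actD ?IH ?IH'.
rewrite deltaM !skew_act_delta //.
rewrite genM etaM ginvM msM -scalerA; congr (f _ _).
by rewrite -!mulrA; congr (_ * (_ * _)); rewrite !mulrA gen_eta.
Qed.

(** With s = e t, the elements a s and a t agree in the crossed product and s^-1 = t^-1 e. The extra
    e is carried across by [balanced_gen]. *)
Lemma skew_act_crossed_rel f w x v : balanced f -> crossed_rel w -> skew_act f w x v = 0.
Proof.
move=> fB [s [t [a [[e ee st] ua ->]]]].
have st' : natural_le s t by exists e.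
have N w1 : skew_act f (- w1) x v = - skew_act f w1 x v.
  by apply/eqP; rewrite -addr_eq0 -skew_actD // addNr skew_act0.
rewrite skew_actD // N !skew_act_delta //; apply/eqP; rewrite subr_eq0; apply/eqP.
have E := eta_gen_le st' ua.
transitivity (f (x * eta a * gen t) (ms K (ginv t * e)%g *: v)).
  by rewrite E mulrA {1}st ginvM (idem_ginv ee).
by rewrite -(balanced_gen _ _ _ fB ee) -genM -st -mulrA E.
Qed.

Lemma skew_act_ideal f w : balanced f -> gideal (@crossed_rel K S A th) w ->
  forall x v, skew_act f w x v = 0.
Proof.
(* Stability under right factors replaces f by [skew_act f c], and stability under left factors
   changes x and v, so all three have to be quantified. *)
pose I w := forall f, balanced f -> forall x v, skew_act f w x v = 0.
have I0 : I 0 by move=> {}f fB x v; apply: skew_act0.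
have ID w1 w2 : I w1 -> I w2 -> I (w1 + w2).
  by move=> I1 I2 {}f fB x v; rewrite skew_actD // I1 // I2 // addr0.
have IMr c w1 : I w1 -> I (w1 * c).
  by move=> I1 {}f fB x v; rewrite skew_actM // I1 //; apply: skew_act_balanced.
have IMl c w1 : I w1 -> I (c * w1).
  move=> I1 {}f fB x v; rewrite skew_actM //; have wB := skew_act_balanced w1 fB.
  elim/skew_ind: c => [|c c' IH IH'|s a]; first exact: skew_act0.
    by rewrite skew_actD // IH IH' addr0.
  by rewrite skew_act_delta // I1.
move=> fB gw; apply: (gw (Ideal I0 ID IMl IMr) _ f fB) => {}w rw {fB gw}f fB x v.
exact: skew_act_crossed_rel.
Qed.

Definition crossed_act f y x v : W := skew_act f (qrep y) x v.

Lemma crossed_act_cls f w x v : balanced f -> crossed_act f (cls w) x v = skew_act f w x v.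
Proof.
move=> fB; apply/eqP; rewrite -subr_eq0; apply/eqP.
have N w1 : - skew_act f w1 x v = skew_act f (- w1) x v.
  by apply/esym/eqP; rewrite -addr_eq0 -skew_actD // addNr skew_act0.
rewrite N -skew_actD //; apply: skew_act_ideal => //.
by apply/(qpiP (gideal (@crossed_rel K S A th))); rewrite qrepK.
Qed.

Lemma crossed_actD f y y' x v : balanced f ->
  crossed_act f (y + y') x v = crossed_act f y x v + crossed_act f y' x v.
Proof.
move=> fB; have [[w ->] [w' ->]] := (qpi_surj y, qpi_surj y').
by rewrite -raddfD -!/(cls _) !crossed_act_cls // skew_actD.
Qed.

Lemma crossed_act_balanced f y : balanced f -> balanced (crossed_act f y).
Proof. exact: skew_act_balanced. Qed.

Lemma crossed_act_gen f a s x v : balanced f ->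
  crossed_act f (eta a * gen s) x v = f (x * (eta a * gen s)) (ms K (ginv s) *: v).
Proof. by move=> fB; rewrite -[in LHS]cls_delta crossed_act_cls // skew_act_delta. Qed.

Lemma crossed_actM f a s y x v : balanced f ->
  crossed_act f (eta a * gen s * y) x v =
  crossed_act f y (x * (eta a * gen s)) (ms K (ginv s) *: v).
Proof.
move=> fB; have [w ->] := qpi_surj y; rewrite -cls_delta -!/(cls _) -clsM.
rewrite !crossed_act_cls // skew_actM // skew_act_delta ?cls_delta //.
exact: skew_act_balanced.
Qed.

Lemma crossed_act_eta f a y x v : balanced f ->
  crossed_act f (eta a * y) x v = crossed_act f y (x * eta a) v.
Proof.
move=> fB; have := crossed_actM a 1%g y x v fB.
by rewrite gen1 !mulr1 ginv1 ms1 scale1r.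
Qed.

Lemma crossed_act_scal f k y x v : balanced f ->
  crossed_act f (scal k * y) x v = k *: crossed_act f y x v.
Proof.
move=> fB; rewrite -(eta_scal th) crossed_act_eta // eta_scal -scalC.
exact: (bZl (crossed_act_balanced y fB)).
Qed.

Section Coinduced.
Variables (f : Lam -> V -> W) (v : V).
Hypothesis fB : balanced f.
Let g x y : W := crossed_act f y x v.
Let gDl y : {morph g^~ y : x x' / x + x'}.
Proof. by move=> x x'; apply: (bDl (crossed_act_balanced y fB)). Qed.
Let gDr x : {morph g x : y y' / y + y'}.
Proof. by move=> y y'; apply: crossed_actD. Qed.
Let gZl k x y : g (scal k * x) y = k *: g x y.
Proof. exact: (bZl (crossed_act_balanced y fB)). Qed.
Let gZr k x y : g x (scal k * y) = k *: g x y.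
Proof. exact: crossed_act_scal. Qed.

Lemma crossed_coindP : @coindP K (env Lam) W (tlift g).
Proof.
by split=> [y z|k y]; [apply: (tliftD gDl gDr gZl gZr) | apply: (tliftZ gDl gDr gZl gZr)].
Qed.
Definition crossed_coind : coind (env Lam) W := mksub (crossed_coindP : coind_sub (env Lam) W _).
Lemma crossed_coindE x y : cfun crossed_coind (tens x y) = crossed_act f y x v.
Proof. by rewrite /cfun inclK; apply: (tliftE gDl gDr gZl gZr). Qed.
End Coinduced.
End Balanced.

Lemma coind0 (h : coind (env Lam) W) : cfun h 0 = 0.
Proof. by apply: (addrI (cfun h 0)); rewrite -cfunD !addr0. Qed.

Lemma coind_env_eq (g h : coind (env Lam) W) :
  (forall x y, cfun g (tens x y) = cfun h (tens x y)) -> g = h.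
Proof.
move=> gh; apply: coind_eq; elim/env_ind => [|z z' IH IH'|//]; first by rewrite !coind0.
by rewrite !cfunD IH IH'.
Qed.

Lemma crossed_coind_central (V : lmodType KS) f (v : V) (fB : balanced f) :
  eta_central (crossed_coind v fB).
Proof.
move=> a; apply: coind_env_eq => x y.
by rewrite !cfun_scale !tensM mulr1 mul1r !crossed_coindE crossed_act_eta.
Qed.

(** The right action of s takes x (x) y to x s (x) s^-1 y. Moving s^-1 back yields x s s^-1 and s v,
    and the idempotent s s^-1 crosses to s v, which it fixes. *)
Lemma crossed_coind_ms (V : lmodType KS) f (v : V) s (fB : balanced f) :
  crossed_coind (ms K s *: v) fB = cross_gen th s *: crossed_coind v fB.
Proof.
apply: coind_env_eq => x y; rewrite cfun_scale /cross_gen tensM !crossed_coindE.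
rewrite -[gen (ginv s)]mul1r -[1 in RHS](rmorph1 eta) crossed_actM // rmorph1 mul1r.
have eV := idem_gV s; have yB := crossed_act_balanced y fB.
rewrite ginvK -mulrA -genM (gen_idem th eV) (bM yB) //.
by rewrite scalerA -msM mulgVK.
Qed.

Theorem T1_coind_injective :
  injective_module (T1_ob (coind (env Lam) W : lmodType (env Lam)) : lmodType KS).
Proof.
move=> V V' i F iI.
pose m v : coind (env Lam) W := T1_value (F v).
have mD v v' : m (v + v') = m v + m v'.
  exact: etrans (congr1 (@T1_value _ _ _ _ _) (linearD F v v')) (T1_valueD _ _).
have mZ k v : m ((scal k : KS) *: v) = (scal k : env Lam) *: m v.
  exact: etrans (congr1 (@T1_value _ _ _ _ _) (linearZ_LR F (scal k) v)) (T1_value_scal k (F v)).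
have mS s v : m (ms K s *: v) = cross_gen th s *: m v.
  exact: etrans (congr1 (@T1_value _ _ _ _ _) (linearZ_LR F (ms K s) v)) (T1_value_ms s (F v)).
have mC v a x y : cfun (m v) (tens (x * eta a) y) = cfun (m v) (tens x (eta a * y)).
  have := congr1 (fun h => cfun h (tens x y)) (T1_value_central (F v) a).
  by rewrite !cfun_scale !tensM mulr1 mul1r.
(* The values on x (x) 1 determine everything else, by [mS] and [mC]. *)
pose f x v := cfun (m v) (tens x 1).
have fB : balanced f.
  split=> [x x' v|x v v'|k x v|k x v|e x v ee]; rewrite /f.
  - by rewrite tensDl cfunD.
  - by rewrite mD.
  - by rewrite tensZl cfunZ.
  - by rewrite mZ cfun_scale -scalC cfunZ.
  rewrite mS cfun_scale /cross_gen tensM (idem_ginv ee) gen_idem // mulr1.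
  by rewrite !mC mulr1 -etaM aunit_idem.
have [f' f'B f'P] := balanced_extend iI fB.
pose G v := T1_mk (crossed_coind_central v f'B).
have GE v : T1_value (G v) = crossed_coind v f'B by apply: T1_mkK.
have Gval v v' :
    (forall x y, cfun (T1_value (G v)) (tens x y) = cfun (T1_value v') (tens x y)) -> G v = v'.
  by move=> e; apply/T1_value_inj/coind_env_eq.
have GL : linear G.
  apply: monalg_linear => [v v'|k v|s v].
  - apply: Gval => x y; rewrite T1_valueD !GE cfun_add !crossed_coindE.
    exact: (bDr (crossed_act_balanced y f'B)).
  - apply: Gval => x y; rewrite (T1_value_scal k (G v)) !GE.
    rewrite (cfun_scale _ (crossed_coind v f'B)) -scalC cfunZ !crossed_coindE.
    exact: (bZr (crossed_act_balanced y f'B)).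
  - by apply: T1_value_inj; rewrite (T1_value_ms s (G v)) !GE crossed_coind_ms.
exists (mkLinear GL) => v; apply: Gval => x y; rewrite GE crossed_coindE.
elim/crossed_ind: y => [|y y' IH IH'|a s].
- rewrite tens0r coind0; apply: (addrI (crossed_act f' 0 x (i v))).
  by rewrite -crossed_actD // !addr0.
- by rewrite crossed_actD // tensDr cfunD IH IH'.
(* Here x (x) a s is recovered from the values on the elements z (x) 1: the action of s^-1 produces
   x a s s^-1 (x) s, and s s^-1, lying in A, moves to the right factor. *)
rewrite crossed_act_gen // -linearZ_LR f'P /f mS cfun_scale /cross_gen tensM ginvK mulr1.
rewrite -!mulrA -genM (gen_idem th (idem_gV s)) -etaM mC etaM -mulrA -(gen_idem th (idem_gV s)).
by rewrite -genM mulgVK.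
Qed.
End T1Injective.

(** * Restriction of coinduced modules along a flat morphism *)

Section TensorTheory.
Variables (R : pzRingType) (M : lmodType R^c).

Section Elements.
Variable N : lmodType R.

Lemma tensor_ptDl (x x' : M) (y : N) : tensor_pt (x + x') y = tensor_pt x y + tensor_pt x' y.
Proof.
rewrite /tensor_pt -[RHS]linearD; apply/projP; rewrite opprD addrA.
exact/span_gen/BalancedDl.
Qed.
Lemma tensor_ptDr (x : M) (y y' : N) : tensor_pt x (y + y') = tensor_pt x y + tensor_pt x y'.
Proof.
rewrite /tensor_pt -[RHS]linearD; apply/projP; rewrite opprD addrA.
exact/span_gen/BalancedDr.
Qed.
Lemma tensor_ptM (x : M) (r : R) (y : N) : tensor_pt ((r : R^c) *: x) y = tensor_pt x (r *: y).
Proof. exact/projP/span_gen/BalancedM. Qed.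
Lemma tensor_pt0 (x : M) : tensor_pt x (0 : N) = 0.
Proof. by apply: (addrI (tensor_pt x 0)); rewrite -tensor_ptDr !addr0. Qed.

Lemma tensor_ind (P : tensor M N -> Prop) :
  P 0 -> (forall s t, P s -> P t -> P (s + t)) -> (forall x y, P (tensor_pt x y)) ->
  forall t, P t.
Proof.
move=> P0 PD Ppt t; have PN x y : P (- tensor_pt x y).
  suff -> : - tensor_pt x y = tensor_pt x (- y) by apply: Ppt.
  by apply/eqP; rewrite eq_sym -addr_eq0 -tensor_ptDr addNr tensor_pt0.
have Pz x y (z : int) : P (z *: tensor_pt x y).
  case: z => n.
    elim: n => [|n IH]; first by rewrite scale0r.
    by rewrite -addn1 PoszD scalerDl scale1r; apply: PD.
  rewrite NegzE; elim: n => [|n IH]; first by rewrite scaleN1r; apply: PN.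
  by rewrite -addn1 PoszD opprD scalerDl scaleN1r; apply: PD.
have [w ->] := proj_surj t; rewrite [w]monalgE linear_sum; elim/big_ind: _ => // -[x y] _.
have -> : << w@_(x, y) *g (x, y) >> = w@_(x, y) *: bpt x y.
  by apply/malgP => k; rewrite mcoeffZ !mcoeffU mulrnAr mulr1.
by rewrite linearZ_LR; apply: Pz.
Qed.

Section Lift.
Variables (T : lmodType int) (g : M -> N -> T).
Hypotheses (gDl : forall x x' y, g (x + x') y = g x y + g x' y)
           (gDr : forall x y y', g x (y + y') = g x y + g x y')
           (gM : forall x (r : R) y, g ((r : R^c) *: x) y = g x (r *: y)).
Let h : {linear {malg int[(M * N)%type]} -> T} := mext (fun p : M * N => g p.1 p.2).
Lemma tensor_liftP w : span (@balanced_rel R M N) w -> h w = 0.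
Proof.
have hE x y : h (bpt x y) = g x y by rewrite [LHS]mextU scale1r.
move=> wB; apply: (span_min (P := kerm h) wB) => _ [x x' y|x y y'|x r y].
- by rewrite /= !linearB !hE gDl addrAC addrK subrr.
- by rewrite /= !linearB !hE gDr addrAC addrK subrr.
- by rewrite /= linearB !hE gM subrr.
Qed.
Definition tensor_lift : {linear tensor M N -> T} := mkLinear (qlift_is_linear tensor_liftP).
Lemma tensor_liftE x y : tensor_lift (tensor_pt x y) = g x y.
Proof. by rewrite [LHS](qliftE tensor_liftP) [LHS]mextU scale1r. Qed.
End Lift.
End Elements.

Lemma tensor_mapD (N N' : lmodType R) (f : {linear N -> N'}) (s t : tensor M N) :
  tensor_map f (s + t) = tensor_map f s + tensor_map f t.
Proof.
pose g (x : M) (y : N) : tensor M N' := tensor_pt x (f y).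
have gDl x x' y : g (x + x') y = g x y + g x' y by apply: tensor_ptDl.
have gDr x y y' : g x (y + y') = g x y + g x y' by rewrite /g linearD tensor_ptDr.
have gM x (r : R) y : g ((r : R^c) *: x) y = g x (r *: y) by rewrite /g linearZ_LR tensor_ptM.
exact: (linearD (tensor_lift gDl gDr gM)).
Qed.

Lemma tensor_map0 (N N' : lmodType R) (f : {linear N -> N'}) : tensor_map f (0 : tensor M N) = 0.
Proof. by apply: (addrI (tensor_map f 0)); rewrite -tensor_mapD !addr0. Qed.
End TensorTheory.

(** * The K-module structure of a tensor product over a K-algebra *)

Section ScalarTensor.
Variables (K : fieldType) (R : ualgType K) (M : lmodType R^c).

Section Scale.
Variable N : lmodType R.
Lemma central_scale_linear (k : K) : linear (fun n : N => (scal k : R) *: n).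
Proof. by move=> a x y; rewrite scalerDr !scalerA scalC. Qed.
Definition central_scale k : {linear N -> N} := mkLinear (central_scale_linear k).

Definition tensor_scale (k : K) (t : tensor M N) : tensor M N := tensor_map (central_scale k) t.

Lemma tensor_scaleE k x y : tensor_scale k (tensor_pt x y) = tensor_pt x ((scal k : R) *: y).
Proof. exact: tensor_mapE. Qed.
Lemma tensor_scaleDr k s t : tensor_scale k (s + t) = tensor_scale k s + tensor_scale k t.
Proof. exact: tensor_mapD. Qed.
Lemma tensor_scale0 k : tensor_scale k 0 = 0.
Proof. exact: tensor_map0. Qed.
Lemma tensor_scaleA a b t : tensor_scale a (tensor_scale b t) = tensor_scale (a * b) t.
Proof.
elim/tensor_ind: t => [|s t IH IH'|x y]; first by rewrite !tensor_scale0.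
  rewrite (tensor_scaleDr b) (tensor_scaleDr a) (tensor_scaleDr (a * b)).
  exact: (congr2 +%R IH IH').
by rewrite (tensor_scaleE b) (tensor_scaleE a) (tensor_scaleE (a * b)) scalerA -(rmorphM (@scal K R)).
Qed.
Lemma tensor_scale1 t : tensor_scale 1 t = t.
Proof.
elim/tensor_ind: t => [|s t IH IH'|x y]; first by rewrite tensor_scale0.
  by rewrite tensor_scaleDr; apply: (congr2 +%R IH IH').
by rewrite tensor_scaleE (rmorph1 (@scal K R)) scale1r.
Qed.
Lemma tensor_scaleDl a b t : tensor_scale (a + b) t = tensor_scale a t + tensor_scale b t.
Proof.
elim/tensor_ind: t => [|s t IH IH'|x y]; first by rewrite !tensor_scale0 addr0.
  rewrite (tensor_scaleDr a) (tensor_scaleDr b) (tensor_scaleDr (a + b)) [RHS]addrACA.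
  exact: (congr2 +%R IH IH').
by rewrite (tensor_scaleE a) (tensor_scaleE b) (tensor_scaleE (a + b))
  (rmorphD (@scal K R)) scalerDl tensor_ptDr.
Qed.

(* M (x)_R N with K acting by k (x (x) y) = x (x) (k y) *)
Definition ktensor : Type := tensor M N.
HB.instance Definition _ := GRing.Zmodule.copy ktensor (tensor M N).
HB.instance Definition _ := GRing.Zmodule_isLmodule.Build K ktensor
  tensor_scaleA tensor_scale1 tensor_scaleDr (fun t a b => tensor_scaleDl a b t).
Lemma ktensorZ k x y : k *: (tensor_pt x y : ktensor) = tensor_pt x ((scal k : R) *: y).
Proof. exact: tensor_scaleE. Qed.
End Scale.

Lemma ktensor_map_linear (N N' : lmodType R) (f : {linear N -> N'}) :
  linear (tensor_map f : ktensor N -> ktensor N').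
Proof.
have Z k t : tensor_map f (tensor_scale k t) = tensor_scale k (tensor_map f t).
  elim/tensor_ind: t => [|s t IH IH'|x y].
  - by rewrite (tensor_scale0 N k) (tensor_map0 M f) (tensor_scale0 N' k).
  - rewrite (tensor_scaleDr k s t) (tensor_mapD f (tensor_scale k s)) (tensor_mapD f s).
    rewrite (tensor_scaleDr k (tensor_map f s)); exact: (congr2 +%R IH IH').
  - rewrite (tensor_scaleE k x y) (tensor_mapE f x y) (tensor_scaleE k x (f y)).
    by rewrite (tensor_mapE f x) linearZ_LR.
by move=> k s t; rewrite -[RHS]/(tensor_scale k (tensor_map f s) + tensor_map f t) -Z -tensor_mapD.
Qed.
End ScalarTensor.

Section FlatCoinduction.
Variables (K : fieldType) (R R' : ualgType K) (phi : {rmorphism R -> R'}).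
Hypothesis phiK : forall k, phi (scal k) = scal k.
Variable W : lmodType K.

(* Hom_R(N, Hom_K(R', W)) = Hom_K(R' (x)_R N, W) *)
Theorem flat_coind_injective : flat (rres phi) -> injective_module (res phi (coind R' W) : lmodType R).
Proof.
move=> fl N N' i f iI.
have fZ (r : R) n : (f (r *: n) : coind R' W) = phi r *: (f n : coind R' W) by apply: (linearZ_LR f).
have fD n n' : (f (n + n') : coind R' W) = (f n : coind R' W) + f n' by apply: (linearD f).
pose g (x : rres phi) (n : N) : zmodule W := cfun (f n) (x : R').
have gDl x x' n : g (x + x') n = g x n + g x' n by apply: cfunD.
have gDr x n n' : g x (n + n') = g x n + g x n' by rewrite /g fD.
have gM x (r : R) n : g ((r : R^c) *: x) n = g x (r *: n) by rewrite /g fZ cfun_scale.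
pose l : ktensor (rres phi) N -> W := tensor_lift gDl gDr gM.
have lE x n : l (tensor_pt x n) = cfun (f n) (x : R').
  exact: (tensor_liftE gDl gDr gM x n).
have lD s t : l (s + t) = l s + l t by apply: (linearD (tensor_lift gDl gDr gM)).
have l0 : l 0 = 0 by apply: (addrI (l 0)); rewrite -lD !addr0.
have lL : linear l.
  move=> k s t; rewrite lD; congr (_ + _).
  elim/tensor_ind: s => [|s s' IH IH'|x n]; first by rewrite scaler0 l0 scaler0.
    apply: etrans (congr1 l (tensor_scaleDr k s s')) _; rewrite (lD (tensor_scale k s)) (lD s).
    by rewrite (scalerDr k (l s)); apply: (congr2 +%R IH IH').
  by rewrite ktensorZ !lE fZ cfun_scale phiK -scalC cfunZ.
(* By flatness the tensored map stays injective, so the functional [l] extends over the field K. *)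
have [G GP] := @extend_linear K _ _ _ (mkLinear (ktensor_map_linear i)) (mkLinear lL) (fl _ _ i iI).
pose F n (x : R') : W := G (tensor_pt (x : rres phi) n).
have FM n (r : R) x : F n (x * phi r) = F (r *: n) x.
  by rewrite /F -tensor_ptM.
have FP n : coindP (F n).
  split=> [x y|k x]; first by rewrite /F [tensor_pt _ _]tensor_ptDl linearD.
  by rewrite scalC -phiK FM /F -ktensorZ linearZ_LR.
pose F' n : res phi (coind R' W) := mksub (FP n : coind_sub R' W _).
have F'E n x : cfun (F' n) x = F n x by rewrite /cfun inclK.
have FL : linear F'.
  move=> r n n'; apply: (@coind_eq _ _ _ (F' (r *: n + n')) (phi r *: (F' n : coind R' W) + F' n')) => x.
  by rewrite cfun_add cfun_scale !F'E FM /F tensor_ptDr linearD.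
exists (mkLinear FL) => n; apply: (@coind_eq _ _ _ (F' (i n)) (f n)) => x.
by rewrite F'E /F -lE -[RHS]GP /= tensor_mapE.
Qed.
End FlatCoinduction.

(** * The main theorem *)

Section ScalarRestriction.
Variables (K : pzRingType) (R : ualgType K) (C : cocomplex R).

Lemma kmod_dif_linear n : linear (dif C n : kmod (C n) -> kmod (C n.+1)).
Proof. by move=> k x y; rewrite !kmodZ; apply: linearP. Qed.
Definition kmod_cocomplex : cocomplex K :=
  @Cocomplex K (fun n => kmod (C n)) (fun n => mkLinear (@kmod_dif_linear n)) (@dif_dif _ C).

Lemma kmod_cohomology n : lmod_iso (kmod (cohomology C n)) (cohomology kmod_cocomplex n).
Proof.
pose r (X : kmod (cohomology C n)) (Y : cohomology kmod_cocomplex n) :=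
  exists x : C n, represents x (X : cohomology C n) /\ represents (x : kmod (C n)) Y.
have B (x : C n) : coboundaries C n x <-> coboundaries kmod_cocomplex n (x : kmod (C n)).
  by move: x; case: n {r} => [|m] x.
apply: (@linear_relation_iso _ _ _ r).
- move=> k X X' Y Y' [x [xX xY]] [x' [xX' xY']]; exists ((scal k : R) *: x + x').
  split; first exact: represents_linear.
  exact: (represents_linear k xY xY').
- move=> X; have [x Zx xX] := represents_ex (X : cohomology C n).
  have [Y xY] := represents_class (coboundaries kmod_cocomplex n)
    (Zx : cocycles kmod_cocomplex n (x : kmod (C n))).
  by exists Y, x.
- move=> Y; have [x Zx xY] := represents_ex Y.
  have [X xX] := represents_class (coboundaries C n) (Zx : cocycles C n (x : C n)).
  by exists X, x.
- move=> X Y [x [xX xY]].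
  by apply: iff_trans (iff_sym (represents0 xX)) _; apply: iff_trans (B x) (represents0 xY).
Qed.
End ScalarRestriction.

Section Restriction.
Variables (R R' : pzRingType) (phi : {rmorphism R -> R'}).
Lemma res_map_linear (M N : lmodType R') (f : {linear M -> N}) : linear (f : res phi M -> res phi N).
Proof. by move=> a x y; apply: linearP. Qed.
Definition res_map (M N : lmodType R') (f : {linear M -> N}) : {linear res phi M -> res phi N} :=
  mkLinear (res_map_linear f).
Definition res_cocomplex (C : cocomplex R') : cocomplex R :=
  @Cocomplex R (fun n => res phi (C n)) (fun n => res_map (dif C n)) (@dif_dif _ C).
End Restriction.

Section Main.
Variables (K : fieldType) (S : invMonoidType) (A : ualgType K) (th : unital_action S A).
Variable M : lmodType (env (crossed th)).
Local Notation I := (standard_resolution M).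
Local Notation T1I := (map_cocomplex (T1 th) I).

(** [Hochschild] uses the standard resolution over A^e, while R^q T1 uses the one over the
    enveloping algebra of the crossed product, so [injective_resolution_Ext] is applied to the
    restriction of the latter. *)
Theorem HochschildS_kmod q : flat (rres (eta_env th)) ->
  lmod_iso (kmod (HochschildS q M)) (Hochschild q (res (eta_env th) M)).
Proof.
move=> fl; apply: lmod_iso_trans (kmod_cohomology T1I q) _.
pose resI := res_cocomplex (eta_env th) I.
have resI_inj n : injective_module (resI n).
  exact: (flat_coind_injective (@eta_env_scal _ _ _ th) fl).
apply: lmod_iso_trans _ (@injective_resolution_Ext K (env A) (regbimod A) resI resI_inj
  (res (eta_env th) M) (res_map _ (iaug I)) (iaug_inj (i := I)) (ires_exact0 (i := I))
  (ires_exact (i := I)) q).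
(* Both complexes consist of the same bimodule maps. K scales them through KS in one and directly in
   the other, with the same result. *)
pose W n := hom (regbimod A) (resI n).
have vL n : linear (id : kmod (T1I n) -> W n).
  by move=> k x y; rewrite kmodZ [X in X + _]repmod_scal.
apply: (@cocomplex_iso K (kmod_cocomplex T1I) (map_cocomplex (hom_functor (regbimod A)) resI) W
  (fun n => dif (map_cocomplex (hom_functor (regbimod A)) resI) n)
  (fun n => mkLinear (vL n)) (fun n => idfun)) => //.
  by move=> n x y.
by move=> n x; apply: (@homP _ _ (regbimod A) (resI n.+1)).
Qed.

Lemma KE_value_linear (N : lmodType (env (crossed th))) :
  linear (@KE_value K S A th N : _ -> kmod N).
Proof.
move=> k f g; rewrite kmodZ /KE_value homD homZ T1_valueD; congr (_ + _).
exact: T1_value_scal.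
Qed.

Lemma hom_value_linear (R : ualgType K) (N : lmodType (env R)) :
  linear ((fun h => homlin h (1 : R)) : hom (regbimod R) N -> kmod N).
Proof. by move=> k f g; rewrite homD homZ. Qed.

(** Evaluation, at the idempotent 1 and then at 1 in A, or at 1 in the crossed product, embeds each
    complex in I. Both images are the central elements. *)
Lemma hom_KE_T1 n : lmod_iso (cohomology (map_cocomplex (hom_functor (KE K S)) T1I) n) (Hochschild n M).
Proof.
apply: (@cocomplex_iso K (map_cocomplex (hom_functor (KE K S)) T1I)
  (map_cocomplex (hom_functor (regbimod (crossed th))) I) (fun n => kmod (I n))
  (fun n => kmap (dif I n)) (fun n => mkLinear (@KE_value_linear (I n)))
  (fun n => mkLinear (@hom_value_linear (crossed th) (I n)))) => [{}n|{}n|{}n x|{}n x|{}n w].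
- exact: KE_value_inj.
- by move=> f g fg; apply: hom_value_inj.
- by [].
- by [].
split=> [[f ->]|[h ->]].
  have cn := KE_value_central f; exists (central_hom cn).
  by apply/esym/(etrans (central_homE cn 1)); rewrite tens1 scale1r.
exact: (KE_value_surj (hom_value_central h)).
Qed.
End Main.

Theorem corollary5p10 (K : fieldType) (S : invMonoidType) (A : ualgType K)
    (theta : unital_action S A) :
  flat (rres (eta_env theta)) ->
  forall M : lmodType (env (crossed theta)),
    (forall q : nat,
       lmod_iso (kmod (HochschildS q M)) (Hochschild q (res (eta_env theta) M))) /\
    exists E : spectral_sequence K,
      (forall p q : nat, lmod_iso (page E 2 p q) (Hmon p (HochschildS q M))) /\
      converges_to E (fun n => Hochschild n M).
Proof.
move=> fl M; split=> [q|]; first exact: HochschildS_kmod.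
pose U := map_cocomplex (T1 theta) (standard_resolution M).
have U_inj q : injective_module (U q) by apply: T1_coind_injective.
exists (total_spectral_sequence (ext_double_complex (KE K S) U)); split=> [p q|].
  (* [HochschildS q M] unfolds to [cohomology U q]. *)
  exact: (ext_second_page (KE K S) U p q).
apply: filtered_convergence => n.
exact: lmod_iso_trans (ext_total (KE K S) U_inj n) (hom_KE_T1 M n).
Qed.
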